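(* Let $k,\alpha>0$, $\gamma,\omega\in\mathbb{R}$, $\mu\in(0,1)$, $\nu\in[0,1]$, $0<t<b<\infty$, and let $f\in AC^{1}[0,b]$. Then the $k$-Hilfer-Prabhakar fractional derivative of $f$ and its regularized version are related by $${}_{k}^{C}\mathcal{D}_{\alpha,\omega,0^{+}}^{\gamma,\mu,\nu}f(t)={}_{k}\mathcal{D}_{\alpha,\omega,0^{+}}^{\gamma,\mu,\nu}f(t)-t^{-\frac{\mu}{k}}E_{k,\alpha,k-\mu}^{-\gamma}\big(\omega t^{\frac{\alpha}{k}}\big)f(0^{+}).$$
   Context: $AC^{1}[0,b]$ is the set of real-valued absolutely continuous functions on $[0,b]$. The $k$-gamma function is $\Gamma_k(z)=\int_0^\infty e^{-t^k/k}t^{z-1}\,dt$, and the $k$-Pochhammer symbol is $(\gamma)_{n,k}=\gamma(\gamma+k)\cdots(\gamma+(n-1)k)$, with $(\gamma)_{0,k}=1$. The $k$-Mittag-Leffler function is $E_{k,\alpha,\mu}^{\gamma}(z)=\sum_{n=0}^\infty \frac{(\gamma)_{n,k}}{\Gamma_k(\alpha n+\mu)}\frac{z^n}{n!}$ (defined for $\operatorname{Re}\alpha>0$, $\operatorname{Re}\mu>0$). The $k$-Prabhakar integral (defined for $\operatorname{Re}\alpha>0$, $\operatorname{Re}\mu>0$) is $$\big({}_{k}P_{\alpha,\mu,\omega}^{\gamma}f\big)(x)=\big({}_{k}P_{\alpha,\mu,\omega,0^+}^{\gamma}f\big)(x)=\int_0^x\frac{(x-t)^{\frac{\mu}{k}-1}}{k}E_{k,\alpha,\mu}^{\gamma}\big[\omega(x-t)^{\frac{\alpha}{k}}\big]f(t)\,dt=\big({}_{k}\varepsilon_{\alpha,\mu,\omega}^{\gamma}*f\big)(x),$$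 where ${}_{k}\varepsilon_{\alpha,\mu,\omega}^{\gamma}(t)=\frac{t^{\mu/k-1}}{k}E_{k,\alpha,\mu}^{\gamma}(\omega t^{\alpha/k})$ for $t>0$ and $0$ for $t\le 0$, $*$ is the convolution $(f*g)(t)=\int_0^t f(t-u)g(u)\,du$, and ${}_{k}P_{\alpha,0,\omega}^{0}$ is the identity. For $f\in L^1[0,b]$ with $\big(f*{}_{k}\varepsilon_{\alpha,(1-\nu)(k-\mu),\omega}^{-\gamma(1-\nu)}\big)\in AC^1[0,b]$, the $k$-Hilfer-Prabhakar fractional derivative of order $\mu$ is $${}_{k}\mathcal{D}_{\alpha,\omega,0^{+}}^{\gamma,\mu,\nu}f(t)=k\Big({}_{k}P_{\alpha,\nu(k-\mu),\omega,0^{+}}^{-\gamma\nu}\frac{d}{dt}\big({}_{k}P_{\alpha,(1-\nu)(k-\mu),\omega,0^{+}}^{-\gamma(1-\nu)}f\big)\Big)(t),$$ and for $f\in AC^1[0,b]$ its regularized version is $${}_{k}^{C}\mathcal{D}_{\alpha,\omega,0^{+}}^{\gamma,\mu,\nu}f(t)=k\Big({}_{k}P_{\alpha,\nu(k-\mu),\omega,0^{+}}^{-\gamma\nu}\,{}_{k}P_{\alpha,(1-\nu)(k-\mu),\omega,0^{+}}^{-\gamma(1-\nu)}\frac{d}{dt}f\Big)(t)=k\Big({}_{k}P_{\alpha,k-\mu,\omega,0^{+}}^{-\gamma}\frac{d}{dt}f\Big)(t).$$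
   Formalization: For ν=1 we assume f(0)=0: there both derivatives coincide, so the formula fails e.g. for f=1. We also assume μ<k, needed for E_{k,α,k-μ} to be defined, and assert the formula at every t in (0,b) where both derivatives exist, which is shown to be a.e. t. *)

(* Defs.v *)
From HB Require Import structures.
From mathcomp Require Import all_boot all_order all_algebra.
From mathcomp Require Import all_classical all_reals all_analysis.

Set Implicit Arguments.
Unset Strict Implicit.
Unset Printing Implicit Defensive.

Import Order.TTheory GRing.Theory Num.Theory.
Import numFieldNormedType.Exports.

Local Open Scope classical_set_scope.
Local Open Scope ring_scope.

(* The subintervals are the ]l i, r i[; they may be degenerate, which does not
   change the notion. *)
Definition abs_continuous (R : realType) (a b : R) (f : R -> R) : Prop :=
  forall e : R, 0 < e -> exists2 d : R, 0 < d &
    forall (n : nat) (l r : 'I_n -> R),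
      (forall i, a <= l i /\ l i <= r i /\ r i <= b) ->
      trivIset setT (fun i => `]l i, r i[%classic) ->
      \sum_(i < n) (r i - l i) < d ->
      \sum_(i < n) `|f (r i) - f (l i)| < e.

Definition kGamma (R : realType) (k z : R) : R :=
  \int[@lebesgue_measure R]_(t in `]0, +oo[)
    (expR (- (t `^ k / k)) * t `^ (z - 1)).

Definition kPochhammer (R : realType) (k c : R) (n : nat) : R :=
  \prod_(i < n) (c + i%:R * k).

(* E_{k,alpha,mu}^c (z), meaningful for k, alpha, mu > 0. *)
Definition kMittagLeffler (R : realType) (k alpha mu c z : R) : R :=
  limn (series (fun n : nat =>
    kPochhammer k c n / kGamma k (n%:R * alpha + mu) * (z ^+ n / n`!%:R))).

Definition kPrabhakar_kernel (R : realType) (k alpha mu omega c t : R) : R :=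
  if 0 < t then
    t `^ (mu / k - 1) / k
      * kMittagLeffler k alpha mu c (omega * t `^ (alpha / k))
  else 0.

Definition convolution (R : realType) (f g : R -> R) (t : R) : R :=
  \int[@lebesgue_measure R]_(u in `]0, t[) (f (t - u) * g u).

(* {}_k P_{alpha,mu,omega}^c f, meaningful for mu > 0 and for mu = c = 0, in
   which case it is the identity.  Where the convolution integral does not
   converge absolutely the value is irrelevant: see kPrabhakar_defined. *)
Definition kPrabhakar (R : realType) (k alpha mu omega c : R) (f : R -> R)
    (x : R) : R :=
  if (mu == 0) && (c == 0) then f x
  else convolution (kPrabhakar_kernel k alpha mu omega c) f x.

(* {}_k P_{alpha,mu,omega}^c f exists at x, for a function f whose values are
   meaningful only on the set A: the identity requires x in A, the integral
   requires f to be given almost everywhere on ]0, x[ and absolute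
   convergence. *)
Definition kPrabhakar_defined (R : realType) (k alpha mu omega c : R)
    (A : set R) (f : R -> R) (x : R) : Prop :=
  if (mu == 0) && (c == 0) then A x
  else {ae @lebesgue_measure R, forall u, 0 < u < x -> A u} /\
    (@lebesgue_measure R).-integrable `]0, x[
      (EFin \o (fun u => kPrabhakar_kernel k alpha mu omega c (x - u) * f u)).

Definition kHilferPrabhakar (R : realType) (k alpha omega c mu nu : R)
    (f : R -> R) (t : R) : R :=
  k * kPrabhakar k alpha (nu * (k - mu)) omega (- (c * nu))
    (derive1
      (kPrabhakar k alpha ((1 - nu) * (k - mu)) omega (- (c * (1 - nu))) f)) t.

(* The functions on [0, b] whose k-Hilfer-Prabhakar derivative is considered. *)
Definition kHilferPrabhakar_class (R : realType) (k alpha omega c mu nu b : R)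
    (f : R -> R) : Prop :=
  (@lebesgue_measure R).-integrable `[0, b] (EFin \o f) /\
  abs_continuous 0 b
    (kPrabhakar k alpha ((1 - nu) * (k - mu)) omega (- (c * (1 - nu))) f).

(* The derivative of an absolutely continuous function is meaningful only
   where it is derivable (derive1 is total). *)
Definition kHilferPrabhakar_defined (R : realType)
    (k alpha omega c mu nu : R) (f : R -> R) (t : R) : Prop :=
  let g :=
    kPrabhakar k alpha ((1 - nu) * (k - mu)) omega (- (c * (1 - nu))) f in
  kPrabhakar_defined k alpha (nu * (k - mu)) omega (- (c * nu))
    [set u | derivable g u 1] (derive1 g) t.

Definition kHilferPrabhakarReg (R : realType) (k alpha omega c mu nu : R)
    (f : R -> R) (t : R) : R :=
  k * kPrabhakar k alpha (nu * (k - mu)) omega (- (c * nu))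
    (kPrabhakar k alpha ((1 - nu) * (k - mu)) omega (- (c * (1 - nu)))
      (derive1 f)) t.

Definition kHilferPrabhakarReg_defined (R : realType)
    (k alpha omega c mu nu : R) (f : R -> R) (t : R) : Prop :=
  kPrabhakar_defined k alpha (nu * (k - mu)) omega (- (c * nu))
    (kPrabhakar_defined k alpha ((1 - nu) * (k - mu)) omega (- (c * (1 - nu)))
      [set u | derivable f u 1] (derive1 f))
    (kPrabhakar k alpha ((1 - nu) * (k - mu)) omega (- (c * (1 - nu)))
      (derive1 f)) t.

(* Main.v *)
Require Import Defs.
From HB Require Import structures.
From mathcomp Require Import all_boot all_order all_algebra.
From mathcomp Require Import all_classical all_reals all_analysis.
From mathcomp Require Import measurable_realfun ring lra.
Import Order.TTheory GRing.Theory Num.Theory.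
Import numFieldNormedType.Exports.
Local Open Scope classical_set_scope.
Local Open Scope ring_scope.
Set Implicit Arguments.
Unset Strict Implicit.
Unset Printing Implicit Defensive.

(** Write K_{m,c} for the Prabhakar kernel of order m and parameter c, K1 and
    K2 for the kernels of the inner operator (order (1 - nu)(k - mu)) and of
    the outer one (order nu (k - mu)), and g = K1 * f, where * is convolution.
    Since f = f(0) + int f', exchanging the two integrations gives
    g(x) = int_0^x (K1 * f' + f(0) K1), so that g is absolutely continuous and
    g' = K1 * f' + f(0) K1 almost everywhere ([convolution_abs_continuous]).
    Convolving with K2,
      K2 * g' = K2 * (K1 * f') + f(0) (K2 * K1),
    and the semigroup law K_{m1,c1} * K_{m2,c2} = K_{m1+m2,c1+c2}
    ([kPrabhakar_kernel_conv]) identifies the last product with the kernel of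
    order k - mu and parameter -gamma, k times which is
    t^(-mu/k) E(omega t^(alpha/k)).

    The semigroup law is obtained by multiplying the two Mittag-Leffler series:
    each pair of monomials is convolved by a Beta integral ([kGamma_beta]), and
    the coefficients are collected by the Vandermonde identity for the
    Pochhammer symbols ([kPoch_factD]); the superexponential growth of the
    gamma function ([kGamma_growth]) makes all the series absolutely convergent.
    The other ingredient is the Lebesgue fundamental theorem of calculus for
    absolutely continuous functions ([abs_continuous_derive1]), which follows
    from the Radon-Nikodym theorem.  Almost everywhere existence of the
    iterated integrals is Fubini's theorem ([lconv_ae_integrable]).

    At the two ends of the range of nu one of the operators is the identity.
    For nu = 1 the two derivatives are the same expression, and f(0) = 0.  For
    nu = 0 the outer operator is the identity, and g' = K1 * f' + f(0) K1 is
    needed at every point where g is derivable and K1 * f' converges, which is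
    more than the almost everywhere statement; it is shown by dominated
    convergence of left difference quotients ([convolution_derivative]). *)

(** * Almost everywhere equality for the Lebesgue measure *)

Lemma ae_imp (R : realType) (P Q : R -> Prop) : (forall x, P x -> Q x) ->
  {ae @lebesgue_measure R, forall x, P x} ->
  {ae @lebesgue_measure R, forall x, Q x}.
Proof.
move=> PQ; apply: filterS; first exact: (ae_filter_ringOfSetsType lebesgue_measure).
exact: PQ.
Qed.

Lemma ae_and (R : realType) (P Q : R -> Prop) :
  {ae @lebesgue_measure R, forall x, P x} ->
  {ae @lebesgue_measure R, forall x, Q x} ->
  {ae @lebesgue_measure R, forall x, P x /\ Q x}.
Proof.
move=> hP hQ; have F := ae_filter_ringOfSetsType (@lebesgue_measure R).
by apply: filterS2 hP hQ => x.
Qed.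

Lemma ae_integral_eq (R : realType) (D : set R) (f g : R -> \bar R) :
  measurable D -> measurable_fun D f -> measurable_fun D g ->
  {ae @lebesgue_measure R, forall x, D x -> f x = g x} ->
  (\int[@lebesgue_measure R]_(x in D) f x =
   \int[@lebesgue_measure R]_(x in D) g x)%E.
Proof. by move=> mD mf mg fg; apply: ae_eq_integral. Qed.

Lemma ae_integrable_eq (R : realType) (D : set R) (f g : R -> \bar R) :
  measurable D -> (@lebesgue_measure R).-integrable D f ->
  measurable_fun D g ->
  {ae @lebesgue_measure R, forall x, D x -> f x = g x} ->
  (@lebesgue_measure R).-integrable D g.
Proof.
move=> mD /integrableP[mf f_oo] mg fg; apply/integrableP; split => //.
rewrite -(@ae_integral_eq _ _ (abse \o f))//.
- exact: measurableT_comp.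
- exact: measurableT_comp.
- by apply: ae_imp fg => x H /H /= ->.
Qed.

(** * Absolutely continuous functions are integrals *)

Definition itv_apart (R : realType) : rel (R * R) :=
  fun p q => (p.2 <= q.1) || (q.2 <= p.1).

Lemma itv_apart_sym (R : realType) : symmetric (@itv_apart R).
Proof. by move=> p q; rewrite /itv_apart orbC. Qed.

Lemma itv_apart_subr (R : realType) (p q r : R * R) :
  r.1 <= q.1 -> q.2 <= r.2 -> itv_apart p r -> itv_apart p q.
Proof.
rewrite /itv_apart => h1 h2 /orP[h|h]; apply/orP; [left|right].
  exact: le_trans h h1.
exact: le_trans h2 h.
Qed.

(** Finite families of intervals indexed by ordinals are traded for lists, on
    which families can be concatenated. *)
Lemma abs_continuous_seq (R : realType) (a b : R) (f : R -> R) (e : R) :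
  abs_continuous a b f -> 0 < e ->
  exists2 d : R, 0 < d & forall L : seq (R * R),
    all (fun p => [&& a <= p.1, p.1 <= p.2 & p.2 <= b]) L ->
    pairwise (@itv_apart R) L ->
    \sum_(p <- L) (p.2 - p.1) < d ->
    \sum_(p <- L) `|f p.2 - f p.1| < e.
Proof.
move=> acf e0; have [d d0 H] := acf _ e0; exists d => // L Lab Ldis.
rewrite (big_tnth _ _ L) => Ld; rewrite (big_tnth _ _ L).
apply: (H _ (fun i => (tnth (in_tuple L) i).1) (fun i => (tnth (in_tuple L) i).2)) => //.
  move=> i; move/allP : Lab => /(_ (tnth (in_tuple L) i) (mem_tnth _ _)).
  by case/and3P.
move=> i j _ _ [x []] /=; rewrite !in_itv/= => /andP[ix xi] /andP[jx xj].
apply/eqP; case: (eqVneq i j) => // ij.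
have : itv_apart (tnth (in_tuple L) i) (tnth (in_tuple L) j).
  rewrite !(tnth_nth (0, 0)) /=.
  move/pairwiseP : Ldis => /(_ (0,0)) LP.
  have [lij|lji|/val_inj eij] := ltngtP i j.
  - by apply: LP => //; rewrite inE ltn_ord.
  - by rewrite itv_apart_sym; apply: LP => //; rewrite inE ltn_ord.
  - by rewrite eij eqxx in ij.
move=> /orP[h|h].
  by have := lt_trans (lt_le_trans xi h) jx; rewrite ltxx.
by have := lt_trans (lt_le_trans xj h) ix; rewrite ltxx.
Qed.

Lemma variation_cons (R : realType) (l r x : R) (f : R -> R) (s : seq R) :
  itv_partition l r (x :: s) ->
  variation l r f (x :: s) = `|f x - f l| + variation x r f s.
Proof.
move=> [/= /andP[lx _] _].
by rewrite /variation /= big_nat_recl.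
Qed.

(** A subdivision is a list of intervals to which absolute continuity
    applies. *)
Lemma variation_pairs (R : realType) (l r : R) (f : R -> R) (s : seq R) :
  itv_partition l r s -> exists L : seq (R * R),
  [/\ all (fun p => [&& l <= p.1, p.1 <= p.2 & p.2 <= r]) L,
      pairwise (@itv_apart R) L,
      \sum_(p <- L) (p.2 - p.1) = r - l &
      \sum_(p <- L) `|f p.2 - f p.1| = variation l r f s].
Proof.
elim: s l => [|x s ih] l.
  move=> [_ /eqP/= ->]; exists [::]; split => //.
    by rewrite big_nil subrr.
  by rewrite big_nil /variation/= big_geq.
move=> lxs; have [/= /andP[lx xs] sr] := lxs.
have [L [Lall Lap Ls Lv]] : exists L : seq (R * R),
  [/\ all (fun p => [&& x <= p.1, p.1 <= p.2 & p.2 <= r]) L,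
      pairwise (@itv_apart R) L,
      \sum_(p <- L) (p.2 - p.1) = r - x &
      \sum_(p <- L) `|f p.2 - f p.1| = variation x r f s] by apply: ih.
have xr : x <= r.
  move: xs sr; clear; elim: s x => [|y s ih] x /=; first by move=> _ /eqP ->.
  by move=> /andP[xy ys] sr; rewrite (le_trans (ltW xy))// ih.
exists ((l, x) :: L); split => /=.
- rewrite lexx (ltW lx) xr/=; apply: sub_all Lall => p /and3P[h1 -> ->].
  by rewrite (le_trans (ltW lx) h1).
- rewrite Lap andbT; apply: sub_all Lall => p /and3P[h1 h2 h3].
  by rewrite /itv_apart h1.
- by rewrite big_cons Ls/= addrC addrA subrK.
- by rewrite big_cons Lv/= variation_cons.
Qed.

(** Refining every interval of the list by a subdivision keeps the total length
    unchanged, so the bound passes to the supremum.  The induction refines one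
    interval at a time, L2 holding the intervals that are not refined. *)
Lemma abs_continuous_total_variation_seq (R : realType) (a b : R) (f : R -> R)
    (e : R) :
  abs_continuous a b f -> 0 < e ->
  exists2 d : R, 0 < d & forall L : seq (R * R),
    all (fun p => [&& a <= p.1, p.1 <= p.2 & p.2 <= b]) L ->
    pairwise (@itv_apart R) L ->
    \sum_(p <- L) (p.2 - p.1) < d ->
    (\sum_(p <- L) total_variation p.1 p.2 f <= e%:E)%E.
Proof.
move=> acf e0; have [d d0 H] := abs_continuous_seq acf e0; exists d => // L.
suff gen : forall L2,
    all (fun p => [&& a <= p.1, p.1 <= p.2 & p.2 <= b]) (L ++ L2) ->
    pairwise (@itv_apart R) (L ++ L2) ->
    \sum_(p <- L ++ L2) (p.2 - p.1) < d ->
    (\sum_(p <- L) total_variation p.1 p.2 f +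
      (\sum_(p <- L2) `|f p.2 - f p.1|)%:E <= e%:E)%E.
  move=> h1 h2 h3; have := gen [::].
  by rewrite cats0 big_nil adde0; apply.
elim: L => [|[l r] L ih] L2.
  by move=> h1 h2 h3; rewrite big_nil add0e lee_fin ltW// H.
rewrite cat_cons [all _ _]/= [pairwise _ _]/= !big_cons/=.
move=> /andP[/and3P[al lr rb] Lall] /andP[lrL Lap] Ld.
set rest := (\sum_(j <- L) _)%E.
have step s : itv_partition l r s ->
    ((variation l r f s)%:E + (rest + (\sum_(p <- L2) `|f p.2 - f p.1|)%:E)
     <= e%:E)%E.
  move=> /(variation_pairs f)[P [Pall Pap Ps Pv]].
  rewrite addeCA -EFinD -Pv -big_cat/=; apply: ih.
  - move: Lall; rewrite !all_cat => /andP[-> ->]; rewrite andbT/=.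
    apply: sub_all Pall => p /and3P[h1 -> h3].
    by rewrite (le_trans al)//= (le_trans h3).
  - move: Lap; rewrite !pairwise_cat Pap => /and3P[h1 -> ->].
    rewrite !andbT.
    have sep p q : p \in P -> q \in L ++ L2 -> itv_apart p q.
      move=> pP qL; rewrite itv_apart_sym.
      move/allP : Pall => /(_ _ pP)/and3P[p1 _ p2].
      apply: (@itv_apart_subr _ q p (l, r)) => //.
      by rewrite itv_apart_sym; move/allP : lrL => /(_ _ qL).
    apply/andP; split.
      apply/allrelP => q z qL; rewrite mem_cat => /orP[zP|zL2].
        by rewrite itv_apart_sym sep// mem_cat qL.
      by move/allrelP : h1 => ->.
    by apply/allrelP => p z pP zL2; rewrite sep// mem_cat zL2 orbT.
  - rewrite !big_cat/= Ps; move: Ld; rewrite big_cat/=.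
    by rewrite addrCA.
have rest_ge0 : (0 <= rest + (\sum_(p <- L2) `|f p.2 - f p.1|)%:E)%E.
  rewrite adde_ge0//; last by rewrite lee_fin sumr_ge0.
  rewrite /rest big_seq sume_ge0// => p pL.
  rewrite total_variation_ge0//.
  by move: Lall; rewrite all_cat => /andP[/allP/(_ _ pL)/and3P[]].
rewrite -addeA.
have rest_fin : (rest + (\sum_(p <- L2) `|f p.2 - f p.1|)%:E)%E \is a fin_num.
  rewrite ge0_fin_numE//.
  have [s hs] : exists s, itv_partition l r s.
    move: lr; rewrite le_eqVlt => /predU1P[->|lr].
      by exists [::]; split => //=.
    by exists [:: r]; split => //=; rewrite ?lr.
  apply: le_lt_trans (ltry e); apply: le_trans (step _ hs).
  by rewrite leeDr// lee_fin sumr_ge0.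
rewrite -leeBrDr//.
apply: ge_ereal_sup => _ [_ [s hs <-] <-].
by rewrite leeBrDr// step.
Qed.

Lemma seq_abs_continuous (R : realType) (a b : R) (f : R -> R) :
  (forall e : R, 0 < e -> exists2 d : R, 0 < d & forall L : seq (R * R),
    all (fun p => [&& a <= p.1, p.1 <= p.2 & p.2 <= b]) L ->
    pairwise (@itv_apart R) L ->
    \sum_(p <- L) (p.2 - p.1) < d ->
    \sum_(p <- L) `|f p.2 - f p.1| < e) ->
  abs_continuous a b f.
Proof.
move=> H e e0; have [d d0 {}H] := H _ e0; exists d => // n l r lr tI ld.
pose L := [seq (l i, r i) | i <- enum 'I_n & l i < r i].
have eL (g : R * R -> R) : (forall x, g (x, x) = 0) ->
    \sum_(p <- L) g p = \sum_(i < n) g (l i, r i).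
  move=> g0; rewrite /L big_map big_filter big_enum_cond/= big_mkcond/=.
  apply: eq_bigr => i _; case: ifPn => //; rewrite -leNgt => ri.
  have [_ [li _]] := lr i.
  have -> : l i = r i by apply/eqP; rewrite eq_le li ri.
  by rewrite g0.
rewrite -(eL (fun p => `|f p.2 - f p.1|)); last by move=> x; rewrite subrr normr0.
apply: H.
- rewrite all_map; apply/allP => i _ /=.
  by have [-> [-> ->]] := lr i.
- rewrite pairwise_map.
  have : uniq [seq i <- enum 'I_n | l i < r i] by rewrite filter_uniq// enum_uniq.
  rewrite uniq_pairwise.
  apply: (@sub_in_pairwise _ (fun i => l i < r i)); last exact: filter_all.
  move=> i j; rewrite -!topredE/= => li lj /= ij.
  rewrite /itv_apart/=.
  rewrite -[_ || _]negbK negb_or -!ltNge; apply/negP => /andP[h1 h2].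
  move: tI => /(_ i j I I) => h; move/eqP: ij; apply; apply: h.
  pose x := Num.max (l i) (l j); pose y := Num.min (r i) (r j).
  have xy : x < y by rewrite /x /y gt_max !lt_min li lj h1 h2.
  exists ((x + y) / 2); split; rewrite /= in_itv/=.
    apply/andP; split.
      by apply: (@le_lt_trans _ _ x); rewrite ?midf_lt// /x le_max lexx.
    by apply: (@lt_le_trans _ _ y); rewrite ?midf_lt// /y ge_min lexx.
  apply/andP; split.
    by apply: (@le_lt_trans _ _ x); rewrite ?midf_lt// /x le_max lexx orbT.
  by apply: (@lt_le_trans _ _ y); rewrite ?midf_lt// /y ge_min lexx orbT.
- by rewrite (eL (fun p => p.2 - p.1))// => x; rewrite subrr.
Qed.

(** An interval shorter than d has variation at most 1, and [x, y] is covered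
    by finitely many of them. *)
Lemma abs_continuous_total_variation_fin (R : realType) (a b x y : R)
    (f : R -> R) :
  abs_continuous a b f -> a <= x -> x <= y -> y <= b ->
  total_variation x y f \is a fin_num.
Proof.
move=> acf ax xy yb.
have [d d0 H] := abs_continuous_total_variation_seq acf (@ltr01 R).
have small u v : a <= u -> u <= v -> v <= b -> v - u < d ->
    total_variation u v f \is a fin_num.
  move=> au uv vb uvd; rewrite ge0_fin_numE ?total_variation_ge0//.
  have := H [:: (u, v)]; rewrite /= !big_seq1 au uv vb /= => h.
  by apply: le_lt_trans (ltry 1); exact: h.
suff main n : forall z, x <= z -> z <= b -> z - x <= n%:R * (d / 2) ->
    total_variation x z f \is a fin_num.
  apply: (main (Num.truncn ((y - x) / (d / 2))).+1) => //.
  by rewrite -ler_pdivrMr ?divr_gt0// ltW// truncnS_gt.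
elim: n => [|n ih] z xz zb.
  rewrite mul0r subr_le0 => zx.
  have -> : z = x by apply/eqP; rewrite eq_le zx xz.
  by rewrite total_variationxx.
move=> zn; have [h|h] := leP (z - x) (d / 2).
  by apply: small => //; apply: le_lt_trans h _; rewrite ltr_pdivrMr// ltr_pMr// ltr1n.
have d2 : 0 <= d / 2 by rewrite divr_ge0// ltW.
have xz' : x <= z - d / 2 by rewrite lerBrDr -lerBrDl ltW.
have zz' : z - d / 2 <= z by rewrite gerBl.
rewrite (total_variationD f xz' zz') fin_numD ih ?small//.
- exact: le_trans xz'.
- by rewrite opprB addrC subrK ltr_pdivrMr// ltr_pMr// ltr1n.
- exact: le_trans zb.
- by move: zn; rewrite -natr1 mulrDl mul1r -lerBlDr addrAC.
Qed.

Lemma fine_total_variationB (R : realType) (a b l r : R) (f : R -> R) :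
  abs_continuous a b f -> a <= l -> l <= r -> r <= b ->
  fine (total_variation a r f) - fine (total_variation a l f) =
  fine (total_variation l r f).
Proof.
move=> acf al lr rb.
rewrite (total_variationD f al lr) fineD ?(abs_continuous_total_variation_fin acf)//.
  by rewrite addrC addKr.
exact: le_trans rb.
Qed.

Lemma abs_continuous_fine_total_variation (R : realType) (a b : R)
    (f : R -> R) :
  abs_continuous a b f ->
  abs_continuous a b (fun x => fine (total_variation a x f)).
Proof.
move=> acf; apply: seq_abs_continuous => e e0.
have e20 : 0 < e / 2 by rewrite divr_gt0.
have [d d0 H] := abs_continuous_total_variation_seq acf e20.
exists d => // L Lall Lap Ld.
apply: (@le_lt_trans _ _ (e / 2)); last by rewrite ltr_pdivrMr// ltr_pMr// ltr1n.
rewrite -lee_fin; apply: le_trans (H _ Lall Lap Ld).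
rewrite -sumEFin big_seq [leRHS]big_seq; apply: lee_sum => p pL.
move/allP : Lall => /(_ _ pL)/and3P[ap pp pb].
rewrite (fine_total_variationB acf)// ger0_norm ?fine_ge0 ?total_variation_ge0//.
by rewrite fineK// (abs_continuous_total_variation_fin acf).
Qed.

Lemma abs_continuousD (R : realType) (a b : R) (f g : R -> R) :
  abs_continuous a b f -> abs_continuous a b g ->
  abs_continuous a b (fun x => f x + g x).
Proof.
move=> acf acg e e0; have e20 : 0 < e / 2 by rewrite divr_gt0.
have [d1 d10 H1] := acf _ e20; have [d2 d20 H2] := acg _ e20.
exists (Num.min d1 d2); first by rewrite lt_min d10.
move=> n l r lr tI; rewrite lt_min => /andP[h1 h2].
rewrite (splitr e); apply: le_lt_trans (ltrD (H1 _ _ _ lr tI h1) (H2 _ _ _ lr tI h2)).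
rewrite -big_split/=; apply: ler_sum => i _.
by apply: le_trans (ler_normD _ _); rewrite opprD addrACA.
Qed.

Lemma abs_continuous_unif (R : realType) (a b : R) (f : R -> R) :
  abs_continuous a b f -> forall e, 0 < e -> exists2 d, 0 < d &
  forall x y, a <= x <= b -> a <= y <= b -> `|y - x| < d -> `|f y - f x| < e.
Proof.
move=> acf e e0; have [d d0 H] := abs_continuous_seq acf e0.
exists d => //.
suff main x y : a <= x <= b -> a <= y <= b -> x <= y -> `|y - x| < d -> `|f y - f x| < e.
  move=> x y xab yab; have [xy|/ltW yx] := leP x y; first exact: main.
  by rewrite distrC => h; rewrite distrC; exact: main.
move=> /andP[ax xb] /andP[ay yb] xy h.
have := H [:: (x, y)]; rewrite /= !big_seq1/= ax xy yb; apply => //.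
by apply: le_lt_trans h; exact: ler_norm.
Qed.

(** The function f o clamp extends f outside of [a, b] by constants, which turns
    properties on the segment into properties on the line. *)
Definition clamp (R : realType) (a b x : R) : R := Num.max a (Num.min x b).

Lemma clamp_itv (R : realType) (a b x : R) : a <= b -> a <= clamp a b x <= b.
Proof. by move=> ab; rewrite /clamp le_max lexx/= ge_max ab ge_min lexx orbT. Qed.

Lemma clamp_id (R : realType) (a b x : R) : a <= x <= b -> clamp a b x = x.
Proof. by move=> /andP[ax xb]; rewrite /clamp (min_idPl xb) (max_idPr ax). Qed.

Lemma clamp_homo (R : realType) (a b : R) : {homo clamp a b : x y / x <= y}.
Proof.
by move=> x y xy; rewrite /clamp /Num.max /Num.min; do 4 case: ifPn => //; lra.
Qed.

Lemma clamp_lip (R : realType) (a b x y : R) :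
  a <= b -> x <= y -> clamp a b y - clamp a b x <= y - x.
Proof.
move=> ab xy; rewrite /clamp /Num.max /Num.min.
by do 4 case: ifPn => //; lra.
Qed.

Lemma clamp_continuous (R : realType) (a b : R) (f : R -> R) : a <= b ->
  abs_continuous a b f -> continuous (f \o clamp a b).
Proof.
move=> ab acf x; apply/cvgrPdist_lt => e e0.
have [d d0 H] := abs_continuous_unif acf e0.
near=> y; apply: H; rewrite ?clamp_itv//.
have : `|x - y| < d by near: y; exact: cvgr_dist_lt.
apply: le_lt_trans; have [xy|/ltW yx] := leP x y.
  rewrite distrC [leRHS]distrC !ger0_norm ?subr_ge0 ?clamp_homo//.
  exact: clamp_lip.
rewrite !ger0_norm ?subr_ge0 ?clamp_homo//.
exact: clamp_lip.
Unshelve. all: by end_near. Qed.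

(** The Lebesgue measure of an unbounded interval is infinite, so a component
    of an open set of finite measure has two real endpoints. *)
Lemma open_interval_bounded (R : realType) (I : set R) :
  open I -> is_interval I -> (@lebesgue_measure R I < +oo)%E ->
  exists p : R * R, p.1 <= p.2 /\ I = `]p.1, p.2[%classic.
Proof.
move=> oI /is_intervalP; case: (Rhull I) => [l r] Ilr Ifin.
have [I0|/set0P[z Iz]] := eqVneq I set0.
  by exists (0, 0); rewrite set_itv_ge// bnd_simp ltxx.
have lr : (l < r)%O.
  have : z \in Interval l r by move: Iz; rewrite Ilr.
  move=> /andP[lz zr]; apply: lt_le_trans zr; apply: le_lt_trans lz _.
  by rewrite bnd_simp.
move: Ifin; rewrite {1}Ilr; move: lr oI Ilr.
case: l r => [x l|[]] [y r|[]]//; rewrite ?lebesgue_measure_itv//=; last 2 first.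
- by move=> _ _ _; rewrite ltry.
- by move=> _ _ _; rewrite ltNyr.
move=> lr oI Ilr _; exists (l, r) => /=; split.
  by move: lr; case: x {Ilr}; case: y; rewrite !bnd_simp// => /ltW.
by rewrite -(interior_itv_bnd l r x y) -Ilr; exact/esym/interior_id.
Qed.

Lemma lebesgue_stieltjes_measure_itvoc (R : realType) (C : cumulative R R)
    (x y : R) : x <= y ->
  lebesgue_stieltjes_measure C `]x, y]%classic = (C y - C x)%:E.
Proof.
move=> xy; rewrite /lebesgue_stieltjes_measure /measure_extension/= measurable_mu_extE/=.
  by rewrite wlength_itv_bnd.
exact: is_ocitv.
Qed.

(** Absolute continuity of F bounds the Stieltjes measure of finite unions of
    intervals; an open set is the disjoint union of its countably many
    components, and the bound passes to the limit. *)
Lemma abs_continuous_nondecreasing_open (R : realType) (a b e d : R)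
    (F : R -> R) (C : cumulative R R) :
  a <= b ->
  (forall n (l r : 'I_n -> R), (forall i, a <= l i /\ l i <= r i /\ r i <= b) ->
      trivIset setT (fun i => `]l i, r i[%classic) ->
      \sum_(i < n) (r i - l i) < d ->
      \sum_(i < n) `|F (r i) - F (l i)| < e) ->
  (forall x, C x = F (clamp a b x)) ->
  forall U : set R, open U -> (@lebesgue_measure R U < d%:E)%E ->
  (lebesgue_stieltjes_measure C U <= e%:E)%E.
Proof.
move=> ab acF CE U oU Ud.
have := open_disjoint_itv_bigcup oU.
set I := open_disjoint_itv oU => UI.
have mI q : measurable (I q : set (measurableTypeR R)).
  apply: open_measurable; exact: open_disjoint_itv_open.
have Ifin q : (@lebesgue_measure R (I q) <  +oo)%E.
  apply: le_lt_trans (lt_trans Ud (ltry d)).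
  apply: le_measure; rewrite ?inE//.
    exact: open_measurable.
  by rewrite [X in _ `<=` X]UI; exact: bigcup_sup.
have /choice[p hp] q := open_interval_bounded (@open_disjoint_itv_open _ _ oU q)
  (@open_disjoint_itv_is_interval _ _ oU q) (Ifin q).
have tI : trivIset setT I by exact: open_disjoint_itv_trivIset.
rewrite UI measure_bigcup//.
apply: lime_le; first exact: is_cvg_nneseries.
apply: nearW => n.
rewrite /= big_mkord.
have Cle q : (lebesgue_stieltjes_measure C (I q) <=
    (F (clamp a b (p q).2) - F (clamp a b (p q).1))%:E)%E.
  have [pq Iq] := hp q.
  apply: (@le_trans _ _ (lebesgue_stieltjes_measure C `](p q).1, (p q).2]%classic)).
    by apply: le_measure; rewrite ?inE// /I Iq; exact: subset_itvW.
  by rewrite lebesgue_stieltjes_measure_itvoc// !CE.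
apply: (@le_trans _ _ (\sum_(i < n) (F (clamp a b (p i).2) - F (clamp a b (p i).1))%:E)%E).
  rewrite [leLHS](eq_bigl xpredT); last by move=> i; rewrite in_setT.
  by apply: lee_sum => i _; exact: Cle.
rewrite sumEFin lee_fin ltW//.
apply: le_lt_trans (acF n (fun i => clamp a b (p i).1) (fun i => clamp a b (p i).2) _ _ _).
- by apply: ler_sum => i _; exact: ler_norm.
- move=> i; have [pi _] := hp i.
  have /andP[-> _] := clamp_itv (p i).1 ab.
  have /andP[_ ->] := clamp_itv (p i).2 ab.
  by rewrite clamp_homo.
- move=> i j _ _ [x [/=]]; rewrite !in_itv/= => /andP[h1 h2] /andP[h3 h4].
  have sub (k : 'I_n) : clamp a b (p k).1 < x -> x < clamp a b (p k).2 -> I k x.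
    have [_ Ik] := hp k; rewrite -/I in Ik; rewrite Ik/= in_itv/=.
    rewrite /clamp gt_max gt_min lt_max lt_min => /andP[ax /orP[->|bx]].
      by move=> /orP[xa|/andP[-> _]//]; move: (lt_trans ax xa); rewrite ltxx.
    move=> /orP[xa|/andP[_ xb]]; first by move: (lt_trans ax xa); rewrite ltxx.
    by move: (lt_trans bx xb); rewrite ltxx.
  by apply/val_inj; apply: (tI i j) => //; exists x; split; exact: sub.
- rewrite -lte_fin; apply: le_lt_trans Ud.
  rewrite [leRHS](_ : _ = @lebesgue_measure R (\bigcup_q I q)); last by rewrite -UI.
  rewrite measure_bigcup// (@eq_eseriesl _ _ xpredT); last by move=> i; rewrite in_setT.
  apply: (@le_trans _ _ (\sum_(0 <= i < n) @lebesgue_measure R (I i))%E); last first.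
    exact: nneseries_lim_ge.
  rewrite big_mkord -sumEFin; apply: lee_sum => i _.
  have [pi Ii] := hp i; rewrite -/I in Ii; rewrite Ii lebesgue_measure_itv/= lte_fin.
  case: ifPn => [_|]; first by rewrite -EFinB lee_fin clamp_lip.
  rewrite -leNgt => h; have -> : (p i).1 = (p i).2 by apply/eqP; rewrite eq_le pi h.
  by rewrite subrr.
Qed.

(** By outer regularity a Lebesgue-null set lies in an open set of small
    measure, hence of small Stieltjes measure: the Stieltjes measure of F is
    dominated by the Lebesgue measure, and phi is its Radon-Nikodym
    derivative. *)
Lemma abs_continuous_nondecreasing_density (R : realType) (a b : R) (F : R -> R) :
  a <= b -> abs_continuous a b F ->
  (forall x y, a <= x -> x <= y -> y <= b -> F x <= F y) ->
  exists2 phi : R -> R, (@lebesgue_measure R).-integrable setT (EFin \o phi) &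
  forall x, a <= x <= b ->
    F x = F a + \int[@lebesgue_measure R]_(t in `]a, x]) phi t.
Proof.
move=> ab acF ndF.
have nd : nondecreasing (F \o clamp a b).
  move=> x y xy /=; apply: ndF; last 2 first.
  - exact: clamp_homo.
  - by have /andP[] := clamp_itv y ab.
  by have /andP[] := clamp_itv x ab.
have rc : right_continuous (F \o clamp a b).
  exact/right_continuousW/clamp_continuous.
(* the distribution function is F o clamp, continuous and nondecreasing on R *)
pose C : cumulative R R := HB.pack (F \o clamp a b)
  (isCumulative.Build R _ R (F \o clamp a b) nd rc).
pose nu := lebesgue_stieltjes_measure C.
have nuE x y : x <= y -> nu `]x, y]%classic = (F (clamp a b y) - F (clamp a b x))%:E.
  exact: lebesgue_stieltjes_measure_itvoc.
have mab : measurable (`]a, b] : set (measurableTypeR R)) by exact: measurable_itv.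
have nuab : (nu `]a, b]%classic < +oo)%E by rewrite nuE// ltry.
pose nuf : {finite_measure set (measurableTypeR R) -> \bar R} := mfrestr mab nuab.
have dom : nuf `<< @lebesgue_measure R.
  apply/null_content_dominatesP => A mA A0.
  rewrite /nuf /= /mfrestr /mrestr.
  apply/eqP; rewrite eq_le measure_ge0 andbT.
  apply/lee_addgt0Pr => e e0; rewrite add0e.
  have [d d0 H] := acF _ e0.
  have [U [oU AU Ud]] : exists U : set R, [/\ open U, A `<=` U & (@lebesgue_measure R (U `\` A) < d%:E)%E].
    by apply: lebesgue_regularity_outer => //; rewrite A0.
  apply: (@le_trans _ _ (nu U)).
    apply: le_measure; rewrite ?inE//.
    - exact: measurableI.
    - exact: open_measurable.
    - by move=> x [/AU].
  apply: (abs_continuous_nondecreasing_open ab H) => //.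
  rewrite -(setDUK AU).
  apply: le_lt_trans (measureU2 _ _ _) _ => //.
    by apply: measurableD => //; exact: open_measurable.
  by rewrite A0 add0e.
have [h [h0 hfin ih hE]] := radon_nikodym_sigma_finite dom.
exists (fine \o h).
  apply: eq_integrable ih => //= x _; by rewrite fineK.
move=> x /andP[ax xb].
rewrite /Rintegral.
under eq_integral do rewrite fineK//.
rewrite -hE// /nuf/= /mfrestr /mrestr setIidl; last first.
  by move=> z/=; rewrite !in_itv/= => /andP[-> /le_trans]; apply.
rewrite [X in fine X](nuE _ _ ax)/=.
by rewrite !clamp_id ?lexx ?ax ?xb// addrC subrK.
Qed.

(** With V the total variation of f on [a, x], both f + V and V are
    nondecreasing and absolutely continuous. *)
Lemma abs_continuous_density (R : realType) (a b : R) (f : R -> R) :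
  a <= b -> abs_continuous a b f ->
  exists2 phi : R -> R, (@lebesgue_measure R).-integrable setT (EFin \o phi) &
  forall x, a <= x <= b ->
    f x = f a + \int[@lebesgue_measure R]_(t in `]a, x]) phi t.
Proof.
move=> ab acf.
set V := fun x => fine (total_variation a x f).
have acV : abs_continuous a b V by exact: abs_continuous_fine_total_variation.
have VB x y : a <= x -> x <= y -> y <= b -> V y - V x = fine (total_variation x y f).
  by move=> ax xy yb; exact: (fine_total_variationB acf).
have ndV x y : a <= x -> x <= y -> y <= b -> V x <= V y.
  by move=> ax xy yb; rewrite -subr_ge0 VB// fine_ge0// total_variation_ge0.
have ndW x y : a <= x -> x <= y -> y <= b -> f x + V x <= f y + V y.
  move=> ax xy yb; rewrite -subr_ge0 opprD addrACA VB// -lerBlDr sub0r lerNl.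
  apply: le_trans (ler_norm _) _; rewrite normrN -lee_fin fineK.
    exact: total_variation_ge.
  exact: (abs_continuous_total_variation_fin acf).
have [p ip pE] := abs_continuous_nondecreasing_density ab (abs_continuousD acf acV) ndW.
have [q iq qE] := abs_continuous_nondecreasing_density ab acV ndV.
exists (fun x => p x - q x).
  exact: (integrableB measurableT ip iq).
move=> x axb; rewrite RintegralB//; last 2 first.
- exact: integrableS ip.
- exact: integrableS iq.
have := pE _ axb; have := qE _ axb; lra.
Qed.

(** Derivability as a Cauchy condition on the difference quotients, which
    involves no unknown limit and has countably many tolerances: it serves to
    show that the set of points of derivability is measurable. *)
Lemma derivable_cauchyP (R : realType) (F : R -> R) (x : R) :
  derivable F x 1 <->
  forall n : nat, exists m : nat, forall h h' : R,
    0 < `|h| -> `|h| < m.+1%:R^-1 -> 0 < `|h'| -> `|h'| < m.+1%:R^-1 ->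
    `|h^-1 * (F (h + x) - F x) - h'^-1 * (F (h' + x) - F x)| <= n.+1%:R^-1.
Proof.
have -> : derivable F x 1 <-> cvg (h^-1 * (F (h + x) - F x) @[h --> 0^']).
  rewrite /derivable; have -> // : (fun h : R => h^-1 *: ((F \o shift x) (h *: 1) - F x)) =
    (fun h => h^-1 * (F (h + x) - F x)).
  by apply/funext => h /=; rewrite /GRing.scale/= mulr1.
split.
  move=> /cvgrPdist_lt Q n.
  have n0 : 0 < (n.+1%:R^-1 / 2 : R) by rewrite divr_gt0// invr_gt0.
  have := Q _ n0 => -[d /= d0 H].
  exists (Num.truncn d^-1) => h h' h0 hm h'0 h'm.
  have dm : (Num.truncn d^-1).+1%:R^-1 < d.
    by rewrite invf_plt ?posrE// truncnS_gt.
  have lt_e z : 0 < `|z| -> `|z| < (Num.truncn d^-1).+1%:R^-1 ->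
      `|lim (h^-1 * (F (h + x) - F x) @[h --> 0^']) - z^-1 * (F (z + x) - F x)| <
      n.+1%:R^-1 / 2.
    move=> z0 zm; apply: H; last by rewrite -normr_gt0.
    by rewrite /ball_/= sub0r normrN (lt_trans zm).
  rewrite -(subrKA (lim (h^-1 * (F (h + x) - F x) @[h --> 0^']))).
  apply: le_trans (ler_normD _ _) _; rewrite [leRHS]splitr distrC lerD// ltW//; exact: lt_e.
move=> H; apply/cauchy_cvgP/cauchy_ballP => e e0.
have [m Hm] := H (Num.truncn e^-1).
have em : (Num.truncn e^-1).+1%:R^-1 < e by rewrite invf_plt ?posrE// truncnS_gt.
pose Q h := h^-1 * (F (h + x) - F x).
exists ([set Q h | h in [set h | 0 < `|h| < m.+1%:R^-1]],
  [set Q h | h in [set h | 0 < `|h| < m.+1%:R^-1]]).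
  suff h : nbhs (Q h @[h --> 0^']) [set Q h | h in [set h | 0 < `|h| < m.+1%:R^-1]].
    by split.
  exists m.+1%:R^-1 => /=; first by rewrite invr_gt0.
  move=> h; rewrite /ball_/= sub0r normrN => hm h0; exists h => //.
  by rewrite normr_gt0 h0.
move=> [_ _] /= [[h /andP[h0 hm] <-] [h' /andP[h'0 h'm] <-]].
by rewrite /ball/= (le_lt_trans (Hm _ _ _ _ _ _)).
Qed.

(** The points where two difference quotients with steps below 1/(m+1) differ by
    more than 1/(n+1) form an open set, as a union of open sets over the pairs
    of steps. *)
Lemma continuous_measurable_derivable (R : realType) (F : R -> R) :
  continuous F -> measurable [set x | derivable F x 1].
Proof.
move=> cF.
pose Q h x := h^-1 * (F (h + x) - F x).
pose O n m := \bigcup_(p in [set p : R * R | (0 < `|p.1| < m.+1%:R^-1) /\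
    (0 < `|p.2| < m.+1%:R^-1)]) [set x | n.+1%:R^-1 < `|Q p.1 x - Q p.2 x|].
have -> : [set x | derivable F x 1] = \bigcap_n \bigcup_m ~` O n m.
  apply/seteqP; split => x /=.
    move=> /derivable_cauchyP H n _; have [m Hm] := H n; exists m => //.
    move=> [[h h'] /= [/andP[h0 hm] /andP[h'0 h'm]]]; apply/negP; rewrite -leNgt.
    exact: Hm.
  move=> H; apply/derivable_cauchyP => n; have [m _ Hm] := H n I; exists m.
  move=> h h' h0 hm h'0 h'm; rewrite leNgt; apply/negP => nh.
  by apply: Hm; exists (h, h') => //=; rewrite h0 h'0.
apply: bigcapT_measurable => n; apply: bigcupT_measurable => m.
apply: measurableC; apply: open_measurable; apply: bigcup_open => -[h h'] _.
have cQ z : continuous (Q z).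
  move=> x; apply: cvgM; first exact: cvg_cst.
  apply: cvgB; last exact: cF.
  by apply: continuous_comp; [apply: cvgD; [exact: cvg_cst|exact: cvg_id]|exact: cF].
rewrite [X in open X](_ : _ = (fun x => `|Q h x - Q h' x|) @^-1` [set y | n.+1%:R^-1 < y])//.
apply: open_comp; last exact: open_gt.
move=> x _; apply: cvg_norm; apply: cvgB; exact: cQ.
Qed.

(** On the measurable set of points of derivability the derivative is a limit
    of continuous functions; elsewhere it has the default value. *)
Lemma continuous_measurable_derive1 (R : realType) (F : R -> R) :
  continuous F -> measurable_fun setT (derive1 F : R -> R).
Proof.
move=> cF; have mD := continuous_measurable_derivable cF.
rewrite -(setUv [set x | derivable F x 1]).
apply/measurable_funU => //; first exact: measurableC.
split; last first.
  apply: (@eq_measurable_fun _ _ _ _ _ (cst (point : R))); last exact: measurable_cst.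
  move=> x; rewrite inE/= => nd; rewrite derive1E /derive.
  by apply/esym/dvgP.
apply: (@measurable_fun_cvg _ _ R _
    (fun n (x : R) => n.+1%:R * (F (n.+1%:R^-1 + x) - F x))).
  move=> n; apply: measurable_funTS; apply: continuous_measurable_fun => x.
  apply: cvgM; first exact: cvg_cst.
  apply: cvgB; last exact: cF.
  by apply: continuous_comp; [apply: cvgD; [exact: cvg_cst|exact: cvg_id]|exact: cF].
move=> x dx.
have : h^-1 * (F (h + x) - F x) @[h --> 0^'] --> derive1 F x.
  move: dx; rewrite /= /derivable /derive1 /=.
  by under eq_fun do rewrite [_ *: 1]mulr1.
move=> /cvgr_dnbhsP /(_ (@harmonic R)) H.
rewrite (_ : (fun n => _) = (fun n => (harmonic n)^-1 * (F (harmonic n + x) - F x))).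
  apply: H; split; last exact: cvg_harmonic.
  by move=> n; rewrite gt_eqF// /harmonic/= invr_gt0.
by apply/funext => n; rewrite /harmonic/= invrK.
Qed.

Lemma derive1_near_eq (R : realType) (F G : R -> R) (x : R) :
  {near x, F =1 G} -> derive1 F x = derive1 G x.
Proof. by move=> FG; rewrite !derive1E; exact: near_eq_derive. Qed.

Lemma abs_continuous_integral (R : realType) (a b : R) (phi f : R -> R) :
  (@lebesgue_measure R).-integrable setT (EFin \o phi) ->
  (forall x, a <= x <= b ->
    f x = f a + \int[@lebesgue_measure R]_(t in `]a, x]) phi t) ->
  abs_continuous a b f.
Proof.
move=> iphi fE e e0.
have [d [d0 H]] := integral_normr_continuous iphi e0.
exists d => // n l r lr tI ld.
have iphiS (A : set R) : measurable A ->
    (@lebesgue_measure R).-integrable A (EFin \o phi).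
  by move=> mA; apply: integrableS iphi.
have fB i : f (r i) - f (l i) = \int[@lebesgue_measure R]_(t in `](l i), (r i)[) phi t.
  have [al [lri rb]] := lr i.
  rewrite (fE (r i)) ?(le_trans al)//= (fE (l i)) ?al/= ?(le_trans lri)//.
  rewrite opprD addrACA subrr add0r Rintegral_itvB ?bnd_simp//; last exact: iphiS.
  by rewrite Rintegral_itv_bndo_bndc//; apply: iphiS.
have mI i : measurable (`](l i), (r i)[%classic : set R) by exact: measurable_itv.
pose A := \big[setU/set0]_(i < n) (`](l i), (r i)[%classic : set (measurableTypeR R)).
have mA : measurable A by exact: bigsetU_measurable.
have muA : (@lebesgue_measure R A < d%:E)%E.
  rewrite measure_bigsetU_ord//.
  rewrite (eq_bigr (fun i => (r i - l i)%:E)) ?sumEFin ?lte_fin// => i _.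
  apply: etrans; first exact: (lebesgue_measure_itv `](l i), (r i)[).
  rewrite /= lte_fin -EFinB.
  have [_ [lri _]] := lr i; case: ltgtP lri => // -> _.
  by rewrite subrr.
apply: le_lt_trans (H _ mA muA).
rewrite -lee_fin /Rintegral fineK; last first.
  apply: integrable_fin_num => //.
  exact: (integrable_abse (iphiS _ mA)).
rewrite ge0_integral_bigsetU//; last 3 first.
- exact: index_enum_uniq.
- exact: sub_trivIset tI.
- by have /integrableP[] := integrable_abse (iphiS _ mA).
rewrite -sumEFin; apply: lee_sum => i _; rewrite fB.
rewrite EFin_normr_Rintegral//; last exact: iphiS.
apply: le_abse_integral => //.
by have /integrableP[] := iphiS _ (mI i).
Qed.

Lemma abs_continuous_derivable (R : realType) (a b : R) (phi f : R -> R) :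
  (@lebesgue_measure R).-integrable setT (EFin \o phi) ->
  (forall x, a <= x <= b ->
    f x = f a + \int[@lebesgue_measure R]_(t in `]a, x]) phi t) ->
  {ae @lebesgue_measure R, forall x, a < x < b ->
    derivable f x 1 /\ derive1 f x = phi x}.
Proof.
move=> iphi fE.
have iphiS (A : set R) : measurable A ->
    (@lebesgue_measure R).-integrable A (EFin \o phi).
  by move=> mA; apply: integrableS iphi.
have := @FTC1 R phi (BRight a) (fun y => iphiS _ (measurable_itv _)).
have loc : locally_integrable setT phi.
  by have := integrable_locally measurableT iphi; rewrite patch_setT.
move=> /(_ loc); apply: ae_imp => x Hx /andP[ax xb].
have [|dF F'] := Hx _; first by rewrite lte_fin.
have nE : {near x, (fun x => f a + \int[@lebesgue_measure R]_(t in `]a, x]) phi t) =1 f}.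
  near=> y; rewrite [RHS]fE//; apply/andP; split; apply: ltW.
    by near: y; exact: lt_nbhsr.
  by near: y; exact: lt_nbhsl.
have dG : is_derive x 1 (fun x => f a + \int[@lebesgue_measure R]_(t in `]a, x]) phi t) (phi x).
  rewrite -F' derive1E -[X in is_derive _ _ _ X]add0r.
  by apply: is_deriveD; apply: DeriveDef.
split; first by apply: near_eq_derivable nE _; exact: ex_derive.
by rewrite -(derive1_near_eq nE) derive1E derive_val.
Unshelve. all: by end_near. Qed.

(** The density of f is its derivative almost everywhere, by the Lebesgue
    differentiation theorem. *)
Lemma abs_continuous_derive1 (R : realType) (a b : R) (f : R -> R) :
  a <= b -> abs_continuous a b f ->
  [/\ {ae @lebesgue_measure R, forall x, a < x < b -> derivable f x 1},
      (@lebesgue_measure R).-integrable `]a, b[ (EFin \o derive1 f) &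
      forall x, a <= x <= b ->
        f x = f a + \int[@lebesgue_measure R]_(t in `]a, x[) derive1 f t].
Proof.
move=> ab acf; have [phi iphi fE] := abs_continuous_density ab acf.
have aeD := abs_continuous_derivable iphi fE.
have iphiS (A : set R) : measurable A ->
    (@lebesgue_measure R).-integrable A (EFin \o phi).
  by move=> mA; apply: integrableS iphi.
have mD : measurable_fun `]a, b[ (derive1 f : R -> R).
  (* f o clamp is continuous on the whole line and has the derivative of f
     inside the interval *)
  apply: (@eq_measurable_fun _ _ _ _ _ (derive1 (f \o clamp a b) : R -> R)).
    move=> x; rewrite inE/= in_itv/= => /andP[ax xb].
    apply: derive1_near_eq; near=> y; rewrite /= clamp_id//.
    apply/andP; split; apply: ltW.
      by near: y; exact: lt_nbhsr.
    by near: y; exact: lt_nbhsl.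
  apply: measurable_funTS; apply: continuous_measurable_derive1.
  exact: clamp_continuous.
have aeE x : a <= x <= b ->
    ae_eq (@lebesgue_measure R) `]a, x[%classic (EFin \o phi) (EFin \o derive1 f).
  move=> /andP[_ xb]; apply: ae_imp aeD => y H /=; rewrite in_itv/= => /andP[ay yx].
  by have [|_ ->] := H; rewrite ?ay ?(lt_le_trans yx).
have mDx x : a <= x <= b -> measurable_fun `]a, x[ (EFin \o derive1 f).
  move=> /andP[_ xb]; apply/measurable_EFinP; apply: measurable_funS mD => //.
  by apply: subset_itvl; rewrite bnd_simp.
have mphi (A : set R) : measurable A -> measurable_fun A (EFin \o phi).
  by move=> mA; have /integrableP[] := iphiS _ mA.
have abb : a <= b <= b by rewrite ab lexx.
split.
- by apply: ae_imp aeD => x H /H[].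
- apply: (@ae_integrable_eq _ _ (EFin \o phi)) => //.
  + exact: iphiS.
  + exact: mDx.
  + exact: aeE.
- move=> x axb; rewrite fE//; congr (_ + _).
  rewrite -Rintegral_itv_bndo_bndc; last exact: iphiS.
  rewrite /Rintegral (@ae_integral_eq _ _ (EFin \o phi) (EFin \o derive1 f))//.
  + exact: mphi.
  + exact: mDx.
  + exact: aeE.
Unshelve. all: by end_near. Qed.

(** * Change of variables, Gamma and Beta integrals *)

(** The Lebesgue measure is the pushforward of itself by x |-> c x + d, scaled
    by |c|: the two agree on intervals. *)
Lemma ge0_integral_affine (R : realType) (c d : R) (f : R -> \bar R) :
  c != 0 -> measurable_fun setT f -> (forall x, (0 <= f x)%E) ->
  (\int[@lebesgue_measure R]_x f x =
   `|c|%:E * \int[@lebesgue_measure R]_x f (c * x + d)%R)%E.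
Proof.
move=> c0 mf f0.
pose phi : measurableTypeR R -> measurableTypeR R := fun x => c * x + d.
have mphi : measurable_fun setT phi.
  apply: measurable_funD => //; exact: measurable_funM.
pose m1 := measure_function_pushforward__canonical__measure_function_Measure
  (@lebesgue_measure R) mphi.
pose m2 : {measure set (measurableTypeR R) -> \bar R} :=
  mscale (NngNum (normr_ge0 c)) m1.
have eqm (A : set (measurableTypeR R)) : measurable A -> lebesgue_measure A = m2 A.
  apply: lebesgue_measure_unique => _ [[a b] _ <-].
  rewrite lebesgue_measure_itv /m2/= /mscale/= /pushforward.
  have cN0 : `|c| != 0 by rewrite normr_eq0.
  have [cpos|cneg|c00] := ltgtP 0 c; last by rewrite -c00 eqxx in c0.
    have -> : phi @^-1` `]a, b] = `]((a - d) / c), ((b - d) / c)]%classic.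
      apply/seteqP; split => x /=; rewrite !in_itv/= /phi -ltrBlDr -lerBrDr.
        by rewrite ltr_pdivrMr// ler_pdivlMr// [x * c]mulrC.
      by rewrite ltr_pdivrMr// ler_pdivlMr// [x * c]mulrC.
    rewrite lebesgue_measure_itv/= !lte_fin ltr_pM2r ?invr_gt0// ltrD2r.
    case: ifPn => _; last by rewrite mule0.
    rewrite -!EFinB -EFinM gtr0_norm// -mulrBl mulrCA mulfV// mulr1.
    by rewrite opprB addrA subrK.
  have -> : phi @^-1` `]a, b] = `[((b - d) / c), ((a - d) / c)[%classic.
    apply/seteqP; split => x /=; rewrite !in_itv/= /phi -ltrBlDr -lerBrDr.
      by rewrite andbC ler_ndivrMr// ltr_ndivlMr// [x * c]mulrC.
    by rewrite andbC ler_ndivrMr// ltr_ndivlMr// [x * c]mulrC.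
  rewrite lebesgue_measure_itv/= !lte_fin ltr_nM2r ?invr_lt0// ltrD2r.
  case: ifPn => _; last by rewrite mule0.
  rewrite -!EFinB -EFinM ltr0_norm// -mulrBl mulNr mulrCA mulfV// mulr1.
  by rewrite !opprB addrA subrK.
rewrite (eq_measure_integral m2) => [|A mA _]; last exact: eqm.
rewrite ge0_integral_mscale//; congr (_ * _)%E.
by rewrite ge0_integral_pushforward.
Qed.

Lemma ge0_lebesgue_bigcup_cvg (R : realType) (F : nat -> set R)
    (f : R -> \bar R) :
  (forall n m, (n <= m)%N -> F n `<=` F m) -> (forall n, measurable (F n)) ->
  measurable_fun setT f -> (forall n x, F n x -> (0 <= f x)%E) ->
  (\int[@lebesgue_measure R]_(x in F n) f x)%E @[n --> \oo] -->
  (\int[@lebesgue_measure R]_(x in \bigcup_n F n) f x)%E.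
Proof.
move=> ndF mF mf f0; apply: ge0_nondecreasing_set_cvg_integral => //.
- by move=> n m nm; apply/subsetPset; exact: ndF.
- by move=> n; exact: measurable_funTS.
Qed.

Lemma measurable_EFin_powR (R : realType) (D : set R) (y : R) :
  measurable_fun D (fun t : R => (t `^ y)%:E).
Proof.
apply/measurable_EFinP; apply: measurable_funTS; exact: measurable_powR.
Qed.

Lemma powR_continuous_gt0 (R : realType) (y t : R) : 0 < t ->
  {for t, continuous (fun t : R => t `^ y)}.
Proof.
move=> t0; apply: differentiable_continuous; apply/derivable1_diffP.
by apply: derivable_powR; rewrite in_itv/= t0.
Qed.

(** For a = 0 the integrand may be singular, and the value is the limit of the
    integrals over ]b/(n+1), b]. *)
Lemma ge0_powR_integral (R : realType) (x a b : R) : 0 < x -> 0 <= a -> a <= b ->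
  (\int[@lebesgue_measure R]_(t in `]a, b]) (t `^ (x - 1))%:E =
   ((b `^ x - a `^ x) / x)%:E)%E.
Proof.
move=> x0.
have x_neq0 : x != 0 by rewrite gt_eqF.
have cpow (y t : R) := @powR_continuous_gt0 R y t.
have pos c : 0 < c -> c <= b ->
    (\int[@lebesgue_measure R]_(t in `]c, b]) (t `^ (x - 1))%:E =
   ((b `^ x - c `^ x) / x)%:E)%E.
  move=> c0; rewrite le_eqVlt => /predU1P[->|cb].
    by rewrite set_itv_ge ?bnd_simp ?ltxx// integral_set0 subrr mul0r.
  rewrite integral_itv_obnd_cbnd; last first.
    exact: measurable_EFin_powR.
  rewrite (@continuous_FTC2 _ _ (fun t => t `^ x / x))//.
  - by rewrite -EFinB mulrBl.
  - apply: continuous_in_subspaceT => t; rewrite inE/= in_itv/= => /andP[ct _].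
    exact: cpow (lt_le_trans c0 ct).
  - split.
    + move=> t; rewrite in_itv/= => /andP[ct _].
      apply: derivableM => //; by apply: derivable_powR; rewrite in_itv/= (lt_trans c0 ct).
    + apply: cvg_at_right_filter; apply: cvgM; last exact: cvg_cst.
      exact: cpow.
    + apply: cvg_at_left_filter; apply: cvgM; last exact: cvg_cst.
      exact: cpow (lt_trans c0 cb).
  - move=> t; rewrite in_itv/= => /andP[ct _].
    have H := is_derive1_powR x (lt_trans c0 ct).
    rewrite derive1E deriveM//=.
    rewrite derive_cst scaler0 add0r (derive_val (is_derive := H)).
    by rewrite /GRing.scale/= mulrA mulVf// mul1r.
rewrite le_eqVlt => /predU1P[<-{a} b0|a0 ab]; last exact: pos.
have [->|b_neq0] := eqVneq b 0.
  by rewrite set_itv_ge ?bnd_simp ?ltxx// integral_set0 subrr mul0r.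
have {b_neq0}b0 : 0 < b by rewrite lt_neqAle eq_sym b_neq0.
pose F n := `]b / n.+1%:R, b]%classic.
have -> : `]0, b]%classic = \bigcup_n F n.
  apply/seteqP; split => t /=; rewrite in_itv/=.
    move=> /andP[t0 tb]; exists (Num.truncn (b / t)) => //.
    rewrite /F/= in_itv/= tb andbT ltr_pdivrMr// mulrC -ltr_pdivrMr//.
    exact: truncnS_gt.
  move=> [n _]; rewrite /F/= in_itv/= => /andP[bt ->]; rewrite andbT.
  by apply: le_lt_trans bt; rewrite divr_ge0// ltW.
have H : (\int[@lebesgue_measure R]_(t in F n) (t `^ (x - 1))%:E)%E @[n --> \oo] -->
    (\int[@lebesgue_measure R]_(t in \bigcup_n F n) (t `^ (x - 1))%:E)%E.
  apply: ge0_lebesgue_bigcup_cvg.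
  - move=> n m nm t; rewrite /F/= !in_itv/= => /andP[h ->].
    rewrite andbT; apply: le_lt_trans h.
    by rewrite ler_pM2l// lef_pV2 ?posrE// ler_nat.
  - by move=> i; exact: measurable_itv.
  - exact: measurable_EFin_powR.
  - by move=> i t _; rewrite lee_fin powR_ge0.
apply: (@cvg_unique _ (@ereal_hausdorff R) _ _ _ _ H).
rewrite (_ : (fun i => _) = (fun n => ((b `^ x - (b / n.+1%:R) `^ x) / x)%:E)); last first.
  apply/funext => n; rewrite pos ?divr_gt0//.
  by rewrite ler_pdivrMr// ler_pMr// ler1n.
apply: cvg_EFin; first by near=> n.
rewrite powR0//; apply: cvgM; last exact: cvg_cst.
apply: cvgB; first exact: cvg_cst.
have /cvg_at_rightP := powR_cvg0 x0.
apply; split; first by move=> n; rewrite divr_gt0.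
rewrite -[X in _ --> X](mulr0 b); apply: cvgM; first exact: cvg_cst.
exact: cvg_harmonic.
Unshelve. all: by end_near. Qed.

(** Truncated powers make the Gamma and Beta integrals, and convolutions of
    powers, integrals over the whole line. *)
Definition tpow (R : realType) (y t : R) : R := if 0 < t then t `^ y else 0.

Lemma tpow_ge0 (R : realType) (y t : R) : 0 <= tpow y t.
Proof. by rewrite /tpow; case: ifP => // _; exact: powR_ge0. Qed.

Lemma measurable_tpow (R : realType) (y : R) : measurable_fun setT (tpow y).
Proof.
by apply: measurable_fun_ifT => //; exact: measurable_fun_ltr.
Qed.

Lemma tpowM (R : realType) (y c t : R) : 0 < c ->
  tpow y (c * t) = c `^ y * tpow y t.
Proof.
move=> c0; rewrite /tpow pmulr_rgt0//; case: ifPn => [t0|_]; last by rewrite mulr0.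
by rewrite powRM// ltW.
Qed.

Lemma tpowE (R : realType) (y t : R) : 0 < t -> tpow y t = t `^ y.
Proof. by rewrite /tpow => ->. Qed.

Lemma ge0_lebesgue_integralZl (R : realType) (c : \bar R) (f : R -> \bar R) :
  (0 <= c)%E -> measurable_fun setT f -> (forall x, (0 <= f x)%E) ->
  (\int[@lebesgue_measure R]_x (c * f x) =
   c * \int[@lebesgue_measure R]_x f x)%E.
Proof. by move=> c0 mf f0; apply: ge0_integralZl. Qed.

(** Euler's Gamma function, as an extended real so that Tonelli's theorem
    applies to it before finiteness is known. *)
Definition eGamma (R : realType) (x : R) : \bar R :=
  (\int[@lebesgue_measure R]_t (expR (- t) * tpow (x - 1) t)%:E)%E.

Lemma measurable_gamma_integrand (R : realType) (x : R) :
  measurable_fun setT (fun t : R => (expR (- t) * tpow (x - 1) t)%:E).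
Proof.
apply/measurable_EFinP; apply: measurable_funM; last exact: measurable_tpow.
by apply: measurableT_comp; [exact: measurable_expR|apply: measurable_funN].
Qed.

Lemma gamma_integrand_ge0 (R : realType) (x t : R) :
  (0 <= (expR (- t) * tpow (x - 1) t)%:E)%E.
Proof. by rewrite lee_fin mulr_ge0 ?expR_ge0 ?tpow_ge0. Qed.

(** With A large this gives the superexponential growth of the Gamma
    function. *)
Lemma eGamma_ge (R : realType) (x A m : R) : 0 < A ->
  (forall t, A <= t <= A + 1 -> m <= expR (- t) * t `^ (x - 1)) ->
  (m%:E <= eGamma x)%E.
Proof.
move=> A0 mle; have [m0|m0] := leP m 0.
  apply: (@le_trans _ _ 0%E); first by rewrite lee_fin.
  by apply: integral_ge0 => t _; exact: gamma_integrand_ge0.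
apply: (@le_trans _ _ (\int[@lebesgue_measure R]_(t in `[A, (A + 1)%R]) m%:E)%E).
  rewrite integral_cst//= lebesgue_measure_itv/= lte_fin ltrDl ltr01.
  by rewrite -EFinD addrAC subrr add0r mule1.
apply: (@le_trans _ _ (\int[@lebesgue_measure R]_(t in `[A, (A + 1)%R])
    (expR (- t) * tpow (x - 1) t)%:E)%E).
  apply: ge0_le_integral => //=.
  - by move=> t _; rewrite lee_fin ltW.
  - by apply: measurable_funTS; exact: measurable_gamma_integrand.
  - move=> t; rewrite in_itv/= => tA; rewrite lee_fin tpowE ?mle//.
    by move: tA => /andP[At _]; exact: lt_le_trans At.
apply: ge0_subset_integral => //.
- exact: measurable_gamma_integrand.
- by move=> t _; exact: gamma_integrand_ge0.
Qed.

Lemma eGamma_gt0 (R : realType) (x : R) : (0 < eGamma x)%E.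
Proof.
apply: (@lt_le_trans _ _ (expR (- 2) * Num.min (1 `^ (x - 1)) (2 `^ (x - 1)))%:E).
  by rewrite lte_fin mulr_gt0 ?expR_gt0// lt_min !powR_gt0.
apply: (@eGamma_ge _ _ 1) => // t /andP[t1 t2].
have t0 : 0 < t by exact: lt_le_trans t1.
have t2' : t <= 2 by apply: le_trans t2 _.
apply: ler_pM.
- exact: expR_ge0.
- by rewrite le_min !powR_ge0.
- by rewrite ler_expR lerN2.
have [x1|x1] := leP 0 (x - 1).
  rewrite ge_min; apply/orP; left.
  by apply: ge0_ler_powR; rewrite ?nnegrE// ltW.
rewrite ge_min; apply/orP; right.
have [y y0 ->] : exists2 y, 0 <= y & x - 1 = - y.
  by exists (- (x - 1)); rewrite ?opprK// oppr_ge0 ltW.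
rewrite (powRN t y) (powRN 2 y) lef_pV2 ?posrE ?powR_gt0//.
by apply: ge0_ler_powR; rewrite ?nnegrE// ltW.
Qed.

(** The integrand is at most t^(x-1) on ]0, 1] and at most a multiple of the
    density exp(-t/2)/2 beyond 1. *)
Lemma eGamma_lty (R : realType) (x : R) : 0 < x -> (eGamma x < +oo)%E.
Proof.
move=> x0.
set n := Num.truncn x.
set C : R := 2 * (n.+1`!%:R * 2 ^+ n.+1).
have C0 : 0 <= C by rewrite mulr_ge0// mulr_ge0.
pose h1 := (fun t : R => tpow (x - 1) t) \_ `]0, 1%R]%classic.
have mh1 : measurable_fun setT (EFin \o h1).
  apply/measurable_EFinP; apply/(measurable_restrictT _ _).1 => //.
  apply: measurable_funTS; exact: measurable_tpow.
have h10 t : (0 <= (EFin \o h1) t)%E.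
  by rewrite /= lee_fin /h1 patchE; case: ifP => // _; exact: tpow_ge0.
pose h2 (t : R) := C * exponential_pdf 2^-1 t.
have h20 t : (0 <= (EFin \o h2) t)%E.
  by rewrite /= lee_fin mulr_ge0// exponential_pdf_ge0.
have mh2 : measurable_fun setT (EFin \o h2).
  by apply/measurable_EFinP; apply: measurable_funM => //; exact: measurable_exponential_pdf.
apply: (@le_lt_trans _ _ (\int[@lebesgue_measure R]_t ((EFin \o h1) t + (EFin \o h2) t))%E).
  apply: ge0_le_integral => //.
  - by move=> t _; exact: gamma_integrand_ge0.
  - exact: measurable_gamma_integrand.
  - exact: emeasurable_funD.
  move=> t _; rewrite /= -EFinD lee_fin.
  have [t0|t0] := leP t 0.
    by rewrite /tpow ltNge t0/= mulr0 addr_ge0//; [exact: h10|exact: h20].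
  have [t1|t1] := leP t 1.
    rewrite -[leLHS]addr0 lerD//; last exact: h20.
    rewrite /h1 patchE mem_set/= ?in_itv/= ?t0//.
    by rewrite ler_piMl ?tpow_ge0// -expR0 ler_expR oppr_le0 ltW.
  rewrite -[leLHS]add0r lerD//; first exact: h10.
  rewrite tpowE// /h2 /exponential_pdf patchE mem_set/= ?in_itv/= ?(ltW t0)//.
  have -> : expR (- t) = expR (- (2^-1 * t)) * expR (- (t / 2)).
    by rewrite -expRD; congr expR; lra.
  rewrite [leRHS](_ : _ = expR (- (2^-1 * t)) * (n.+1`!%:R * 2 ^+ n.+1)); last first.
    by rewrite /C mulNr; field.
  rewrite -mulrA ler_pM2l ?expR_gt0// expRN ler_pdivrMl ?expR_gt0//.
  apply: (@le_trans _ _ (t ^+ n.+1)).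
    rewrite -powR_mulrn ?(ltW t0)//; apply: ler_powR; first exact: ltW.
    by rewrite lerBlDr; apply: le_trans (ltW (truncnS_gt x)) _; rewrite lerDl.
  rewrite -ler_pdivrMr; last by rewrite mulr_gt0// ltr0n fact_gt0.
  have := @expR_ge1Dxn _ (t / 2) n; move=> /(_ (ltW (divr_gt0 t0 _))) => h.
  apply: le_trans (h _) => //; rewrite -[leLHS]add0r lerD//.
  by rewrite expr_div_n invfM -!mulrA [X in _ <= _ * X]mulrC.
rewrite ge0_integralD//; apply: lte_add_pinfty.
  rewrite [X in (X < _)%E](_ : _ =
      \int[@lebesgue_measure R]_(t in `]0%R, 1%R]) (t `^ (x - 1))%:E)%E.
    by rewrite ge0_powR_integral// ltry.
  rewrite [RHS]integral_mkcond/=; apply: eq_integral => t _.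
  rewrite /h1 !patchE; case: ifPn => //; rewrite inE/= in_itv/= => /andP[t0 _].
  by rewrite tpowE.
rewrite /h2 /=; under eq_integral do rewrite EFinM.
rewrite ge0_integralZl//.
- by rewrite integral_exponential_pdf// mule1 ltry.
- by apply/measurable_EFinP; exact: measurable_exponential_pdf.
- by move=> t _; rewrite lee_fin exponential_pdf_ge0.
Qed.

(** The convolution at t of two truncated powers; at t = 1 it is Euler's
    Beta function. *)
Definition eBeta (R : realType) (x y t : R) : \bar R :=
  (\int[@lebesgue_measure R]_u (tpow (x - 1) (t - u) * tpow (y - 1) u)%:E)%E.

Lemma measurable_tpow_sub (R : realType) (y : R) :
  measurable_fun setT (fun p : R * R => tpow y (p.1 - p.2)).
Proof.
by apply: measurableT_comp; [exact: measurable_tpow|apply: measurable_funB].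
Qed.

Lemma measurable_tpow_snd (R : realType) (y : R) :
  measurable_fun setT (fun p : R * R => tpow y p.2).
Proof. by apply: measurableT_comp; [exact: measurable_tpow|]. Qed.

Lemma eBeta_le0 (R : realType) (x y t : R) : t <= 0 -> eBeta x y t = 0%E.
Proof.
move=> t0; rewrite /eBeta integral0_eq// => u _.
rewrite /tpow subr_gt0; case: ltP => ut; last by rewrite mul0r.
by rewrite ltNge (le_trans (ltW ut) t0)/= mulr0.
Qed.

Lemma measurable_beta_integrand (R : realType) (x y t : R) :
  measurable_fun setT (fun u : R => (tpow (x - 1) (t - u) * tpow (y - 1) u)%:E).
Proof.
apply/measurable_EFinP; apply: measurable_funM; last exact: measurable_tpow.
by apply: measurableT_comp; [exact: measurable_tpow|apply: measurable_funB].
Qed.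

Lemma beta_integrand_ge0 (R : realType) (x y t u : R) :
  (0 <= (tpow (x - 1) (t - u) * tpow (y - 1) u)%:E)%E.
Proof. by rewrite lee_fin mulr_ge0 ?tpow_ge0. Qed.

(** Homogeneity, by the substitution u = t v. *)
Lemma eBeta_scale (R : realType) (x y t : R) : 0 < t ->
  eBeta x y t = ((t `^ (x + y - 1))%:E * eBeta x y 1)%E.
Proof.
move=> t0; have tn0 : t != 0 by rewrite gt_eqF.
transitivity (`|t|%:E * \int[@lebesgue_measure R]_u
    (tpow (x - 1) (t - (t * u + 0)) * tpow (y - 1) (t * u + 0))%:E)%E.
  exact: (ge0_integral_affine 0 tn0 (measurable_beta_integrand x y t)
    (beta_integrand_ge0 x y t)).
transitivity (`|t|%:E * ((t `^ (x - 1) * t `^ (y - 1))%:E * eBeta x y 1))%E.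
  congr (_ * _)%E.
  transitivity (\int[@lebesgue_measure R]_u ((t `^ (x - 1) * t `^ (y - 1))%:E *
      (tpow (x - 1) (1 - u) * tpow (y - 1) u)%:E))%E.
    apply: eq_integral => u _.
    by rewrite addr0 -{1}[t]mulr1 -mulrBr !tpowM// mulrACA EFinM.
  apply: ge0_lebesgue_integralZl.
  - by rewrite lee_fin mulr_ge0 ?powR_ge0.
  - exact: measurable_beta_integrand.
  - exact: beta_integrand_ge0.
rewrite muleA -EFinM; congr (_%:E * _)%E.
rewrite gtr0_norm// -powRD ?tn0 ?implybT//.
rewrite -{1}(powRr1 (ltW t0)) -powRD ?tn0 ?implybT//.
by congr (_ `^ _); lra.
Qed.

(** Gamma(x) Gamma(y) is the double integral of exp(-s-r) s^(x-1) r^(y-1);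
    after the translation t = s + r the integration over r yields the
    convolution of the two powers at t, which is homogeneous in t. *)
Lemma eGammaM (R : realType) (x y : R) :
  (eGamma x * eGamma y = eBeta x y 1 * eGamma (x + y))%E.
Proof.
have Gx0 : (0 <= eGamma x)%E by rewrite ltW// eGamma_gt0.
have B0 : (0 <= eBeta x y 1)%E.
  by apply: integral_ge0 => u _; exact: beta_integrand_ge0.
pose f (p : R * R) : \bar R :=
  (expR (- p.1) * (tpow (x - 1) (p.1 - p.2) * tpow (y - 1) p.2))%:E.
have mf : measurable_fun setT f.
  apply/measurable_EFinP; apply: measurable_funM.
    apply: measurableT_comp; first exact: measurable_expR.
    exact: measurable_funN.
  by apply: measurable_funM; [exact: measurable_tpow_sub|exact: measurable_tpow_snd].
have f0 p : (0 <= f p)%E.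
  by rewrite lee_fin mulr_ge0 ?expR_ge0// mulr_ge0 ?tpow_ge0.
transitivity (\int[@lebesgue_measure R]_r \int[@lebesgue_measure R]_t f (t, r))%E; last first.
  apply: etrans; first exact: (esym (@fubini_tonelli _ _ _ _ R
    (@lebesgue_measure R) (@lebesgue_measure R) f mf f0)).
  transitivity (\int[@lebesgue_measure R]_t
      (eBeta x y 1 * (expR (- t) * tpow (x + y - 1) t)%:E))%E; last first.
    apply: ge0_lebesgue_integralZl => //; first exact: measurable_gamma_integrand.
    by move=> t; exact: gamma_integrand_ge0.
  apply: eq_integral => t _.
  transitivity ((expR (- t))%:E * eBeta x y t)%E.
    apply: (@ge0_lebesgue_integralZl _ (expR (- t))%:E
      (fun u => (tpow (x - 1) (t - u) * tpow (y - 1) u)%:E)).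
    - by rewrite lee_fin expR_ge0.
    - exact: measurable_beta_integrand.
    - exact: beta_integrand_ge0.
  have [t0|t0] := leP t 0.
    by rewrite eBeta_le0// /tpow ltNge t0/= mulr0 !mule0.
  by rewrite eBeta_scale// tpowE// muleA -EFinM muleC.
transitivity (\int[@lebesgue_measure R]_r
    (eGamma x * (expR (- r) * tpow (y - 1) r)%:E))%E.
  apply/esym/ge0_lebesgue_integralZl => //; first exact: measurable_gamma_integrand.
  by move=> t; exact: gamma_integrand_ge0.
apply: eq_integral => r _; apply/esym.
have mfr : measurable_fun setT (fun t => f (t, r)) by exact: measurableT_comp.
apply: etrans.
  exact: (@ge0_integral_affine R 1 r _ (oner_neq0 _) mfr (fun t => f0 (t, r))).
rewrite normr1 mul1e muleC.
apply: etrans; last first.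
  apply: (@ge0_lebesgue_integralZl _ _ (fun t => (expR (- t) * tpow (x - 1) t)%:E)).
  - exact: gamma_integrand_ge0.
  - exact: measurable_gamma_integrand.
  - by move=> t; exact: gamma_integrand_ge0.
apply: eq_integral => s _; rewrite /f/= mul1r addrK -EFinM; congr EFin.
by rewrite opprD expRD; ring.
Qed.

(** Substitution of s = t^k / k, on the segments [1/(n+1), n+1] and then in the
    limit. *)
Lemma kGamma_integral (R : realType) (k z : R) : 0 < k -> 0 < z ->
  (\int[@lebesgue_measure R]_(t in `]0%R, +oo[)
    (expR (- (t `^ k / k)) * t `^ (z - 1))%:E =
  (k `^ (z / k - 1))%:E * eGamma (z / k))%E.
Proof.
move=> k0 z0.
pose T (t : R) := t `^ k / k.
have kn0 : k != 0 by rewrite gt_eqF.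
have kV (p : R) : k^-1 `^ p = k `^ (- p).
  by rewrite -{1}(powR_inv1 (ltW k0)) -powRrM mulN1r.
have T0 (t : R) : 0 < t -> 0 < T t by move=> t0; rewrite divr_gt0// powR_gt0.
have Tmono (a b : R) : 0 <= a -> a < b -> T a < T b.
  move=> a0 ab; rewrite ltr_pM2r ?invr_gt0//.
  by apply: gt0_ltr_powR; rewrite ?nnegrE// ltW// (le_lt_trans a0).
have dT (t : R) : 0 < t -> is_derive t 1 T (t `^ (k - 1)).
  move=> t0; rewrite /T.
  have H := is_derive1_powR k t0.
  have := is_deriveM H (is_derive_cst k^-1 t 1).
  by rewrite scaler0 add0r /GRing.scale/= mulrA mulVf// mul1r.
have dT1 (t : R) : 0 < t -> derive1 T t = t `^ (k - 1).
  by move=> t0; have H := dT _ t0; rewrite derive1E derive_val.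
have cpow (y t : R) := @powR_continuous_gt0 R y t.
have cT' (t : R) : 0 < t -> {for t, continuous (derive1 T : R -> R)}.
  move=> t0; rewrite /prop_for /continuous_at dT1//.
  apply: cvg_trans (cpow (k - 1) t t0); apply: near_eq_cvg; near=> s.
  by rewrite dT1//; near: s; exact: lt_nbhsr.
have cTt (t : R) : 0 < t -> {for t, continuous T}.
  move=> t0; apply: differentiable_continuous; apply/derivable1_diffP.
  by have H := dT _ t0; exact: ex_derive.
pose gx (s : R) := expR (- s) * s `^ (z / k - 1).
have cg (s : R) : 0 < s -> {for s, continuous gx}.
  move=> s0; apply: cvgM; last exact: cpow.
  apply: continuous_comp; last exact: continuous_expR.
  by apply: cvgN; exact: cvg_id.
have sub (a b : R) : 0 < a -> a <= b ->
    (\int[@lebesgue_measure R]_(s in `[T a, T b]) (gx s)%:E =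
     (k `^ (1 - z / k))%:E *
     \int[@lebesgue_measure R]_(t in `[a, b])
        (expR (- (t `^ k / k)) * t `^ (z - 1))%:E)%E.
  move=> a0 ab.
  rewrite (@integration_by_substitution_increasing _ T gx a b)//.
  - rewrite -ge0_integralZl//; last 3 first.
    + apply/measurable_EFinP; apply: measurable_funTS; apply: measurable_funM => //.
      apply: measurableT_comp; first exact: measurable_expR.
      apply: measurable_funN; exact: measurable_funM.
    + by move=> t _; rewrite lee_fin mulr_ge0 ?expR_ge0 ?powR_ge0.
    + by rewrite lee_fin powR_ge0.
    apply: eq_integral => t; rewrite inE/= in_itv/= => /andP[at_ _].
    have t0 : 0 < t by exact: lt_le_trans at_.
    rewrite -EFinM; congr EFin; rewrite fctE /= dT1// /gx -/(T t).
    rewrite mulrCA -mulrA; congr (_ * _).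
    rewrite /T powRM ?powR_ge0 ?invr_ge0 ?(ltW k0)// kV.
    rewrite -powRrM mulrAC -powRD; last by rewrite (gt_eqF t0) implybT.
    rewrite mulrC; congr (_ `^ _ * _ `^ _); first lra.
    by field.
  - move=> u v; rewrite !in_itv/= => /andP[au _] _; apply: Tmono.
    by rewrite ltW// (lt_le_trans a0).
  - move=> t; rewrite in_itv/= => /andP[at_ _]; exact: cT' (lt_trans a0 at_).
  - apply/cvg_ex; exists (derive1 T a); apply: cvg_at_right_filter; exact: cT'.
  - apply/cvg_ex; exists (derive1 T b); apply: cvg_at_left_filter.
    exact: cT' (lt_le_trans a0 ab).
  - split.
    + move=> t; rewrite in_itv/= => /andP[at_ _].
      by have H := dT _ (lt_trans a0 at_); exact: ex_derive.
    + by apply: cvg_at_right_filter; exact: cTt.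
    + by apply: cvg_at_left_filter; exact: cTt (lt_le_trans a0 ab).
  - apply: continuous_in_subspaceT => s; rewrite inE/= in_itv/= => /andP[Ts _].
    exact: cg (lt_le_trans (T0 _ a0) Ts).
pose a_ (n : nat) : R := n.+1%:R^-1.
pose b_ (n : nat) : R := n.+1%:R.
have a_gt0 n : 0 < a_ n by rewrite invr_gt0.
have ab_ n : a_ n <= b_ n.
  by apply: (@le_trans _ _ 1); rewrite ?ler1n// invf_le1// ler1n.
have sandwich (t : R) : 0 < t -> exists n, a_ n <= t <= b_ n.
  move=> t0; exists (maxn (Num.truncn t) (Num.truncn t^-1)); apply/andP; split.
    rewrite invf_ple ?posrE//; apply: ltW; apply: lt_le_trans (truncnS_gt _) _.
    by rewrite ler_nat ltnS leq_maxr.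
  apply: ltW; apply: lt_le_trans (truncnS_gt _) _.
  by rewrite ler_nat ltnS leq_maxl.
have a_nd n m : (n <= m)%N -> a_ m <= a_ n.
  by move=> nm; rewrite lef_pV2 ?posrE// ler_nat.
have b_nd n m : (n <= m)%N -> b_ n <= b_ m by move=> nm; rewrite ler_nat.
have Tle (a b : R) : 0 < a -> a <= b -> T a <= T b.
  move=> a0; rewrite le_eqVlt => /predU1P[->//|ab].
  by rewrite ltW// Tmono// ltW.
pose h (t : R) := (expR (- (t `^ k / k)) * t `^ (z - 1))%:E.
have mh : measurable_fun setT h.
  apply/measurable_EFinP; apply: measurable_funM => //.
  apply: measurableT_comp; first exact: measurable_expR.
  apply: measurable_funN; exact: measurable_funM.
have cvI : (\int[@lebesgue_measure R]_(t in `[a_ n, b_ n]) h t)%E @[n --> \oo] -->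
    (\int[@lebesgue_measure R]_(t in `]0%R, +oo[) h t)%E.
  have -> : `]0%R, +oo[%classic = \bigcup_n `[a_ n, b_ n]%classic.
    apply/seteqP; split => t /=; rewrite in_itv/= ?andbT.
      by move=> /sandwich[n nt]; exists n => //=; rewrite in_itv.
    by move=> [n _] /=; rewrite in_itv/= => /andP[nt _]; exact: lt_le_trans nt.
  apply: ge0_lebesgue_bigcup_cvg => //.
  - move=> n m nm; apply: subset_itvScc; rewrite bnd_simp; [exact: a_nd|exact: b_nd].
  - by move=> n t _; rewrite lee_fin mulr_ge0 ?expR_ge0 ?powR_ge0.
have cvG : (\int[@lebesgue_measure R]_(s in `[T (a_ n), T (b_ n)]) (gx s)%:E)%E @[n --> \oo] -->
    eGamma (z / k).
  have -> : eGamma (z / k) = (\int[@lebesgue_measure R]_(s in `]0%R, +oo[) (gx s)%:E)%E.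
    rewrite [RHS]integral_mkcond; apply: eq_integral => s _.
    rewrite patchE /tpow; case: ifPn => [s0|s0].
      by rewrite mem_set//= in_itv/= s0.
    by rewrite memNset ?mulr0//= in_itv/= andbT; exact/negP.
  have -> : `]0%R, +oo[%classic = \bigcup_n `[T (a_ n), T (b_ n)]%classic.
    apply/seteqP; split => s /=; rewrite in_itv/= ?andbT.
      move=> s0; have [n /andP[n1 n2]] := sandwich ((k * s) `^ k^-1) (powR_gt0 _ (mulr_gt0 k0 s0)).
      have Ts : T ((k * s) `^ k^-1) = s.
        rewrite /T -powRrM mulVf// powRr1; last by rewrite mulr_ge0// ltW.
        by rewrite mulrAC mulfV// mul1r.
      exists n => //=; rewrite in_itv/= -Ts !Tle//.
      by rewrite powR_gt0 ?mulr_gt0.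
    move=> [n _] /=; rewrite in_itv/= => /andP[nt _]; apply: lt_le_trans nt.
    exact: T0.
  apply: ge0_lebesgue_bigcup_cvg => //.
  - move=> n m nm; apply: subset_itvScc; rewrite bnd_simp.
      by apply: Tle => //; exact: a_nd.
    by apply: Tle; [rewrite /b_|exact: b_nd].
  - apply/measurable_EFinP; apply: measurable_funM => //.
    apply: measurableT_comp; first exact: measurable_expR.
    exact: measurable_funN.
  - by move=> n t _; rewrite lee_fin mulr_ge0 ?expR_ge0 ?powR_ge0.
have eG : (eGamma (z / k) = (k `^ (1 - z / k))%:E *
    \int[@lebesgue_measure R]_(t in `]0%R, +oo[) h t)%E.
  apply: (@cvg_unique _ (@ereal_hausdorff R) _ _ _ _ cvG).
  rewrite /= [X in X @ \oo --> _](_ : _ = (fun n => (k `^ (1 - z / k))%:E *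
      \int[@lebesgue_measure R]_(t in `[a_ n, b_ n]) h t)%E); last first.
    by apply/funext => n; rewrite sub.
  by apply: cvgeZl.
rewrite eG muleA -EFinM -powRD; last by rewrite kn0 implybT.
have -> : z / k - 1 + (1 - z / k) = 0 by lra.
by rewrite powRr0 mul1e.
Unshelve. all: by end_near. Qed.

Lemma kGammaE (R : realType) (k z : R) : 0 < k -> 0 < z ->
  (kGamma k z)%:E = ((k `^ (z / k - 1))%:E * eGamma (z / k))%E.
Proof.
move=> k0 z0; rewrite /kGamma /Rintegral kGamma_integral// fineK//.
rewrite fin_numM// ge0_fin_numE ?eGamma_lty ?divr_gt0//.
exact/ltW/eGamma_gt0.
Qed.

Lemma kGamma_gt0 (R : realType) (k z : R) : 0 < k -> 0 < z -> 0 < kGamma k z.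
Proof.
move=> k0 z0; rewrite -lte_fin kGammaE// mule_gt0 ?lte_fin ?powR_gt0//.
exact: eGamma_gt0.
Qed.

(** The integral over [A, A + 1] alone bounds the Gamma function at z/k below
    by a multiple of A^(z/k); A is chosen so that (k A)^(alpha/k) = M. *)
Lemma kGamma_growth (R : realType) (k alpha m M : R) : 0 < k -> 0 < alpha ->
  0 < m -> 0 < M ->
  exists c N, 0 < c /\ forall n : nat, (N <= n)%N ->
    c * M ^+ n <= kGamma k (n%:R * alpha + m).
Proof.
move=> k0 a0 m0 M0.
pose A := M `^ (k / alpha) / k.
have A0 : 0 < A by rewrite divr_gt0// powR_gt0.
pose c := expR (- (A + 1)) * (k * A) `^ (m / k - 1).
exists c, (Num.truncn (k / alpha)).+1; split.
  by rewrite mulr_gt0 ?expR_gt0// powR_gt0// mulr_gt0.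
move=> n nN; set z := n%:R * alpha + m.
have z0 : 0 < z by rewrite ltr_wpDl// mulr_ge0// ltW.
have zk : 0 <= z / k - 1.
  rewrite subr_ge0 ler_pdivlMr// mul1r; apply: (@le_trans _ _ (n%:R * alpha)).
    rewrite -ler_pdivrMr//; apply: le_trans (ltW (truncnS_gt _)) _.
    by rewrite ler_nat.
  by rewrite lerDl ltW.
have -> : c * M ^+ n = k `^ (z / k - 1) * (expR (- (A + 1)) * A `^ (z / k - 1)).
  rewrite mulrCA -powRM ?(ltW k0) ?(ltW A0)// /c -mulrA; congr (_ * _).
  have -> : M ^+ n = (k * A) `^ (n%:R * alpha / k).
    rewrite /A mulrC divfK ?gt_eqF// -powRrM -powR_mulrn ?(ltW M0)//; congr (_ `^ _).
    by field; rewrite !gt_eqF.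
  have kA0 : k * A != 0 by rewrite gt_eqF// mulr_gt0.
  rewrite -powRD ?kA0 ?implybT//.
  by congr (_ `^ _); rewrite /z; field; rewrite gt_eqF.
rewrite -lee_fin kGammaE// EFinM lee_pmul2l ?lte_fin ?powR_gt0//.
apply: (eGamma_ge A0) => t /andP[At tA].
apply: ler_pM; rewrite ?expR_ge0 ?powR_ge0//.
  by rewrite ler_expR lerN2.
by apply: ge0_ler_powR; rewrite // nnegrE ltW// (lt_le_trans A0).
Qed.

(** The Beta integral in terms of the k-gamma function: the powers of k brought
    by the change of variables combine to a single factor k. *)
Lemma kGamma_beta (R : realType) (k x y t : R) : 0 < k -> 0 < x -> 0 < y -> 0 < t ->
  eBeta (x / k) (y / k) t =
  (k * kGamma k x * kGamma k y / kGamma k (x + y) * t `^ ((x + y) / k - 1))%:E.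
Proof.
move=> k0 x0 y0 t0; rewrite eBeta_scale//.
have xk0 : 0 < x / k by rewrite divr_gt0.
have yk0 : 0 < y / k by rewrite divr_gt0.
have xyk0 : 0 < (x + y) / k by rewrite divr_gt0// addr_gt0.
have fG (u : R) : 0 < u -> exists2 g, 0 < g & eGamma u = g%:E.
  move=> u0; exists (fine (eGamma u)).
    by rewrite fine_gt0// eGamma_gt0 eGamma_lty.
  by rewrite fineK// ge0_fin_numE ?eGamma_lty//; exact/ltW/eGamma_gt0.
have [gx gx0 Gx] := fG _ xk0.
have [gy gy0 Gy] := fG _ yk0.
have [g g0 G] := fG _ xyk0.
have kx : kGamma k x = k `^ (x / k - 1) * gx.
  by apply: EFin_inj; rewrite kGammaE// Gx.
have ky : kGamma k y = k `^ (y / k - 1) * gy.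
  by apply: EFin_inj; rewrite kGammaE// Gy.
have kxy : kGamma k (x + y) = k `^ ((x + y) / k - 1) * g.
  by apply: EFin_inj; rewrite kGammaE ?addr_gt0// G.
have := eGammaM (x / k) (y / k); rewrite -mulrDl Gx Gy G.
have kn0 : k != 0 by rewrite gt_eqF.
case: (eBeta _ _ _) => [r| |]; last 2 first.
- by rewrite gt0_mulye ?lte_fin.
- by rewrite gt0_mulNye ?lte_fin.
rewrite -!EFinM => -[E]; congr EFin; rewrite mulrC; congr (_ * _).
rewrite kx ky kxy.
have -> : (x + y) / k - 1 = 1 + (x / k - 1 + (y / k - 1)) by rewrite mulrDl; ring.
rewrite (@powRD _ k 1) ?kn0 ?implybT// (@powRD _ k (x / k - 1)) ?kn0 ?implybT//.
rewrite powRr1 ?(ltW k0)//.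
have -> : r = gx * gy / g by rewrite E mulfK// gt_eqF.
have p1 : k `^ (x / k - 1) != 0 by rewrite gt_eqF// powR_gt0.
have p2 : k `^ (y / k - 1) != 0 by rewrite gt_eqF// powR_gt0.
by field; rewrite p1 p2 kn0 gt_eqF.
Qed.

(** * Power series of infinite radius and Cauchy products *)

(** The coefficients of an entire power series: the terms are bounded at every
    argument. *)
Definition entire_coef (R : realType) (a : nat -> R) : Prop :=
  forall Z : R, 0 < Z -> exists C, forall n, `|a n| * Z ^+ n <= C.

Lemma entire_coef_cvg (R : realType) (a : nat -> R) (z : R) :
  entire_coef a -> cvgn (series (fun n => `|a n * z ^+ n|)).
Proof.
move=> ea; pose Z := `|z| + 1.
have Z0 : 0 < Z by rewrite ltr_wpDl.
have Z20 : 0 < 2 * Z by rewrite mulr_gt0.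
have [C HC] := ea (2 * Z) Z20.
have C0 : 0 <= C by apply: le_trans (HC 0); rewrite mulr_ge0.
apply: (@series_le_cvg _ _ (fun n => C * 2^-1 ^+ n)).
- by move=> n.
- by move=> n; rewrite mulr_ge0// exprn_ge0// invr_ge0.
- move=> n; rewrite exprVn ler_pdivlMr ?exprn_gt0//.
  apply: le_trans (HC n); rewrite exprMn normrM -mulrA ler_wpM2l//.
  rewrite mulrC ler_wpM2l ?exprn_ge0// normrX lerXn2r ?nnegrE ?(ltW Z0)//.
  by rewrite lerDl.
- by apply: is_cvg_geometric_series; rewrite ger0_norm ?invf_lt1 ?ltr1n// invr_ge0.
Qed.

Lemma entire_coef_diffs (R : realType) (a : nat -> R) :
  entire_coef a -> entire_coef (pseries_diffs a).
Proof.
move=> ea Z Z0; have Z20 : 0 < 2 * Z by rewrite mulr_gt0.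
have [C HC] := ea (2 * Z) Z20.
exists (C / Z) => n; rewrite ler_pdivlMr// /pseries_diffs.
apply: le_trans (HC n.+1); rewrite normrM normr_nat exprMn [X in _ <= _ * (_ * X)]exprSr.
rewrite [n.+1%:R * _]mulrC -!mulrA ler_wpM2l// ler_wpM2r//.
  by rewrite mulr_ge0 ?exprn_ge0 ?ltW.
by rewrite -natrX ler_nat; exact/ltnW/ltn_expl.
Qed.

Lemma entire_coef_pseries_cvg (R : realType) (a : nat -> R) (z : R) :
  entire_coef a -> cvgn (pseries a z).
Proof. by move=> ea; apply: normed_cvg; exact: entire_coef_cvg. Qed.

Lemma entire_coef_continuous (R : realType) (a : nat -> R) :
  entire_coef a -> continuous (fun z : R => limn (pseries a z)).
Proof.
move=> ea z.
have ed := entire_coef_diffs ea; have edd := entire_coef_diffs ed.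
have H := @pseries_snd_diffs R a (`|z| + 1) z (@entire_coef_pseries_cvg _ _ _ ea)
  (@entire_coef_pseries_cvg _ _ _ ed) (@entire_coef_pseries_cvg _ _ _ edd).
apply: differentiable_continuous; apply/derivable1_diffP.
have /H H' : `|z| < `| `|z| + 1|.
  by rewrite [ltRHS]ger0_norm ?addr_ge0// ltrDl.
exact: ex_derive.
Qed.

Lemma series_norm_le_limn (R : realType) (u : nat -> R) (N : nat) :
  cvgn (series (fun n => `|u n|)) ->
  `|series u N| <= limn (series (fun n => `|u n|)).
Proof.
move=> cu; apply: (@le_trans _ _ (series (fun n => `|u n|) N)).
  exact: ler_norm_sum.
apply: nondecreasing_cvgn_le => //.
by apply: nondecreasing_series => n _.
Qed.

Definition cauchy_prod (R : realType) (a b : nat -> R) (n : nat) : R :=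
  \sum_(i < n.+1) a i * b (n - i)%N.

(** Summation by rows of the triangle i + j < N. *)
Lemma series_cauchy_prodE (R : realType) (a b : nat -> R) (N : nat) :
  series (cauchy_prod a b) N = \sum_(i < N) a i * series b (N - i)%N.
Proof.
rewrite /series/= big_mkord; elim: N => [|N ih]; first by rewrite !big_ord0.
rewrite big_ord_recr/= ih [RHS]big_ord_recr/= subSnn big_nat1.
rewrite /cauchy_prod big_ord_recr/= subnn addrA -big_split/=; congr (_ + _).
apply: eq_bigr => i _; rewrite -mulrDr; congr (_ * _).
by rewrite subSn ?(ltnW (ltn_ord i))// big_nat_recr.
Qed.

(** Mertens' theorem for absolutely convergent series.  For the series of
    absolute values the triangle i + j < 2N contains the square i, j < N, so
    its sums have the same limit as the squares; the difference between square
    and triangle then also dominates that of the original series. *)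
Lemma series_cauchy_prod_cvg (R : realType) (a b : nat -> R) :
  cvgn (series (fun n => `|a n|)) -> cvgn (series (fun n => `|b n|)) ->
  series (cauchy_prod a b) n @[n --> \oo] -->
    limn (series a) * limn (series b).
Proof.
move=> ca cb.
pose a' n : R := `|a n|; pose b' n : R := `|b n|.
have a'0 n : 0 <= a' n by exact: normr_ge0.
have b'0 n : 0 <= b' n by exact: normr_ge0.
pose D' := series (cauchy_prod a' b').
have sa0 N : 0 <= series a' N by apply: sumr_ge0 => n _; exact: normr_ge0.
have sb0 N : 0 <= series b' N by apply: sumr_ge0 => n _; exact: normr_ge0.
have sa_nd : nondecreasing_seq (series a') by apply: nondecreasing_series => n _ _; exact: normr_ge0.
have sb_nd : nondecreasing_seq (series b') by apply: nondecreasing_series => n _ _; exact: normr_ge0.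
have D'_nd : nondecreasing_seq D'.
  by apply: nondecreasing_series => n _ _; apply: sumr_ge0 => i _; rewrite mulr_ge0.
have seriesE (u : nat -> R) N : series u N = \sum_(i < N) u i.
  by rewrite /series/= big_mkord.
have D'_le N : D' N <= series a' N * series b' N.
  rewrite /D' series_cauchy_prodE [series a' N]seriesE mulr_suml.
  by apply: ler_sum => i _; rewrite ler_wpM2l// sb_nd// leq_subr.
have D'_ge N : series a' N * series b' N <= D' (N + N)%N.
  rewrite /D' series_cauchy_prodE [series a' N]seriesE mulr_suml.
  rewrite big_split_ord/= -[leLHS]addr0; apply: lerD.
    apply: ler_sum => i _; rewrite ler_wpM2l// sb_nd//.
    by rewrite -addnBA ?leq_addr// ltnW.
  by apply: sumr_ge0 => i _; rewrite mulr_ge0.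
have cvab : series a' n * series b' n @[n --> \oo] --> limn (series a') * limn (series b').
  by apply: cvgM.
have cvD' : D' n @[n --> \oo] --> limn (series a') * limn (series b').
  have cD' : cvgn D'.
    apply: nondecreasing_is_cvgn => //; exists (limn (series a') * limn (series b')).
    move=> _ [n _ <-]; apply: le_trans (D'_le n) _.
    by apply: ler_pM => //; exact: nondecreasing_cvgn_le.
  suff <- : limn D' = limn (series a') * limn (series b') by [].
  apply/eqP; rewrite eq_le; apply/andP; split.
    rewrite -(cvg_lim (@Rhausdorff R) cvab); apply: ler_lim => //.
      by apply/cvg_ex; eexists; exact: cvab.
    by apply: nearW.
  rewrite -(cvg_lim (@Rhausdorff R) cvab); apply: limr_le.
    by apply/cvg_ex; eexists; exact: cvab.
  apply: nearW => n; apply: le_trans (D'_ge n) _.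
  exact: nondecreasing_cvgn_le.
have cva := normed_cvg ca; have cvb := normed_cvg cb.
have cvAB : series a n * series b n @[n --> \oo] --> limn (series a) * limn (series b).
  by apply: cvgM.
suff d0 : series a n * series b n - series (cauchy_prod a b) n @[n --> \oo] --> 0.
  rewrite -[X in _ --> X]subr0.
  rewrite (_ : series (cauchy_prod a b) = fun n => series a n * series b n -
    (series a n * series b n - series (cauchy_prod a b) n)).
    by apply: cvgB.
  by apply/funext => n; rewrite opprB addrC subrK.
have d'0 : series a' n * series b' n - D' n @[n --> \oo] --> 0.
  rewrite -[X in _ --> X](subrr (limn (series a') * limn (series b'))).
  by apply: cvgB.
apply/cvgr0Pnorm_le => e e0; move/cvgr0Pnorm_le : d'0 => /(_ e e0).
apply: filterS => n; apply: le_trans.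
rewrite [leRHS]ger0_norm ?subr_ge0//.
rewrite series_cauchy_prodE /D' series_cauchy_prodE [series a n]seriesE [series a' n]seriesE.
rewrite !mulr_suml -!sumrB.
apply: le_trans (ler_norm_sum _ _ _) _; apply: ler_sum => i _.
rewrite -!mulrBr normrM ler_wpM2l//.
rewrite !sub_series_geq ?leq_subr//.
exact: ler_norm_sum.
Qed.

Lemma cauchy_prod_series_le (R : realType) (a b : nat -> R) (N : nat) :
  cvgn (series (fun n => `|a n|)) -> cvgn (series (fun n => `|b n|)) ->
  `|series (cauchy_prod a b) N| <=
    limn (series (fun n => `|a n|)) * limn (series (fun n => `|b n|)).
Proof.
move=> ca cb; rewrite series_cauchy_prodE.
apply: le_trans (ler_norm_sum _ _ _) _.
apply: (@le_trans _ _ (series (fun n => `|a n|) N * limn (series (fun n => `|b n|)))).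
  rewrite /series/= big_mkord mulr_suml; apply: ler_sum => i _.
  by rewrite normrM ler_wpM2l//; exact: series_norm_le_limn.
rewrite ler_wpM2r//.
  by apply: le_trans (series_norm_le_limn 0 cb).
apply: nondecreasing_cvgn_le => //; by apply: nondecreasing_series => n _.
Qed.

(** * The k-Mittag-Leffler function and the Prabhakar kernel *)

(** The Taylor coefficients of (1 - k x)^(- c / k). *)
Definition kPoch_fact (R : realType) (k c : R) (n : nat) : R :=
  kPochhammer k c n / n`!%:R.

Lemma kPoch_factS (R : realType) (k c : R) (n : nat) :
  n.+1%:R * kPoch_fact k c n.+1 = (c + n%:R * k) * kPoch_fact k c n.
Proof.
rewrite /kPoch_fact /kPochhammer big_ord_recr/= factS natrM.
have f0 : n`!%:R != 0 :> R by rewrite pnatr_eq0 -lt0n fact_gt0.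
have n0 : n.+1%:R != 0 :> R by rewrite pnatr_eq0.
by field; rewrite f0 /= nat1r n0.
Qed.

Lemma kPoch_fact0 (R : realType) (k c : R) : kPoch_fact k c 0 = 1.
Proof. by rewrite /kPoch_fact /kPochhammer big_ord0 fact0 divr1. Qed.

Lemma kPoch_fact_le (R : realType) (k c : R) (n : nat) : 0 <= k ->
  `|kPoch_fact k c n| <= (`|c| + k) ^+ n.
Proof.
move=> k0; elim: n => [|n ih]; first by rewrite kPoch_fact0 normr1.
have n0 : 0 < n.+1%:R :> R by [].
rewrite -(ler_pM2l n0) -{1}(ger0_norm (ltW n0)) -normrM kPoch_factS normrM.
rewrite exprS mulrA; apply: ler_pM => //.
apply: le_trans (ler_normD _ _) _; rewrite mulrDr lerD//.
  by rewrite ler_peMl// ler1n.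
by rewrite ger0_norm ?mulr_ge0// ler_wpM2r// ler_nat.
Qed.

(** Vandermonde's identity, the coefficient form of
    (1 - k x)^(-c/k) (1 - k x)^(-d/k) = (1 - k x)^(-(c+d)/k).  Both sides satisfy
    the recurrence [kPoch_factS], which results from splitting the factor
    n + 1 as i + (n + 1 - i) in the Cauchy product. *)
Lemma kPoch_factD (R : realType) (k c d : R) (n : nat) :
  cauchy_prod (kPoch_fact k c) (kPoch_fact k d) n = kPoch_fact k (c + d) n.
Proof.
elim: n => [|n ih].
  by rewrite /cauchy_prod big_ord_recr big_ord0/= add0r !kPoch_fact0 mulr1.
have n0 : n.+1%:R != 0 :> R by rewrite pnatr_eq0.
apply: (mulfI n0); rewrite kPoch_factS -ih /cauchy_prod.
transitivity (\sum_(i < n.+2) (i%:R * kPoch_fact k c i) * kPoch_fact k d (n.+1 - i)%N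
  + \sum_(i < n.+2) kPoch_fact k c i *
      ((n.+1 - i)%:R * kPoch_fact k d (n.+1 - i)%N)).
  rewrite mulr_sumr -big_split/=; apply: eq_bigr => i _.
  have -> : n.+1%:R = i%:R + (n.+1 - i)%:R :> R.
    by rewrite -natrD subnKC// -ltnS.
  ring.
rewrite big_ord_recl/= mul0r mul0r add0r.
rewrite [X in _ + X]big_ord_recr/= subnn mul0r mulr0 addr0.
rewrite mulr_sumr -big_split/=; apply: eq_bigr => i _.
rewrite /bump/= add1n kPoch_factS subSS.
rewrite subSn ?kPoch_factS; last by rewrite -ltnS.
have -> : n%:R = i%:R + (n - i)%:R :> R by rewrite -natrD subnKC// -ltnS.
ring.
Qed.

Definition kML_coef (R : realType) (k alpha m c : R) (n : nat) : R :=
  kPoch_fact k c n / kGamma k (n%:R * alpha + m).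

Lemma kMittagLefflerE (R : realType) (k alpha m c z : R) :
  kMittagLeffler k alpha m c z = limn (pseries (kML_coef k alpha m c) z).
Proof.
rewrite /kMittagLeffler /pseries; congr (limn (series _)); apply/funext => n.
by rewrite /= /kML_coef /kPoch_fact; ring.
Qed.

(** The Pochhammer factor grows at most geometrically, the gamma function faster
    than any geometric sequence. *)
Lemma kML_coef_entire (R : realType) (k alpha m c : R) : 0 < k -> 0 < alpha ->
  0 < m -> entire_coef (kML_coef k alpha m c).
Proof.
move=> k0 a0 m0 Z Z0.
have ck0 : 0 < `|c| + k by rewrite ltr_wpDl.
have M0 : 0 < (`|c| + k) * Z by rewrite mulr_gt0.
have [e [N [e0 eN]]] := kGamma_growth k0 a0 m0 M0.
have G0 n : 0 < kGamma k (n%:R * alpha + m).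
  by apply: kGamma_gt0 => //; rewrite ltr_wpDl// mulr_ge0// ltW.
pose S := \sum_(i < N) `|kML_coef k alpha m c i| * Z ^+ i.
have S0 : 0 <= S by apply: sumr_ge0 => i _; rewrite mulr_ge0// exprn_ge0// ltW.
exists (e^-1 + S) => n; have [nN|Nn] := ltnP n N.
  rewrite -[leLHS]add0r lerD ?invr_ge0 ?(ltW e0)//.
  rewrite /S (bigD1 (Ordinal nN))//= lerDl; apply: sumr_ge0 => i _.
  by rewrite mulr_ge0// exprn_ge0// ltW.
rewrite -[leLHS]addr0 lerD//.
rewrite /kML_coef normrM normfV (gtr0_norm (G0 n)) mulrAC ler_pdivrMr//.
rewrite ler_pdivlMl//; apply: le_trans (eN _ Nn).
rewrite ler_pM2l// exprMn ler_wpM2r ?exprn_ge0 ?(ltW Z0)//.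
exact: kPoch_fact_le (ltW k0).
Qed.

Lemma kMittagLeffler_continuous (R : realType) (k alpha m c : R) : 0 < k ->
  0 < alpha -> 0 < m -> continuous (kMittagLeffler k alpha m c).
Proof.
move=> k0 a0 m0.
rewrite (_ : kMittagLeffler k alpha m c =
    fun z => limn (pseries (kML_coef k alpha m c) z)).
  exact: entire_coef_continuous (kML_coef_entire _ _ _ _).
by apply/funext => z; rewrite kMittagLefflerE.
Qed.

Lemma kMittagLeffler0_gt0 (R : realType) (k alpha m c : R) : 0 < k ->
  0 < m -> 0 < kMittagLeffler k alpha m c 0.
Proof.
move=> k0 m0; rewrite kMittagLefflerE.
rewrite (_ : limn _ = (kGamma k m)^-1); first by rewrite invr_gt0 kGamma_gt0.
apply: cvg_lim => //; apply: cvg_near_cst; exists 1%N => // -[|n] //= _.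
rewrite /pseries /series/= big_nat_recl// big1_seq ?addr0.
  by rewrite /kML_coef kPoch_fact0 expr0 mulr1 mul0r add0r mul1r.
by move=> i _; rewrite exprS mul0r mulr0.
Qed.

(** The kernel is a series of powers of t, each of which can be convolved by a
    Beta integral. *)
Definition kPrabhakar_term (R : realType) (k alpha m omega c : R) (n : nat)
    (t : R) : R :=
  kML_coef k alpha m c n * omega ^+ n / k * tpow ((n%:R * alpha + m) / k - 1) t.

Lemma kPrabhakar_termE (R : realType) (k alpha m omega c t : R) (n : nat) :
  0 < t -> 0 < k ->
  kPrabhakar_term k alpha m omega c n t = t `^ (m / k - 1) / k *
    (kML_coef k alpha m c n * (omega * t `^ (alpha / k)) ^+ n).
Proof.
move=> t0 k0; rewrite /kPrabhakar_term tpowE//.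
have -> : (n%:R * alpha + m) / k - 1 = (m / k - 1) + alpha / k * n%:R.
  by rewrite mulrDl; ring.
rewrite powRD ?(gt_eqF t0) ?implybT// powRrM powR_mulrn ?powR_ge0// exprMn.
ring.
Qed.

Lemma kPrabhakar_term_le0 (R : realType) (k alpha m omega c t : R) (n : nat) :
  t <= 0 -> kPrabhakar_term k alpha m omega c n t = 0.
Proof. by move=> t0; rewrite /kPrabhakar_term /tpow ltNge t0/= mulr0. Qed.

Lemma kPrabhakar_kernel_le0 (R : realType) (k alpha m omega c t : R) :
  t <= 0 -> kPrabhakar_kernel k alpha m omega c t = 0.
Proof. by move=> t0; rewrite /kPrabhakar_kernel ltNge t0. Qed.

Lemma kPrabhakar_term_norm_cvg (R : realType) (k alpha m omega c t : R) :
  0 < k -> 0 < alpha -> 0 < m ->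
  cvgn (series (fun n => `|kPrabhakar_term k alpha m omega c n t|)).
Proof.
move=> k0 a0 m0; have [t0|t0] := leP t 0.
  rewrite (_ : series _ = cst 0); first exact: is_cvg_cst.
  apply/funext => n; rewrite /series/= big1// => i _.
  by rewrite kPrabhakar_term_le0// normr0.
rewrite (_ : (fun n => _) = fun n => `|t `^ (m / k - 1) / k| *
    `|kML_coef k alpha m c n * (omega * t `^ (alpha / k)) ^+ n|).
  apply: is_cvg_seriesZ; apply: entire_coef_cvg; exact: kML_coef_entire.
by apply/funext => n; rewrite kPrabhakar_termE// normrM.
Qed.

Lemma kPrabhakar_kernel_series (R : realType) (k alpha m omega c t : R) :
  0 < k -> 0 < alpha -> 0 < m ->
  kPrabhakar_kernel k alpha m omega c t =
    limn (series (fun n => kPrabhakar_term k alpha m omega c n t)).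
Proof.
move=> k0 a0 m0; have [t0|t0] := leP t 0.
  rewrite kPrabhakar_kernel_le0//; apply/esym.
  rewrite (_ : series _ = cst 0); first exact: lim_cst.
  by apply/funext => n; rewrite /series/= big1// => i _; rewrite kPrabhakar_term_le0.
rewrite /kPrabhakar_kernel t0 kMittagLefflerE.
rewrite (_ : (fun n => kPrabhakar_term _ _ _ _ _ n t) = fun n => t `^ (m / k - 1) / k *
    (kML_coef k alpha m c n * (omega * t `^ (alpha / k)) ^+ n)).
  by rewrite lim_seriesZ//; apply: entire_coef_pseries_cvg; exact: kML_coef_entire.
by apply/funext => n; rewrite kPrabhakar_termE.
Qed.

Lemma lebesgue_dominated_convergence (R : realType) (D : set R) (f_ : nat -> R -> \bar R)
    (f g : R -> \bar R) :
  measurable D -> (forall n, measurable_fun D (f_ n)) ->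
  (forall x, D x -> f_ n x @[n --> \oo] --> f x) ->
  (@lebesgue_measure R).-integrable D g ->
  (forall n x, D x -> (`|f_ n x| <= g x)%E) ->
  (@lebesgue_measure R).-integrable D f /\
  (\int[@lebesgue_measure R]_(x in D) f_ n x)%E @[n --> \oo] -->
  (\int[@lebesgue_measure R]_(x in D) f x)%E.
Proof.
move=> mD mf fcvg ig fg.
have mf' : measurable_fun D f by exact: emeasurable_fun_cvg fcvg.
have [||if_ _ cvf] := @dominated_convergence _ _ R (@lebesgue_measure R) D mD
  f_ f g mf mf' _ ig _; last by split.
- by apply/aeW => x; exact: fcvg.
- by apply/aeW => x n; exact: fg.
Qed.

Lemma lebesgue_integral_sum (R : realType) (I : Type) (s : seq I) (h : I -> R -> R) :
  (forall i, (@lebesgue_measure R).-integrable setT (EFin \o h i)) ->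
  (@lebesgue_measure R).-integrable setT (fun x => (\sum_(i <- s) h i x)%:E) /\
  (\int[@lebesgue_measure R]_x (\sum_(i <- s) h i x)%:E =
   \sum_(i <- s) \int[@lebesgue_measure R]_x (h i x)%:E)%E.
Proof.
move=> ih; under eq_fun do rewrite -sumEFin.
split; first by apply: integrable_sum => // i _; exact: ih.
by rewrite integral_sum.
Qed.

Lemma measurable_kPrabhakar_kernel (R : realType) (k alpha m omega c : R) :
  0 < k -> 0 < alpha -> 0 < m ->
  measurable_fun setT (kPrabhakar_kernel k alpha m omega c).
Proof.
move=> k0 a0 m0; apply: measurable_fun_ifT => //; first exact: measurable_fun_ltr.
apply: measurable_funM.
  by apply: measurable_funM => //; exact: measurable_powR.
apply: measurableT_comp.
  apply: continuous_measurable_fun; exact: kMittagLeffler_continuous.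
by apply: measurable_funM => //; exact: measurable_powR.
Qed.

Lemma kPrabhakar_kernel_continuous (R : realType) (k alpha m omega c t : R) :
  0 < k -> 0 < alpha -> 0 < m -> 0 < t ->
  {for t, continuous (kPrabhakar_kernel k alpha m omega c)}.
Proof.
move=> k0 a0 m0 t0.
pose g (t : R) := t `^ (m / k - 1) / k
      * kMittagLeffler k alpha m c (omega * t `^ (alpha / k)).
have cg : {for t, continuous g}.
  apply: cvgM.
    by apply: cvgM; [exact: powR_continuous_gt0|exact: cvg_cst].
  apply: continuous_comp; last exact: kMittagLeffler_continuous.
  by apply: cvgM; [exact: cvg_cst|exact: powR_continuous_gt0].
rewrite /prop_for /continuous_at {2}/kPrabhakar_kernel t0.
apply: cvg_trans cg; apply: near_eq_cvg; near=> s.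
rewrite /kPrabhakar_kernel ifT//; near: s; exact: lt_nbhsr.
Unshelve. all: by end_near. Qed.

(** The power series factor is largest at b, because its argument grows with
    t; this also dominates the partial sums in the semigroup law. *)
Lemma kPrabhakar_term_bound (R : realType) (k alpha m omega c b : R) :
  0 < k -> 0 < alpha -> 0 < m -> 0 < b ->
  exists2 C, 0 <= C & forall t, t <= b ->
    limn (series (fun n => `|kPrabhakar_term k alpha m omega c n t|)) <=
      C * tpow (m / k - 1) t.
Proof.
move=> k0 a0 m0 b0.
pose S := limn (series (fun n => `|kML_coef k alpha m c n *
  (omega * b `^ (alpha / k)) ^+ n|)).
have cS : cvgn (series (fun n => `|kML_coef k alpha m c n *
  (omega * b `^ (alpha / k)) ^+ n|)).
  by apply: entire_coef_cvg; exact: kML_coef_entire.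
have S0 : 0 <= S by apply: le_trans (series_norm_le_limn 0 cS).
exists (k^-1 * S) => [|t tb]; first by rewrite mulr_ge0// invr_ge0 ltW.
have [t0|t0] := leP t 0.
  rewrite /tpow ltNge t0/= mulr0.
  rewrite (_ : series _ = cst 0) ?lim_cst//.
  by apply/funext => n; rewrite /series/= big1// => i _; rewrite kPrabhakar_term_le0// normr0.
rewrite tpowE//.
have ct : cvgn (series (fun n => `|kML_coef k alpha m c n *
    (omega * t `^ (alpha / k)) ^+ n|)).
  by apply: entire_coef_cvg; exact: kML_coef_entire.
rewrite (_ : (fun n => _) = fun n => `|t `^ (m / k - 1) / k| *
    `|kML_coef k alpha m c n * (omega * t `^ (alpha / k)) ^+ n|); last first.
  by apply/funext => n; rewrite kPrabhakar_termE// normrM.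
have LS : limn (series (fun n => `|kML_coef k alpha m c n *
    (omega * t `^ (alpha / k)) ^+ n|)) <= S.
  apply: (lim_series_le ct cS) => n.
  rewrite !normrM ler_wpM2l// !normrX lerXn2r ?nnegrE// !normrM ler_wpM2l//.
  rewrite !ger0_norm ?powR_ge0//; apply: ge0_ler_powR; rewrite ?nnegrE ?(ltW t0) ?(ltW b0)//.
  by rewrite divr_ge0// ltW.
rewrite (lim_seriesZ _ ct) ger0_norm; last by rewrite mulr_ge0 ?powR_ge0 ?invr_ge0 ?(ltW k0).
move: LS S0; move: (limn _) S => L S' LS S0.
rewrite /GRing.scale/= -mulrA [leRHS]mulrC ler_wpM2l ?powR_ge0//.
by rewrite ler_wpM2l ?invr_ge0 ?(ltW k0).
Qed.

Lemma kPrabhakar_kernel_bound (R : realType) (k alpha m omega c b : R) :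
  0 < k -> 0 < alpha -> 0 < m -> 0 < b ->
  exists2 C, 0 <= C & forall t, t <= b ->
    `|kPrabhakar_kernel k alpha m omega c t| <= C * tpow (m / k - 1) t.
Proof.
move=> k0 a0 m0 b0.
have [C C0 HC] := @kPrabhakar_term_bound _ k alpha m omega c b k0 a0 m0 b0.
exists C => // t tb; apply: le_trans (HC _ tb).
rewrite kPrabhakar_kernel_series//; apply: lim_series_norm.
exact: kPrabhakar_term_norm_cvg.
Qed.

(** Since the Mittag-Leffler function is positive at 0, the kernel is comparable
    to its singular factor near 0.  Integrability against the kernel thus
    gives integrability against the singular factor. *)
Lemma kPrabhakar_kernel_lower (R : realType) (k alpha m omega c : R) :
  0 < k -> 0 < alpha -> 0 < m ->
  exists e d, [/\ 0 < e, 0 < d & forall t, t < d ->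
    e * tpow (m / k - 1) t <= kPrabhakar_kernel k alpha m omega c t].
Proof.
move=> k0 a0 m0.
have E0 := kMittagLeffler0_gt0 alpha c k0 m0.
set E := kMittagLeffler k alpha m c in E0.
have ak0 : 0 < alpha / k by rewrite divr_gt0.
have cvE : E (omega * t `^ (alpha / k)) @[t --> 0^'+] --> E 0.
  apply: (@cvg_comp _ _ _ (fun t => omega * t `^ (alpha / k)) E _ (nbhs (0 : R))).
    have : omega * t `^ (alpha / k) @[t --> 0^'+] --> omega * 0.
      by apply: cvgM; [exact: cvg_cst|exact: powR_cvg0].
    by rewrite mulr0.
  exact: kMittagLeffler_continuous.
have E20 : E 0 / 2 < E 0 by rewrite ltr_pdivrMr// ltr_pMr// ltr1n.
have /= := cvgr_ge _ cvE _ E20.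
move=> [d /= d0 Hd]; exists (E 0 / 2 / k), d; split => //.
  by rewrite !divr_gt0.
move=> t td; have [t0|t0] := leP t 0.
  by rewrite /tpow ltNge t0/= mulr0 kPrabhakar_kernel_le0.
rewrite tpowE// /kPrabhakar_kernel t0.
have -> : E 0 / 2 / k * t `^ (m / k - 1) = t `^ (m / k - 1) / k * (E 0 / 2) by ring.
rewrite ler_wpM2l ?mulr_ge0 ?powR_ge0 ?invr_ge0 ?(ltW k0)//; apply: Hd => //.
by rewrite /= sub0r normrN gtr0_norm.
Qed.

Lemma eBeta_lty (R : realType) (x y t : R) : 0 < x -> 0 < y -> 0 < t ->
  (eBeta x y t < +oo)%E.
Proof.
move=> x0 y0 t0; have := @kGamma_beta R 1 x y t ltr01 x0 y0 t0.
by rewrite !divr1 => ->; rewrite ltry.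
Qed.

Lemma integrable_beta (R : realType) (x y t : R) : 0 < x -> 0 < y -> 0 < t ->
  (@lebesgue_measure R).-integrable setT
    (fun u : R => (tpow (x - 1) (t - u) * tpow (y - 1) u)%:E).
Proof.
move=> x0 y0 t0; apply/integrableP; split; first exact: measurable_beta_integrand.
apply: le_lt_trans (eBeta_lty x0 y0 t0).
rewrite le_eqVlt; apply/orP; left; apply/eqP; apply: eq_integral => u _.
by rewrite gee0_abs// beta_integrand_ge0.
Qed.

Lemma kPrabhakar_term_conv (R : realType) (k alpha omega m1 c1 m2 c2 t : R)
    (i j : nat) :
  0 < k -> 0 < alpha -> 0 < m1 -> 0 < m2 -> 0 < t ->
  (@lebesgue_measure R).-integrable setT (fun u =>
    (kPrabhakar_term k alpha m1 omega c1 i (t - u) *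
     kPrabhakar_term k alpha m2 omega c2 j u)%:E) /\
  (\int[@lebesgue_measure R]_u
    (kPrabhakar_term k alpha m1 omega c1 i (t - u) *
     kPrabhakar_term k alpha m2 omega c2 j u)%:E =
  (kPoch_fact k c1 i * kPoch_fact k c2 j * (omega ^+ (i + j) / k *
    (kGamma k ((i + j)%:R * alpha + (m1 + m2)))^-1 *
     t `^ (((i + j)%:R * alpha + (m1 + m2)) / k - 1)))%:E)%E.
Proof.
move=> k0 a0 m10 m20 t0.
have z0 (n : nat) m : 0 < m -> 0 < n%:R * alpha + m.
  by move=> m0; rewrite ltr_wpDl// mulr_ge0// ltW.
set z1 := i%:R * alpha + m1; set z2 := j%:R * alpha + m2.
have z10 : 0 < z1 by exact: z0.
have z20 : 0 < z2 by exact: z0.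
have ib := integrable_beta (divr_gt0 z10 k0) (divr_gt0 z20 k0) t0.
set C := (kML_coef k alpha m1 c1 i * omega ^+ i / k) *
  (kML_coef k alpha m2 c2 j * omega ^+ j / k).
have E : (fun u : R => (kPrabhakar_term k alpha m1 omega c1 i (t - u) *
     kPrabhakar_term k alpha m2 omega c2 j u)%:E) =
  (fun u => C%:E * (tpow (z1 / k - 1) (t - u) * tpow (z2 / k - 1) u)%:E)%E.
  by apply/funext => u; rewrite -EFinM /kPrabhakar_term mulrACA.
rewrite E; split; first exact: integrableZl.
have H := integralZl measurableT ib C.
apply: etrans; first exact: H.
rewrite -/(eBeta (z1 / k) (z2 / k) t) (kGamma_beta k0 z10 z20 t0) -EFinM; congr EFin.
have -> : z1 + z2 = (i + j)%:R * alpha + (m1 + m2) by rewrite /z1 /z2 natrD; ring.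
rewrite /C /kML_coef -/z1 -/z2 exprD.
have G1 : kGamma k z1 != 0 by rewrite gt_eqF// kGamma_gt0.
have G2 : kGamma k z2 != 0 by rewrite gt_eqF// kGamma_gt0.
have G12 : kGamma k ((i + j)%:R * alpha + (m1 + m2)) != 0.
  by rewrite gt_eqF// kGamma_gt0// z0// addr_gt0.
have kn0 : k != 0 by rewrite gt_eqF.
move: (kPoch_fact k c1 i) (kPoch_fact k c2 j) (kGamma k z1) (kGamma k z2)
  (kGamma k _) (t `^ _) (omega ^+ i) (omega ^+ j) G1 G2 G12 => *.
by field; apply/and4P.
Qed.

Lemma measurable_kPrabhakar_term (R : realType) (k alpha m omega c : R)
    (n : nat) : measurable_fun setT (kPrabhakar_term k alpha m omega c n).
Proof. by apply: measurable_funM => //; exact: measurable_tpow. Qed.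

Lemma measurable_subl (R : realType) (t : R) (f : R -> R) :
  measurable_fun setT f -> measurable_fun setT (fun u : R => f (t - u)).
Proof. by move=> mf; apply: measurableT_comp => //; apply: measurable_funB. Qed.

(** The semigroup law.  The partial sums of the Cauchy product of the two series
    converge to the product of the kernels and are dominated by an integrable
    product of two powers, so the integral can be taken term by term. *)
Lemma kPrabhakar_kernel_conv (R : realType) (k alpha omega m1 c1 m2 c2 t : R) :
  0 < k -> 0 < alpha -> 0 < m1 -> 0 < m2 -> 0 < t ->
  (@lebesgue_measure R).-integrable setT (fun u =>
    (kPrabhakar_kernel k alpha m1 omega c1 (t - u) *
     kPrabhakar_kernel k alpha m2 omega c2 u)%:E) /\
  (\int[@lebesgue_measure R]_u
    (kPrabhakar_kernel k alpha m1 omega c1 (t - u) *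
     kPrabhakar_kernel k alpha m2 omega c2 u)%:E =
  (kPrabhakar_kernel k alpha (m1 + m2) omega (c1 + c2) t)%:E)%E.
Proof.
move=> k0 a0 m10 m20 t0.
pose T1 (u : R) i := kPrabhakar_term k alpha m1 omega c1 i (t - u).
pose T2 (u : R) j := kPrabhakar_term k alpha m2 omega c2 j u.
pose S N (u : R) := (series (cauchy_prod (T1 u) (T2 u)) N)%:E.
have [C1 C10 HC1] := @kPrabhakar_term_bound _ k alpha m1 omega c1 t k0 a0 m10 t0.
have [C2 C20 HC2] := @kPrabhakar_term_bound _ k alpha m2 omega c2 t k0 a0 m20 t0.
pose g (u : R) := ((C1 * C2)%:E *
  (tpow (m1 / k - 1) (t - u) * tpow (m2 / k - 1) u)%:E)%E.
have mS N : measurable_fun setT (S N).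
  apply/measurable_EFinP; apply: measurable_sum => n; apply: measurable_sum => i.
  apply: measurable_funM; last exact: measurable_kPrabhakar_term.
  by apply: measurable_subl; exact: measurable_kPrabhakar_term.
have mK : measurable_fun setT (fun u : R => (kPrabhakar_kernel k alpha m1 omega c1 (t - u) *
     kPrabhakar_kernel k alpha m2 omega c2 u)%:E).
  apply/measurable_EFinP; apply: measurable_funM; last exact: measurable_kPrabhakar_kernel.
  by apply: measurable_subl; exact: measurable_kPrabhakar_kernel.
have T1cvg u : cvgn (series (fun n => `|T1 u n|)) by exact: kPrabhakar_term_norm_cvg.
have T2cvg u : cvgn (series (fun n => `|T2 u n|)) by exact: kPrabhakar_term_norm_cvg.
have ig : (@lebesgue_measure R).-integrable setT g.
  by apply: integrableZl => //; apply: integrable_beta; rewrite ?divr_gt0.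
have Scvg u : S n u @[n --> \oo] --> (kPrabhakar_kernel k alpha m1 omega c1 (t - u) *
     kPrabhakar_kernel k alpha m2 omega c2 u)%:E.
  apply: cvg_EFin; first by near=> n.
  rewrite !kPrabhakar_kernel_series//.
  exact: series_cauchy_prod_cvg (T1cvg u) (T2cvg u).
have Sle u n : (`|S n u| <= g u)%E.
  rewrite /S /g -EFinM lee_fin.
  have [u0|u0] := leP u 0.
    rewrite [tpow (m2 / k - 1) u]/tpow ltNge u0/= !mulr0.
    rewrite /series/= big1 ?normr0// => i _; rewrite /cauchy_prod big1// => j _.
    by rewrite /T2 kPrabhakar_term_le0// mulr0.
  have [tu|ut] := leP t u.
    rewrite [tpow (m1 / k - 1) _]/tpow subr_gt0 ltNge tu/= mul0r mulr0.
    rewrite /series/= big1 ?normr0// => i _; rewrite /cauchy_prod big1// => j _.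
    by rewrite /T1 kPrabhakar_term_le0 ?mul0r// subr_le0.
  apply: le_trans (cauchy_prod_series_le _ (T1cvg u) (T2cvg u)) _.
  rewrite mulrACA; apply: ler_pM.
  - by apply: le_trans (series_norm_le_limn 0 (T1cvg u)).
  - by apply: le_trans (series_norm_le_limn 0 (T2cvg u)).
  - by apply: HC1; rewrite gerBl ltW.
  - by apply: HC2; rewrite ltW.
have [iK cvI] := lebesgue_dominated_convergence measurableT mS (fun u _ => Scvg u) ig
  (fun n u _ => Sle u n).
split => //.
apply: (@cvg_unique _ (@ereal_hausdorff R) _ _ _ _ cvI).
rewrite kPrabhakar_kernel_series ?addr_gt0//.
rewrite /= [X in X @ \oo --> _](_ : _ = EFin \o series (fun n =>
    kPrabhakar_term k alpha (m1 + m2) omega (c1 + c2) n t)).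
  apply: cvg_EFin; first by near=> n.
  by apply: normed_cvg; apply: kPrabhakar_term_norm_cvg; rewrite ?addr_gt0.
apply/funext => N /=.
have iT n i := (@kPrabhakar_term_conv R k alpha omega m1 c1 m2 c2 t i (n - i)%N
  k0 a0 m10 m20 t0).1.
have ic n := lebesgue_integral_sum (index_enum 'I_n.+1) (fun i : 'I_n.+1 => iT n i).
have [_ H] := lebesgue_integral_sum (index_iota 0 N) (fun n => (ic n).1).
apply: etrans; first exact: H.
rewrite /series/= -sumEFin; apply: eq_bigr => n _.
apply: etrans; first exact: (ic n).2.
transitivity (\sum_(i < n.+1) (kPoch_fact k c1 i * kPoch_fact k c2 (n - i)%N *
  (omega ^+ n / k * (kGamma k (n%:R * alpha + (m1 + m2)))^-1 *
     t `^ ((n%:R * alpha + (m1 + m2)) / k - 1)))%:E)%E.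
  apply: eq_bigr => i _.
  apply: etrans; first exact: (@kPrabhakar_term_conv R k alpha omega m1 c1 m2 c2 t i
    (n - i)%N k0 a0 m10 m20 t0).2.
  by rewrite subnKC// -ltnS.
rewrite sumEFin; congr EFin; rewrite -mulr_suml -/(cauchy_prod _ _ _) kPoch_factD.
by rewrite /kPrabhakar_term tpowE// /kML_coef; ring.
Unshelve. all: by end_near. Qed.

(** * Convolutions over the line and Fubini's theorem *)

Lemma lebesgue_integral_isometry (R : realType) (c d : R) (f : R -> R) : `|c| = 1 ->
  measurable_fun setT f ->
  (\int[@lebesgue_measure R]_x (f (c * x + d)%R)%:E =
   \int[@lebesgue_measure R]_x (f x)%:E)%E.
Proof.
move=> c1 mf; have c0 : c != 0 by rewrite -normr_eq0 c1 oner_neq0.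
rewrite [LHS]integralE [RHS]integralE; congr (_ - _)%E; apply/esym.
- apply: etrans; first apply: (@ge0_integral_affine R c d (EFin \o f)^\+%E c0).
  + by apply: measurable_funepos; exact/measurable_EFinP.
  + by move=> x; exact: funepos_ge0.
  by rewrite c1 mul1e; apply: eq_integral => x _; rewrite !funeposE.
- apply: etrans; first apply: (@ge0_integral_affine R c d (EFin \o f)^\-%E c0).
  + by apply: measurable_funeneg; exact/measurable_EFinP.
  + by move=> x; exact: funeneg_ge0.
  by rewrite c1 mul1e; apply: eq_integral => x _; rewrite !funenegE.
Qed.

Lemma integrable_isometry (R : realType) (c d : R) (f : R -> R) : `|c| = 1 ->
  (@lebesgue_measure R).-integrable setT (EFin \o f) ->
  (@lebesgue_measure R).-integrable setT (fun x => (f (c * x + d))%:E).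
Proof.
move=> c1 /integrableP[/measurable_EFinP mf foo].
have mfa : measurable_fun setT (fun x : R => f (c * x + d)).
  by apply: measurableT_comp => //; apply: measurable_funD => //; exact: measurable_funM.
apply/integrableP; split; first exact/measurable_EFinP.
apply: le_lt_trans foo; rewrite le_eqVlt; apply/orP; left; apply/eqP.
apply: (@lebesgue_integral_isometry R c d (fun x => `|f x|) c1).
exact: measurableT_comp.
Qed.

(** The common source of the exchanges of integrals below: F (c u + d(v)) phi(v)
    is integrable in (u, v), since the inner integral over u does not depend
    on v; W cuts out the triangle of integration. *)
Lemma integrable_prod_isometry (R : realType) (F phi : R -> R) (c : R)
    (d : R -> R) (W : R * R -> bool) : `|c| = 1 ->
  measurable_fun setT d -> measurable_fun setT W ->
  (@lebesgue_measure R).-integrable setT (EFin \o F) ->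
  (@lebesgue_measure R).-integrable setT (EFin \o phi) ->
  (@lebesgue_measure R \x @lebesgue_measure R)%E.-integrable setT
    (fun p : R * R => (if W p then F (c * p.1 + d p.2) * phi p.2 else 0)%:E).
Proof.
move=> c1 md mW iF iphi.
have mF : measurable_fun setT F by have /integrableP[/measurable_EFinP] := iF.
have mphi : measurable_fun setT phi by have /integrableP[/measurable_EFinP] := iphi.
pose G (p : R * R) := F (c * p.1 + d p.2) * phi p.2.
have mG : measurable_fun setT G.
  apply: measurable_funM; last exact: measurableT_comp.
  apply: measurableT_comp => //; apply: measurable_funD; first exact: measurable_funM.
  exact: measurableT_comp.
have mGW : measurable_fun setT (fun p => if W p then G p else 0).
  exact: measurable_fun_ifT.
suff iG : (@lebesgue_measure R \x @lebesgue_measure R)%E.-integrable setT (EFin \o G).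
  apply: (le_integrable _ _ _ iG) => //; first exact/measurable_EFinP.
  by move=> p _ /=; case: ifP => // _; rewrite normr0 lee_fin.
apply/integrable21ltyP; first exact/measurable_EFinP.
have /integrableP[_ Foo] := iF; have /integrableP[_ phioo] := iphi.
rewrite (_ : \int[_]_y _ = (\int[@lebesgue_measure R]_x `|(EFin \o F) x|) *
    (\int[@lebesgue_measure R]_x `|(EFin \o phi) x|))%E; last first.
  rewrite -ge0_lebesgue_integralZl//; last 2 first.
  - by apply: integral_ge0.
  - by apply: measurableT_comp => //; exact/measurable_EFinP.
  apply: eq_integral => v _.
  transitivity (\int[@lebesgue_measure R]_u (`|(phi v)%:E| * `|(F (c * u + d v))%:E|))%E.
    by apply: eq_integral => u _; rewrite /= normrM mulrC.
  rewrite ge0_lebesgue_integralZl//; last first.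
    apply/measurable_EFinP; apply: measurableT_comp => //.
    by apply: measurableT_comp => //; apply: measurable_funD => //; exact: measurable_funM.
  rewrite muleC; congr (_ * _)%E.
  apply: (@lebesgue_integral_isometry R c (d v) (fun x => `|F x|) c1).
  exact: measurableT_comp.
apply: lte_mul_pinfty => //; first exact: integral_ge0.
by rewrite ge0_fin_numE//; exact: integral_ge0.
Qed.

(** Convolution over the whole line: with both factors extended by 0 it has no
    moving endpoint, unlike the convolution on ]0, t[. *)
Definition lconv (R : realType) (F phi : R -> R) (x : R) : R :=
  \int[@lebesgue_measure R]_u (F (x - u) * phi u).

Definition primitive (R : realType) (F : R -> R) (x : R) : R :=
  \int[@lebesgue_measure R]_(u in `]-oo, x[) F u.

Lemma primitiveE (R : realType) (F : R -> R) (x : R) :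
  primitive F x = \int[@lebesgue_measure R]_u (if u < x then F u else 0).
Proof.
rewrite /primitive Rintegral_mkcond; apply: eq_Rintegral => u _.
rewrite patchE; case: ifPn => [|/negP]; rewrite inE/= in_itv/=.
  by move=> ->.
by move/negP/negbTE => ->.
Qed.

Lemma integrable_lt (R : realType) (F : R -> R) (x : R) :
  (@lebesgue_measure R).-integrable setT (EFin \o F) ->
  (@lebesgue_measure R).-integrable setT (fun u => (if u < x then F u else 0)%:E).
Proof.
move=> iF; apply: (le_integrable _ _ _ iF) => //.
  apply/measurable_EFinP; apply: measurable_fun_ifT => //; first exact: measurable_fun_ltr.
  by have /integrableP[/measurable_EFinP] := iF.
by move=> p _ /=; case: ifP => // _; rewrite normr0 lee_fin.
Qed.

Lemma EFin_Rintegral (R : realType) (D : set R) (f : R -> R) : measurable D ->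
  (@lebesgue_measure R).-integrable D (EFin \o f) ->
  ((\int[@lebesgue_measure R]_(x in D) f x)%R%:E =
   \int[@lebesgue_measure R]_(x in D) (f x)%:E)%E.
Proof. by move=> mD jf; rewrite /Rintegral fineK// integrable_fin_num. Qed.

Lemma lconv_ae_integrable (R : realType) (F phi : R -> R) :
  (@lebesgue_measure R).-integrable setT (EFin \o F) ->
  (@lebesgue_measure R).-integrable setT (EFin \o phi) ->
  {ae @lebesgue_measure R, forall x, (@lebesgue_measure R).-integrable setT
    (fun u => (F (x - u) * phi u)%:E)}.
Proof.
move=> iF iphi.
have H := @integrable_prod_isometry R F phi 1 (fun v => - v) (fun=> true)
  (normr1 _) (@oppr_measurable R setT) (measurable_cst _) iF iphi.
have := ae_integrable1 H; apply: ae_imp => x.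
by under eq_fun do rewrite /= mul1r.
Qed.

Lemma lconv_integrable (R : realType) (F phi : R -> R) :
  (@lebesgue_measure R).-integrable setT (EFin \o F) ->
  (@lebesgue_measure R).-integrable setT (EFin \o phi) ->
  (@lebesgue_measure R).-integrable setT (EFin \o lconv F phi).
Proof.
move=> iF iphi.
have H := @integrable_prod_isometry R F phi 1 (fun v => - v) (fun=> true)
  (normr1 _) (@oppr_measurable R setT) (measurable_cst _) iF iphi.
have iH := integrable_fubini_F H.
apply: (ae_integrable_eq measurableT iH).
  have /integrableP[mH _] := iH.
  apply/measurable_EFinP.
  rewrite (_ : lconv F phi = fine \o fubini_F (@lebesgue_measure R)
    (fun p : R * R => (F (1 * p.1 - p.2) * phi p.2)%:E)).
    by apply: measurableT_comp => //; exact: measurable_fine.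
  apply/funext => x; rewrite /lconv /Rintegral /fubini_F /=.
  by under [in RHS]eq_integral do rewrite mul1r.
apply: ae_imp (lconv_ae_integrable iF iphi) => x ix _.
rewrite /= /lconv EFin_Rintegral// /fubini_F/=.
by apply: eq_integral => u _; rewrite mul1r.
Qed.

Lemma lebesgue_integral_if_isometry (R : realType) (F : R -> R) (W : R -> bool) (r c d : R) :
  `|c| = 1 -> measurable_fun setT W ->
  (@lebesgue_measure R).-integrable setT (EFin \o F) ->
  (\int[@lebesgue_measure R]_u (if W u then F (c * u + d) * r else 0)%:E =
   (r * \int[@lebesgue_measure R]_u (if W (c^-1 * (u - d)) then F u else 0))%:E)%E.
Proof.
move=> c1 mW iF.
have c0 : c != 0 by rewrite -normr_eq0 c1 oner_neq0.
have mWa : measurable_fun setT (fun u : R => W (c^-1 * (u - d))).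
  by apply: measurableT_comp => //; apply: measurable_funM => //; exact: measurable_funB.
have mF : measurable_fun setT F by have /integrableP[/measurable_EFinP] := iF.
have iG : (@lebesgue_measure R).-integrable setT
    (fun u => (if W (c^-1 * (u - d)) then F u else 0)%:E).
  apply: (le_integrable _ _ _ iF) => //.
    by apply/measurable_EFinP; exact: measurable_fun_ifT.
  by move=> u _ /=; case: ifP => // _; rewrite normr0 lee_fin.
have iGa := integrable_isometry d c1 iG.
rewrite EFinM EFin_Rintegral//.
transitivity (\int[@lebesgue_measure R]_u (r%:E *
    (if W (c^-1 * (c * u + d - d)) then F (c * u + d) else 0)%:E))%E.
  apply: eq_integral => u _; rewrite addrK mulrA mulVf// mul1r -EFinM.
  by case: ifP => _; rewrite ?mulr0// mulrC.
apply: etrans; first exact: (integralZl measurableT iGa r).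
congr (_ * _)%E.
apply: (@lebesgue_integral_isometry R c d (fun u => if W (c^-1 * (u - d)) then F u else 0) c1).
exact: measurable_fun_ifT.
Qed.

Lemma integrable_mul_primitive (R : realType) (F phi : R -> R) (x : R) :
  (@lebesgue_measure R).-integrable setT (EFin \o F) ->
  (@lebesgue_measure R).-integrable setT (EFin \o phi) ->
  (@lebesgue_measure R).-integrable setT
    (fun v => (phi v * primitive F (x - v))%:E).
Proof.
move=> iF iphi.
have mW : measurable_fun setT (fun p : R * R => p.1 < x).
  by apply: measurable_fun_ltr.
have H := @integrable_prod_isometry R F phi 1 (fun v => - v) _
  (normr1 _) (@oppr_measurable R setT) mW iF iphi.
have mWx : measurable_fun setT (fun u : R => u < x) by apply: measurable_fun_ltr.
have mP : measurable_fun setT (fun v => (phi v * primitive F (x - v))%:E).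
  rewrite [X in measurable_fun _ X](_ : _ = fun v => \int[@lebesgue_measure R]_s
      (if s < x then F (1 * s - v) * phi v else 0)%:E)%E.
    exact: (measurable_fubini_G H).
  apply/funext => v; apply/esym.
  apply: etrans; first exact: (@lebesgue_integral_if_isometry R F (fun s => s < x) (phi v) 1 (- v)
    (normr1 _) mWx iF).
  rewrite primitiveE; congr ((_ * _)%:E); apply: eq_Rintegral => u _.
  by rewrite invr1 mul1r opprK ltrBrDr.
have inF : (@lebesgue_measure R).-integrable setT (EFin \o (fun u => `|F u|)).
  exact: (integrable_norm iF).
pose M := \int[@lebesgue_measure R]_u `|F u|.
have PM y : `|primitive F y| <= M.
  rewrite primitiveE; apply: le_trans.
    by apply: le_normr_Rintegral => //; exact: (integrable_lt y iF).
  apply: le_Rintegral => //; first exact: (integrable_norm (integrable_lt y iF)).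
  by move=> u _; case: ifP => // _; rewrite normr0.
have ig : (@lebesgue_measure R).-integrable setT (fun v => (M * `|phi v|)%:E).
  exact: (integrableZl measurableT M (integrable_norm iphi)).
apply: (le_integrable measurableT _ _ ig); first exact: mP.
move=> v _ /=; rewrite lee_fin !normrM normr_id mulrC ler_wpM2r//.
exact: le_trans (PM _) (ler_norm _).
Qed.

(** The primitive of F * phi is phi * (primitive of F). *)
Lemma primitive_lconv (R : realType) (F phi : R -> R) (x : R) :
  (@lebesgue_measure R).-integrable setT (EFin \o F) ->
  (@lebesgue_measure R).-integrable setT (EFin \o phi) ->
  (primitive (lconv F phi) x)%:E =
  (\int[@lebesgue_measure R]_v (phi v * primitive F (x - v))%:E)%E.
Proof.
move=> iF iphi.
have ih := lconv_integrable iF iphi.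
have mW : measurable_fun setT (fun p : R * R => p.1 < x).
  by apply: measurable_fun_ltr.
have H := @integrable_prod_isometry R F phi 1 (fun v => - v) _
  (normr1 _) (@oppr_measurable R setT) mW iF iphi.
have mWx : measurable_fun setT (fun u : R => u < x) by apply: measurable_fun_ltr.
rewrite primitiveE EFin_Rintegral//; last exact: integrable_lt.
have iFH := integrable_fubini_F H.
transitivity (\int[@lebesgue_measure R]_s \int[@lebesgue_measure R]_v
    (if s < x then F (1 * s - v) * phi v else 0)%:E)%E.
  apply: ae_integral_eq => //.
  - by have /integrableP[] := integrable_lt x ih.
  - by have /integrableP[] := iFH.
  apply: ae_imp (lconv_ae_integrable iF iphi) => s is_ _.
  have [sx|xs] := ltP s x; last by rewrite integral0.
  rewrite /lconv EFin_Rintegral//.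
  by apply: eq_integral => v _; rewrite mul1r.
apply: etrans; first exact: (Fubini H).
apply: eq_integral => v _.
apply: etrans; first exact: (@lebesgue_integral_if_isometry R F (fun s => s < x) (phi v) 1 (- v)
  (normr1 _) mWx iF).
rewrite primitiveE; congr ((_ * _)%:E); apply: eq_Rintegral => u _.
by rewrite invr1 mul1r opprK ltrBrDr.
Qed.

(** F * (primitive of phi) and phi * (primitive of F) are the same, both being
    the integral of F (x - u) phi(v) over v < u. *)
Lemma lconv_primitive (R : realType) (F phi : R -> R) (x : R) :
  (@lebesgue_measure R).-integrable setT (EFin \o F) ->
  (@lebesgue_measure R).-integrable setT (EFin \o phi) ->
  (@lebesgue_measure R).-integrable setT
    (fun u => (F (x - u) * primitive phi u)%:E) /\
  (\int[@lebesgue_measure R]_u (F (x - u) * primitive phi u)%:E)%E =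
  (\int[@lebesgue_measure R]_v (phi v * primitive F (x - v))%:E)%E.
Proof.
move=> iF iphi.
have mW : measurable_fun setT (fun p : R * R => p.2 < p.1).
  by apply: measurable_fun_ltr.
have H := @integrable_prod_isometry R F phi (-1) (fun=> x) _
  (normrN1 _) (measurable_cst x) mW iF iphi.
have E : (fun u => (F (x - u) * primitive phi u)%:E) =
    (fun u => \int[@lebesgue_measure R]_v
    (if v < u then F (-1 * u + x) * phi v else 0)%:E)%E.
  apply/funext => u.
  rewrite primitiveE EFinM EFin_Rintegral//; last exact: integrable_lt.
  apply/esym; apply: etrans; last exact: (integralZl measurableT (integrable_lt u iphi)).
  apply: eq_integral => v _; rewrite -EFinM mulN1r addrC.
  by case: ifP => _; rewrite ?mulr0.
rewrite E; split; first exact: (integrable_fubini_F H).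
apply: etrans; first exact: (Fubini H).
apply: eq_integral => v _.
have mWv : measurable_fun setT (fun u : R => v < u) by apply: measurable_fun_ltr.
apply: etrans; first exact: (@lebesgue_integral_if_isometry R F (fun u => v < u) (phi v) (-1) x
  (normrN1 _) mWv iF).
rewrite primitiveE; congr ((_ * _)%:E); apply: eq_Rintegral => u _.
by rewrite invrN1 mulN1r opprB ltrBrDr addrC -ltrBrDr.
Qed.

Lemma integrable_patch (R : realType) (D : set R) (f : R -> R) : measurable D ->
  (@lebesgue_measure R).-integrable D (EFin \o f) <->
  (@lebesgue_measure R).-integrable setT (EFin \o (f \_ D)).
Proof.
move=> mD; rewrite -restrict_EFin.
have H := @integrable_mkcond _ _ R (@lebesgue_measure R) D (EFin \o f) mD.
by split => /H.
Qed.

(** * Convolution of a kernel with an absolutely continuous function *)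

(** The kernel need not be integrable at infinity, and only its values on
    ]0, b[ matter for convolutions on [0, b]. *)
Definition trunc_kernel (R : realType) (K : R -> R) (b : R) (s : R) : R :=
  if s < b then K s else 0.

Lemma integrable_trunc_kernel (R : realType) (k alpha m omega c b : R) :
  0 < k -> 0 < alpha -> 0 < m -> 0 < b ->
  (@lebesgue_measure R).-integrable setT
    (EFin \o trunc_kernel (kPrabhakar_kernel k alpha m omega c) b).
Proof.
move=> k0 a0 m0 b0.
have [C C0 HC] := @kPrabhakar_kernel_bound R k alpha m omega c b k0 a0 m0 b0.
have mk0 : 0 < m / k by rewrite divr_gt0.
pose G (s : R) : R := if s < b then C * tpow (m / k - 1) s else 0.
have mlt : measurable_fun setT (fun s : R => s < b) by apply: measurable_fun_ltr.
have mG : measurable_fun setT G.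
  apply: measurable_fun_ifT => //; apply: measurable_funM => //; exact: measurable_tpow.
have G0 s : 0 <= G s by rewrite /G; case: ifP => // _; rewrite mulr_ge0 ?tpow_ge0.
have iG : (@lebesgue_measure R).-integrable setT (EFin \o G).
  apply/integrableP; split; first exact/measurable_EFinP.
  apply: (@le_lt_trans _ _ (C%:E * \int[@lebesgue_measure R]_(s in `]0%R, b]) (s `^ (m / k - 1))%:E)%E).
    rewrite -ge0_integralZl//; last 2 first.
    - exact: measurable_EFin_powR.
    - by move=> s _; rewrite lee_fin powR_ge0.
    rewrite [leRHS]integral_mkcond; apply: ge0_le_integral => //.
    - by apply: measurableT_comp => //; exact/measurable_EFinP.
    - apply/(measurable_restrictT _ _).1 => //.
      by apply: emeasurable_funM => //; exact: measurable_EFin_powR.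
    move=> s _; rewrite patchE /= /G; have [sb|bs] := ltP s b; last first.
      by rewrite normr0; case: ifP => // _; rewrite lee_fin mulr_ge0 ?powR_ge0.
    have [s0|s0] := leP s 0.
      rewrite /tpow ltNge s0/= mulr0 normr0; case: ifP => // _.
      by rewrite lee_fin mulr_ge0 ?powR_ge0.
    rewrite mem_set/= ?in_itv/= ?s0 ?(ltW sb)// tpowE// ger0_norm.
      by rewrite EFinM lexx.
    by rewrite mulr_ge0 ?powR_ge0.
  by rewrite (ge0_powR_integral mk0 (lexx 0) (ltW b0)) -EFinM ltry.
apply: (le_integrable _ _ _ iG) => //.
  apply/measurable_EFinP; apply: measurable_fun_ifT => //.
  exact: measurable_kPrabhakar_kernel.
move=> s _; rewrite /= lee_fin /trunc_kernel [leRHS]ger0_norm// /G.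
by case: ltP => sb; rewrite ?normr0//; apply: HC; exact: ltW.
Qed.

Lemma trunc_kernel_le0 (R : realType) (k alpha m omega c b s : R) :
  s <= 0 -> trunc_kernel (kPrabhakar_kernel k alpha m omega c) b s = 0.
Proof.
by move=> s0; rewrite /trunc_kernel kPrabhakar_kernel_le0//; case: ifP.
Qed.

(** Both kernels and psi' vanish on the negative half-line, so the integral over
    ]0, x[ extends to the line. *)
Lemma convolution_lconv (R : realType) (k alpha m omega c b x : R)
    (psi psi' : R -> R) : x <= b -> (forall u, u <= 0 -> psi' u = 0) ->
  (forall u, 0 < u < x -> psi u = psi' u) ->
  let K := kPrabhakar_kernel k alpha m omega c in
  convolution K psi x = lconv (trunc_kernel K b) psi' x /\
  ((@lebesgue_measure R).-integrable `]0, x[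
     (EFin \o (fun u => K (x - u) * psi u)) <->
   (@lebesgue_measure R).-integrable setT
     (fun u => (trunc_kernel K b (x - u) * psi' u)%:E)).
Proof.
move=> xb psi0 psiE K.
have E : (fun u => K (x - u) * psi u) \_ `]0, x[ =
    (fun u => trunc_kernel K b (x - u) * psi' u).
  apply/funext => u; rewrite patchE; case: ifPn => [|/negP].
    rewrite inE/= in_itv/= => u0x; rewrite psiE// /trunc_kernel ifT//.
    by apply: lt_le_trans xb; rewrite gtrBl; case/andP: u0x.
  rewrite inE/= in_itv/= => /negP; rewrite negb_and -!leNgt => /orP[u0|xu].
    by rewrite psi0// mulr0.
  by rewrite trunc_kernel_le0 ?mul0r// subr_le0.
split; first by rewrite /convolution /lconv Rintegral_mkcond E.
apply: iff_trans; first exact: (@integrable_patch R `]0, x[ (fun u => K (x - u) * psi u)).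
by rewrite E.
Qed.

Lemma primitive_itv (R : realType) (F : R -> R) (x : R) :
  (forall u, u <= 0 -> F u = 0) -> (@lebesgue_measure R).-integrable setT (EFin \o F) ->
  primitive F x = \int[@lebesgue_measure R]_(u in `]0, x]) F u.
Proof.
move=> F0 iF; rewrite -Rintegral_itv_bndo_bndc; last exact: integrableS iF.
rewrite /primitive Rintegral_mkcond [RHS]Rintegral_mkcond.
apply: eq_Rintegral => u _; rewrite !patchE.
have [u0|u0] := leP u 0; first by rewrite F0//; do 2 case: ifP.
by congr (if _ then _ else _); apply/idP/idP; rewrite !inE/= !in_itv/= u0.
Qed.

Lemma lconv_le0 (R : realType) (F phi : R -> R) (x : R) :
  (forall u, u <= 0 -> F u = 0) -> (forall u, u <= 0 -> phi u = 0) ->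
  x <= 0 -> lconv F phi x = 0.
Proof.
move=> F0 phi0 x0; rewrite /lconv /Rintegral integral0_eq// => u _.
have [u0|u0] := leP u 0; first by rewrite phi0// mulr0.
by rewrite F0 ?mul0r// subr_le0 (le_trans x0)// ltW.
Qed.

Lemma abs_continuous_integrable (R : realType) (a b : R) (f : R -> R) :
  a <= b -> abs_continuous a b f ->
  (@lebesgue_measure R).-integrable `[a, b] (EFin \o f).
Proof.
move=> ab acf.
suff H : (@lebesgue_measure R).-integrable `[a, b] (EFin \o (f \o clamp a b)).
  apply: eq_integrable H => // x; rewrite inE/= in_itv/= => xab.
  by rewrite clamp_id.
apply: continuous_compact_integrable; first exact: segment_compact.
by apply: continuous_subspaceT; exact: clamp_continuous.
Qed.

Lemma abs_continuous_cvg_right (R : realType) (b : R) (f : R -> R) :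
  0 < b -> abs_continuous 0 b f -> f x @[x --> 0^'+] --> f 0.
Proof.
move=> b0 acf; apply/cvgrPdist_lt => e e0.
have [d d0 H] := abs_continuous_unif acf e0.
near=> x; have x0 : 0 < x by near: x; exact: nbhs_right_gt.
rewrite distrC; apply: H; rewrite ?lexx ?(ltW b0) ?(ltW x0)//=.
  by near: x; exact: nbhs_right_le.
by rewrite subr0 gtr0_norm//; near: x; exact: nbhs_right_lt.
Unshelve. all: by end_near. Qed.

Lemma primitive_le0 (R : realType) (F : R -> R) (x : R) :
  (forall u, u <= 0 -> F u = 0) -> x <= 0 -> primitive F x = 0.
Proof.
move=> F0 x0; rewrite primitiveE /Rintegral integral0_eq// => u _.
by case: ifP => // ux; rewrite F0// ltW// (lt_le_trans ux).
Qed.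

Lemma primitiveD (R : realType) (F G : R -> R) (x : R) :
  (@lebesgue_measure R).-integrable setT (EFin \o F) ->
  (@lebesgue_measure R).-integrable setT (EFin \o G) ->
  primitive (fun u => F u + G u) x = primitive F x + primitive G x.
Proof.
move=> iF iG; apply: RintegralD => //.
  exact: (@integrableS _ _ _ _ setT).
exact: (@integrableS _ _ _ _ setT).
Qed.

Lemma primitiveZ (R : realType) (F : R -> R) (r x : R) :
  (@lebesgue_measure R).-integrable setT (EFin \o F) ->
  primitive (fun u => r * F u) x = r * primitive F x.
Proof.
by move=> iF; apply: RintegralZl => //; exact: (@integrableS _ _ _ _ setT).
Qed.

Lemma lebesgue_integrableD (R : realType) (F G : R -> R) :
  (@lebesgue_measure R).-integrable setT (EFin \o F) ->
  (@lebesgue_measure R).-integrable setT (EFin \o G) ->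
  (@lebesgue_measure R).-integrable setT (fun u => (F u + G u)%:E).
Proof. by move=> iF iG; exact: (integrableD measurableT iF iG). Qed.

Lemma lebesgue_integrableZl (R : realType) (D : set R) (F : R -> R) (r : R) : measurable D ->
  (@lebesgue_measure R).-integrable D (EFin \o F) ->
  (@lebesgue_measure R).-integrable D (fun u => (r * F u)%:E).
Proof.
move=> mD iF.
under [X in _.-integrable _ X]eq_fun do rewrite EFinM.
by apply: integrableZl.
Qed.

Definition trunc_derive1 (R : realType) (b : R) (f : R -> R) : R -> R :=
  derive1 f \_ `]0, b[.

Lemma trunc_derive1_le0 (R : realType) (b u : R) (f : R -> R) : u <= 0 ->
  trunc_derive1 b f u = 0.
Proof.
move=> u0; rewrite /trunc_derive1 patchE; case: ifPn => //.
by rewrite inE/= in_itv/= ltNge u0.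
Qed.

Lemma trunc_derive1E (R : realType) (b u : R) (f : R -> R) : 0 < u < b ->
  trunc_derive1 b f u = derive1 f u.
Proof. by move=> u0b; rewrite /trunc_derive1 patchE mem_set//= in_itv. Qed.

Lemma abs_continuous_primitive (R : realType) (b : R) (f : R -> R) :
  0 < b -> abs_continuous 0 b f ->
  let phi := trunc_derive1 b f in
  (@lebesgue_measure R).-integrable setT (EFin \o phi) /\
  forall x, 0 <= x <= b -> f x = f 0 + primitive phi x.
Proof.
move=> b0 /(abs_continuous_derive1 (ltW b0))[_ i' fE] phi; split.
  by apply: (integrable_patch (derive1 f) (measurable_itv `]0, b[)).1.
move=> x /andP[x0 xb]; rewrite fE ?x0//; congr (_ + _).
rewrite primitiveE Rintegral_mkcond; apply: eq_Rintegral => u _; rewrite patchE.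
have [u0|u0] := leP u 0.
  rewrite memNset/= ?in_itv/= ?(ltNge 0) ?u0// /phi trunc_derive1_le0//.
  by case: ifP.
have [ux|xu] := ltP u x.
  by rewrite mem_set/= ?in_itv/= ?u0// /phi trunc_derive1E// u0 (lt_le_trans ux).
by rewrite memNset//= in_itv/= => /andP[_]; rewrite ltNge xu.
Qed.

(** Insert f = f(0) + int f' into the convolution and exchange the
    integrations. *)
Lemma convolution_primitive (R : realType) (k alpha m omega c b : R) (f : R -> R) :
  0 < k -> 0 < alpha -> 0 < m -> 0 < b -> abs_continuous 0 b f ->
  let phi := trunc_derive1 b f in
  let K := kPrabhakar_kernel k alpha m omega c in
  let Kb := trunc_kernel K b in
  forall x, 0 <= x <= b ->
    (convolution K f x)%:E = ((f 0 * primitive Kb x)%:E +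
      \int[@lebesgue_measure R]_v (phi v * primitive Kb (x - v))%:E)%E.
Proof.
move=> k0 a0 m0 b0 acf phi K Kb x /andP[x0 xb].
have [iphi fE] := abs_continuous_primitive b0 acf.
have iKb : (@lebesgue_measure R).-integrable setT (EFin \o Kb).
  exact: integrable_trunc_kernel.
have phi0 u : u <= 0 -> phi u = 0 by exact: trunc_derive1_le0.
pose psi (u : R) : R := (if 0 < u then f 0 else 0) + primitive phi u.
have psi0 u : u <= 0 -> psi u = 0.
  by move=> u0; rewrite /psi ltNge u0/= add0r primitive_le0.
have psiE u : 0 < u < x -> f u = psi u.
  move=> /andP[u0 ux]; rewrite /psi u0 fE// (ltW u0)/=.
  by rewrite ltW// (lt_le_trans ux).
have [-> _] := @convolution_lconv R k alpha m omega c b x f psi xb psi0 psiE.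
have [i2 E2] := lconv_primitive x iKb iphi.
have mW : measurable_fun setT (fun u : R => 0 < u) by apply: measurable_fun_ltr.
have iKx := integrable_isometry x (normrN1 _) iKb.
have i1 : (@lebesgue_measure R).-integrable setT
    (fun u => (if 0 < u then Kb (-1 * u + x) * f 0 else 0)%:E).
  apply: (le_integrable measurableT _ _ (integrableZl measurableT (f 0) iKx)).
    have /integrableP[/measurable_EFinP mKx _] := iKx.
    by apply/measurable_EFinP; apply: measurable_fun_ifT => //; exact: measurable_funM.
  move=> u _ /=; rewrite lee_fin mulrC; case: ifP => _; first exact: lexx.
  by rewrite normr0 normr_ge0.
have E : (fun u => (Kb (x - u) * psi u)%:E) = (fun u =>
    (if 0 < u then Kb (-1 * u + x) * f 0 else 0)%:E +
    (Kb (x - u) * primitive phi u)%:E)%E.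
  apply/funext => u; rewrite -EFinD mulN1r (addrC _ x) /psi mulrDr.
  by case: ifP => _; rewrite ?mulr0.
rewrite /lconv (EFin_Rintegral measurableT); last first.
  by rewrite [X in _.-integrable _ X]E; exact: (integrableD measurableT i1 i2).
rewrite E; apply: etrans; first exact: (integralD measurableT i1 i2).
congr (_ + _)%E; last exact: E2.
apply: etrans; first exact: (@lebesgue_integral_if_isometry R Kb (fun u => 0 < u) (f 0) (-1) x
  (normrN1 _) mW iKb).
rewrite primitiveE; congr ((_ * _)%:E); apply: eq_Rintegral => u _.
by rewrite invrN1 mulN1r opprB subr_gt0.
Qed.

(** The function K * f' + f(0) K, almost everywhere the derivative of K * f on
    ]0, b[. *)
Definition convolution_density (R : realType) (K f : R -> R) (b s : R) : R :=
  lconv (trunc_kernel K b) (trunc_derive1 b f) s + f 0 * trunc_kernel K b s.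

Lemma convolution_densityP (R : realType) (k alpha m omega c b : R) (f : R -> R) :
  0 < k -> 0 < alpha -> 0 < m -> 0 < b -> abs_continuous 0 b f ->
  let K := kPrabhakar_kernel k alpha m omega c in
  let H := convolution_density K f b in
  (@lebesgue_measure R).-integrable setT (EFin \o H) /\
  forall x, 0 <= x <= b -> convolution K f x = convolution K f 0 +
    \int[@lebesgue_measure R]_(u in `]0, x]) H u.
Proof.
move=> k0 a0 m0 b0 acf K H.
have [iphi fE] := abs_continuous_primitive b0 acf.
have iKb : (@lebesgue_measure R).-integrable setT (EFin \o trunc_kernel K b).
  exact: integrable_trunc_kernel.
have iL := lconv_integrable iKb iphi.
have iZ := lebesgue_integrableZl (f 0) measurableT iKb.
have iH := lebesgue_integrableD iL iZ.
split; first exact: iH.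
have gE x : 0 <= x <= b -> convolution K f x = primitive H x.
  move=> x0b; apply: EFin_inj.
  rewrite (convolution_primitive omega c k0 a0 m0 b0 acf x0b).
  rewrite (primitiveD x iL iZ) (primitiveZ (f 0) x iKb) [in RHS]EFinD.
  by rewrite (primitive_lconv x iKb iphi) addeC.
have H0 u : u <= 0 -> H u = 0.
  move=> u0; rewrite /H /convolution_density trunc_kernel_le0// mulr0 addr0.
  apply: lconv_le0 => // v v0; first exact: trunc_kernel_le0.
  exact: trunc_derive1_le0.
move=> x x0b; rewrite (gE x x0b) (gE 0) ?lexx ?(ltW b0)//.
rewrite (@primitive_le0 _ H 0)// add0r.
exact: primitive_itv.
Qed.

Lemma primitive_subr (R : realType) (F : R -> R) (r s : R) : r <= s ->
  (@lebesgue_measure R).-integrable setT (EFin \o F) ->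
  primitive F s - primitive F r = \int[@lebesgue_measure R]_(u in `]r, s]) F u.
Proof.
move=> rs iF.
have iD (D : set R) : measurable D -> (@lebesgue_measure R).-integrable D (EFin \o F).
  by move=> mD; exact: integrableS iF.
rewrite /primitive !Rintegral_itv_bndo_bndc; [|exact: iD|exact: iD].
by rewrite (@Rintegral_itvB R F _ (BRight s) r) ?bnd_simp//; exact: iD.
Qed.

(** On ]r, s] with r = max(0, s - h) the integral of u^(a-1) is
    (s^a - r^a) / a, and s^a - r^a <= s^(a-1) (s - r) because q <= q^a for
    0 <= q <= 1 and a <= 1.  Left increments keep the singular factor at s,
    which is what the domination in [convolution_derivative] needs; a right
    increment may be nonzero at some s <= 0, where the bound vanishes. *)
Lemma primitive_singular_lip (R : realType) (F : R -> R) (a C s h : R) :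
  (@lebesgue_measure R).-integrable setT (EFin \o F) ->
  0 < a <= 1 -> 0 <= C -> (forall u, `|F u| <= C * tpow (a - 1) u) -> 0 < h ->
  `|primitive F s - primitive F (s - h)| <= h * (C / a * tpow (a - 1) s).
Proof.
move=> iF /andP[a0 a1] C0 HF h0.
have F0 u : u <= 0 -> F u = 0.
  move=> u0; apply/eqP; rewrite -normr_le0 (le_trans (HF u))// /tpow.
  by rewrite ltNge u0/= mulr0.
have [s0|s0] := leP s 0.
  rewrite !primitive_le0 ?subr0 ?normr0//; last by rewrite (le_trans _ s0)// gerBl ltW.
  by rewrite !mulr_ge0 ?tpow_ge0 ?invr_ge0// ltW.
pose r := Num.max 0 (s - h).
have r0 : 0 <= r by rewrite le_max lexx.
have rs : r <= s by rewrite ge_max (ltW s0)/= gerBl ltW.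
have -> : primitive F (s - h) = primitive F r.
  rewrite /r; case: leP => // sh0.
  by rewrite (primitive_le0 F0 (ltW sh0)) (primitive_le0 F0 (lexx 0)).
rewrite primitive_subr//.
have iFrs : (@lebesgue_measure R).-integrable `]r, s] (EFin \o F).
  exact: integrableS iF.
apply: (@le_trans _ _ (C / a * (s `^ a - r `^ a))).
  rewrite -lee_fin; apply: (@le_trans _ _ (\int[@lebesgue_measure R]_(u in `]r, s])
      (C%:E * (u `^ (a - 1))%:E))%E).
    have -> : (`|\int[@lebesgue_measure R]_(u in `]r, s]) F u|%:E =
        `|\int[@lebesgue_measure R]_(u in `]r, s]) (F u)%:E|)%E.
      by rewrite -EFin_Rintegral.
    apply: le_trans; first by apply: le_abse_integral => //; case/integrableP: iFrs.
    apply: ge0_le_integral => //.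
    - by apply: measurableT_comp => //; case/integrableP: iFrs.
    - by apply: emeasurable_funM => //; exact: measurable_EFin_powR.
    - move=> u; rewrite /= in_itv/= => /andP[ru _].
      by rewrite lee_fin (le_trans (HF u))// tpowE// (le_lt_trans r0).
  rewrite ge0_integralZl//; last 2 first.
  - exact: measurable_EFin_powR.
  - by move=> u _; rewrite lee_fin powR_ge0.
  by rewrite (ge0_powR_integral a0 r0 rs) -EFinM lee_fin mulrA mulrAC.
rewrite mulrCA ler_wpM2l ?divr_ge0 ?(ltW a0)// tpowE//.
have -> : s `^ a = s * s `^ (a - 1).
  by rewrite -{2}(powRr1 (ltW s0)) -powRD ?gt_eqF ?implybT// addrC subrK.
have -> : r `^ a = (r / s) `^ a * (s * s `^ (a - 1)).
  have -> : s * s `^ (a - 1) = s `^ a.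
    by rewrite -{1}(powRr1 (ltW s0)) -powRD ?gt_eqF ?implybT// addrC subrK.
  by rewrite -powRM ?divr_ge0 ?(ltW s0)// divfK ?gt_eqF.
have q_le : r / s <= (r / s) `^ a.
  have [->|/eqP rn0] := eqVneq r 0; first by rewrite mul0r powR_ge0.
  have rp : 0 < r by rewrite lt0r r0 andbT; exact/eqP.
  by apply: ger1_powR => //; rewrite divr_gt0//= ler_pdivrMr// mul1r.
apply: (@le_trans _ _ (s * s `^ (a - 1) - r / s * (s * s `^ (a - 1)))).
  by rewrite lerB// ler_wpM2r// mulr_ge0 ?powR_ge0// ltW.
rewrite mulrA divfK ?gt_eqF// -mulrBl ler_wpM2r ?powR_ge0//.
by rewrite lerBlDl -lerBlDr le_max lexx orbT.
Qed.

Lemma primitive_derive1 (R : realType) (F : R -> R) (x : R) :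
  (@lebesgue_measure R).-integrable setT (EFin \o F) -> {for x, continuous F} ->
  derivable (primitive F) x 1 /\ derive1 (primitive F) x = F x.
Proof.
move=> iF cF.
have E : primitive F = (fun y => \int[@lebesgue_measure R]_(u in `]-oo, y]) F u).
  by apply/funext => y; rewrite /primitive Rintegral_itv_bndo_bndc//; exact: integrableS iF.
rewrite E; apply: (@continuous_FTC1 R F -oo%O x (x + 1)).
- by rewrite ltrDl.
- exact: integrableS iF.
- by rewrite ltNyr.
- exact: cF.
Qed.

Lemma derivable_left_quotient_cvg (R : realType) (F : R -> R) (x : R) (h : nat -> R) :
  derivable F x 1 -> (forall n, 0 < h n) -> h n @[n --> \oo] --> (0 : R) ->
  (F x - F (x - h n)) / h n @[n --> \oo] --> derive1 F x.
Proof.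
move=> dF h0 hcvg.
have H : h^-1 * (F (h + x) - F x) @[h --> 0^'] --> derive1 F x.
  rewrite derive1E; have := dF; rewrite /derivable /derive => dF'.
  by under [X in X @ _ --> _]eq_fun do rewrite -[X in F (X + _)]mulr1.
have := (cvgr_dnbhsP _ _ _).1 H (fun n => - h n) _.
under [X in _ -> X @ _ --> _]eq_fun do
  rewrite invrN mulNr -mulrN opprB mulrC (addrC (- h _)).
apply; split; first by move=> n; rewrite oppr_eq0 gt_eqF.
by rewrite -oppr0; exact: cvgN.
Qed.

(** Left difference quotients of K * f at t are
    f(0) Q(t) + int f'(v) Q(t - v) dv, with Q a left difference quotient of the
    primitive of K.  By [primitive_singular_lip] the integrand is dominated by
    |f'(v)| (t - v)^(m/k - 1), up to a constant; close to v = t this is at most a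
    multiple of |K (t - v) f'(v)| by [kPrabhakar_kernel_lower], integrable by
    hypothesis, and elsewhere a multiple of |f'(v)|. *)
Lemma convolution_derivative (R : realType) (k alpha m omega c b t : R) (f : R -> R) :
  0 < k -> 0 < alpha -> 0 < m <= k -> 0 < b -> abs_continuous 0 b f -> 0 < t < b ->
  let K := kPrabhakar_kernel k alpha m omega c in
  derivable (convolution K f) t 1 ->
  (@lebesgue_measure R).-integrable `]0, t[
    (EFin \o (fun u => K (t - u) * derive1 f u)) ->
  derive1 (convolution K f) t = convolution K (derive1 f) t + f 0 * K t.
Proof.
move=> k0 a0 /andP[m0 mk] b0 acf /andP[t0 tb] K dg iK.
have [iphi fE] := abs_continuous_primitive b0 acf.
set phi := trunc_derive1 b f in iphi.
pose Kb := trunc_kernel K b.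
have iKb : (@lebesgue_measure R).-integrable setT (EFin \o Kb).
  exact: integrable_trunc_kernel.
have phi0 u : u <= 0 -> phi u = 0 by exact: trunc_derive1_le0.
have phiE u : 0 < u < t -> derive1 f u = phi u.
  by move=> /andP[u0 ut]; rewrite /phi trunc_derive1E// u0 (lt_trans ut).
have [-> E] := @convolution_lconv R k alpha m omega c b t _ _ (ltW tb) phi0 phiE.
have {iK}/E iKphi := iK.
(* the steps are at most t, so that t - h n stays in [0, b] *)
pose h (n : nat) : R := t / n.+1%:R.
have h0 n : 0 < h n by rewrite divr_gt0.
have ht n : h n <= t by rewrite ler_pdivrMr// ler_peMr ?(ltW t0)// ler1n.
have hcvg : h n @[n --> \oo] --> (0 : R).
  by rewrite -(mulr0 t); apply: cvgM; [exact: cvg_cst|exact: cvg_harmonic].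
have HK (u : R) : 0 < u < b -> derivable (primitive Kb) u 1 /\
    derive1 (primitive Kb) u = K u.
  move=> /andP[u0 ub]; have cK := @kPrabhakar_kernel_continuous R k alpha m omega c u k0 a0 m0 u0.
  have nE : \forall y \near u, K y = Kb y.
    near=> y; rewrite /Kb /trunc_kernel ifT//; near: y; exact: lt_nbhsl.
  have KbE : Kb u = K u by rewrite (nbhs_singleton nE).
  rewrite -KbE; apply: primitive_derive1 => //.
  have -> : {for u, continuous Kb} = (Kb x @[x --> u] --> K u).
    by rewrite -KbE.
  apply: cvg_trans cK; exact: near_eq_cvg.
have Pq n (v : R) : v <= 0 \/ t <= v ->
    phi v * ((primitive Kb (t - v) - primitive Kb (t - v - h n)) / h n) = 0.
  move=> [v0|tv]; first by rewrite phi0// mul0r.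
  have Kb0 u : u <= 0 -> Kb u = 0 by exact: trunc_kernel_le0.
  rewrite !(primitive_le0 Kb0) ?subr0 ?mul0r ?mulr0// ?subr_le0//.
  by rewrite (le_trans _ (ltW (h0 n)))// subr_le0.
have gE x : 0 <= x <= b -> convolution K f x = f 0 * primitive Kb x +
    \int[@lebesgue_measure R]_v (phi v * primitive Kb (x - v)).
  move=> xb; apply: EFin_inj; rewrite (convolution_primitive _ _ k0 a0 m0 b0 acf xb).
  by rewrite EFinD (EFin_Rintegral measurableT)//; exact: integrable_mul_primitive.
have iP x := integrable_mul_primitive x iKb iphi.
pose Q n (v : R) : R :=
  phi v * ((primitive Kb (t - v) - primitive Kb (t - v - h n)) / h n).
have QE n : Q n = (fun v => (h n)^-1 * (phi v * primitive Kb (t - v) -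
    phi v * primitive Kb (t - h n - v))).
  by apply/funext => v; rewrite /Q (addrAC t) -mulrBr mulrA mulrC.
have iQ n : (@lebesgue_measure R).-integrable setT (EFin \o Q n).
  rewrite QE; apply: (@lebesgue_integrableZl R setT (fun v => phi v * primitive Kb (t - v) -
    phi v * primitive Kb (t - h n - v)) _ measurableT).
  exact: (integrableB measurableT (iP t) (iP (t - h n))).
have qE n : (convolution K f t - convolution K f (t - h n)) / h n =
    f 0 * ((primitive Kb t - primitive Kb (t - h n)) / h n) +
    \int[@lebesgue_measure R]_v Q n v.
  rewrite gE ?(ltW t0) ?(ltW tb)// gE; last first.
    by rewrite subr_ge0 ht/= lerBlDr (le_trans (ltW tb))// lerDl ltW.
  rewrite QE RintegralZl//; last exact: (integrableB measurableT (iP t) (iP (t - h n))).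
  rewrite RintegralB; [|exact: measurableT|exact: iP|exact: iP].
  have aux (r p q X Y l : R) : (r * p + X - (r * q + Y)) / l =
      r * ((p - q) / l) + l^-1 * (X - Y) by ring.
  exact: aux.
have [C C0 HC] := @kPrabhakar_kernel_bound R k alpha m omega c b k0 a0 m0 b0.
have [e [d [e0 d0 Hed]]] := @kPrabhakar_kernel_lower R k alpha m omega c k0 a0 m0.
pose a := m / k.
have a01 : 0 < a <= 1 by rewrite divr_gt0//= ler_pdivrMr// mul1r.
have [ap a1] := andP a01.
have Ca0 : 0 <= C / a := divr_ge0 C0 (ltW ap).
have HKb u : `|Kb u| <= C * tpow (a - 1) u.
  rewrite /Kb /trunc_kernel; case: ltP => ub; first exact: HC (ltW ub).
  by rewrite normr0 mulr_ge0 ?tpow_ge0.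
pose G v := C / a * (e^-1 * `|Kb (t - v) * phi v| + d `^ (a - 1) * `|phi v|).
have iG : (@lebesgue_measure R).-integrable setT (EFin \o G).
  apply: (lebesgue_integrableZl _ measurableT); apply: lebesgue_integrableD.
    by apply: (lebesgue_integrableZl _ measurableT); exact: (integrable_norm iKphi).
  by apply: (lebesgue_integrableZl _ measurableT); exact: (integrable_norm iphi).
have QG n v : `|Q n v| <= G v.
  have G0 : 0 <= G v.
    apply: mulr_ge0; first exact: Ca0.
    by apply: addr_ge0; apply: mulr_ge0; rewrite ?powR_ge0// invr_ge0 ltW.
  have [v0|v0] := leP v 0; first by rewrite /Q Pq ?normr0//; left.
  have lip := @primitive_singular_lip R Kb a C (t - v) (h n) iKb a01 C0 HKb (h0 n).
  apply: (@le_trans _ _ (`|phi v| * (C / a * tpow (a - 1) (t - v)))).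
    rewrite /Q normrM ler_wpM2l// normrM normfV (gtr0_norm (h0 n)).
    by rewrite ler_pdivrMr// mulrC.
  rewrite mulrCA; apply: ler_wpM2l; first exact: Ca0.
  have [tvd|dtv] := ltP (t - v) d.
    apply: ler_wpDr; first by rewrite mulr_ge0 ?powR_ge0.
    rewrite normrM mulrA mulrC ler_wpM2r// mulrC ler_pdivlMr// mulrC.
    apply: le_trans (Hed _ tvd) _; rewrite /Kb /trunc_kernel ifT; first exact: ler_norm.
    by rewrite (lt_trans _ tb)// gtrBl.
  apply: ler_wpDl; first by rewrite mulr_ge0 ?invr_ge0// ltW.
  rewrite mulrC ler_wpM2r// tpowE ?(lt_le_trans d0)//.
  rewrite -(opprB 1 a) !powRN lef_pV2 ?posrE ?powR_gt0 ?(lt_le_trans d0)//.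
  by rewrite ge0_ler_powR ?subr_ge0 ?nnegrE ?(ltW d0) ?(le_trans (ltW d0)).
have Qcvg v : Q n v @[n --> \oo] --> Kb (t - v) * phi v.
  have [v0|v0] := leP v 0.
    rewrite [X in X @ _ --> _](_ : _ = fun=> Kb (t - v) * phi v); first exact: cvg_cst.
    by apply/funext => n; rewrite /Q Pq ?phi0 ?mulr0//; left.
  have [tv|vt] := leP t v.
    rewrite [X in X @ _ --> _](_ : _ = fun=> Kb (t - v) * phi v); first exact: cvg_cst.
    by apply/funext => n; rewrite /Q Pq ?[Kb _]trunc_kernel_le0 ?subr_le0 ?mul0r//; right.
  have tvb : 0 < t - v < b by rewrite subr_gt0 vt (lt_trans _ tb)// gtrBl.
  have [dP PE] := HK _ tvb.
  have KbE : Kb (t - v) = K (t - v) by rewrite /Kb /trunc_kernel; case/andP: tvb => _ ->.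
  rewrite mulrC KbE -PE; apply: cvgM; first exact: cvg_cst.
  exact: derivable_left_quotient_cvg.
have cvQ : (\int[@lebesgue_measure R]_v Q n v) @[n --> \oo] --> lconv Kb phi t.
  apply: fine_cvg; rewrite fineK; last exact: integrable_fin_num.
  apply: (@lebesgue_dominated_convergence R setT (fun n => EFin \o Q n) _ (EFin \o G) measurableT _ _ iG _).2.
  - by move=> n; case/integrableP: (iQ n).
  - by move=> v _; apply: cvg_EFin => //; [exact: nearW|exact: Qcvg].
  - by move=> n v _; rewrite lee_fin.
have [dP PE] := HK t (introT andP (conj t0 tb)).
have cvP := derivable_left_quotient_cvg dP h0 hcvg.
have cvg2 : (convolution K f t - convolution K f (t - h n)) / h n @[n --> \oo] -->
    f 0 * K t + lconv Kb phi t.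
  under [X in X @ _ --> _]eq_fun do rewrite qE.
  by apply: cvgD cvQ; apply: cvgM; [exact: cvg_cst|rewrite -PE].
rewrite [RHS]addrC.
exact: (cvg_unique _ (derivable_left_quotient_cvg dg h0 hcvg) cvg2).
Unshelve. all: by end_near. Qed.

(** * Hilfer-Prabhakar derivatives *)

Lemma convolution_abs_continuous (R : realType) (k alpha m omega c b : R) (f : R -> R) :
  0 < k -> 0 < alpha -> 0 < m -> 0 < b -> abs_continuous 0 b f ->
  let K := kPrabhakar_kernel k alpha m omega c in
  abs_continuous 0 b (convolution K f) /\
  {ae @lebesgue_measure R, forall t, 0 < t < b ->
    derivable (convolution K f) t 1 /\
    derive1 (convolution K f) t = convolution_density K f b t}.
Proof.
move=> k0 a0 m0 b0 acf K.
have [iH HE] := convolution_densityP omega c k0 a0 m0 b0 acf.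
split; first exact: abs_continuous_integral iH HE.
exact: abs_continuous_derivable iH HE.
Qed.

Lemma convolution_derive1_defined (R : realType) (k alpha m omega c b : R) (f : R -> R) :
  0 < k -> 0 < alpha -> 0 < m -> 0 < b -> abs_continuous 0 b f ->
  let K := kPrabhakar_kernel k alpha m omega c in
  {ae @lebesgue_measure R, forall t, 0 < t < b ->
    {ae @lebesgue_measure R, forall u, 0 < u < t -> derivable f u 1} /\
    (@lebesgue_measure R).-integrable `]0, t[
      (EFin \o (fun u => K (t - u) * derive1 f u))}.
Proof.
move=> k0 a0 m0 b0 acf K.
have [df _ _] := abs_continuous_derive1 (ltW b0) acf.
have [iphi _] := abs_continuous_primitive b0 acf.
have iKb : (@lebesgue_measure R).-integrable setT (EFin \o trunc_kernel K b).
  exact: integrable_trunc_kernel.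
apply: ae_imp (lconv_ae_integrable iKb iphi) => t it /andP[t0 tb]; split.
  by apply: ae_imp df => u du /andP[u0 ut]; apply: du; rewrite u0 (lt_trans ut).
apply: (@convolution_lconv R k alpha m omega c b t (derive1 f) (trunc_derive1 b f)
  (ltW tb) _ _).2.2; last exact: it.
- by move=> u; exact: trunc_derive1_le0.
- by move=> u /andP[u0 ut]; rewrite trunc_derive1E// u0 (lt_trans ut).
Qed.

Lemma convolution_derive1E (R : realType) (k alpha m omega c b u : R) (f : R -> R) :
  0 < u < b ->
  let K := kPrabhakar_kernel k alpha m omega c in
  convolution K (derive1 f) u = lconv (trunc_kernel K b) (trunc_derive1 b f) u.
Proof.
move=> /andP[u0 ub] K.
apply: (@convolution_lconv R k alpha m omega c b u (derive1 f) (trunc_derive1 b f)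
  (ltW ub) _ _).1.
- by move=> v; exact: trunc_derive1_le0.
- by move=> v /andP[v0 vu]; rewrite trunc_derive1E// v0 (lt_trans vu).
Qed.

Lemma convolution2_defined (R : realType) (k alpha m1 m2 omega c1 c2 b : R) (f : R -> R) :
  0 < k -> 0 < alpha -> 0 < m1 -> 0 < m2 -> 0 < b -> abs_continuous 0 b f ->
  let K1 := kPrabhakar_kernel k alpha m1 omega c1 in
  let K2 := kPrabhakar_kernel k alpha m2 omega c2 in
  {ae @lebesgue_measure R, forall t, 0 < t < b ->
    (@lebesgue_measure R).-integrable `]0, t[
      (EFin \o (fun u => K2 (t - u) * convolution K1 (derive1 f) u))}.
Proof.
move=> k0 a0 m10 m20 b0 acf K1 K2.
have [iphi _] := abs_continuous_primitive b0 acf.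
have iK1 : (@lebesgue_measure R).-integrable setT (EFin \o trunc_kernel K1 b).
  exact: integrable_trunc_kernel.
have iK2 : (@lebesgue_measure R).-integrable setT (EFin \o trunc_kernel K2 b).
  exact: integrable_trunc_kernel.
have iL := lconv_integrable iK1 iphi.
apply: ae_imp (lconv_ae_integrable iK2 iL) => t it /andP[t0 tb].
apply: (@convolution_lconv R k alpha m2 omega c2 b t _ _ (ltW tb) _ _).2.2; last exact: it.
- move=> u u0; apply: lconv_le0 => // v v0; first exact: trunc_kernel_le0.
  exact: trunc_derive1_le0.
- by move=> u /andP[u0 ut]; rewrite (@convolution_derive1E R k alpha m1 omega c1 b)// u0 (lt_trans ut).
Qed.

Lemma Rintegral_ae_linear (R : realType) (D : set R) (F G H : R -> R) (r : R) :
  measurable D -> (@lebesgue_measure R).-integrable D (EFin \o F) ->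
  (@lebesgue_measure R).-integrable D (EFin \o G) ->
  (@lebesgue_measure R).-integrable D (EFin \o H) ->
  {ae @lebesgue_measure R, forall u, D u -> F u = G u + r * H u} ->
  \int[@lebesgue_measure R]_(u in D) F u =
  \int[@lebesgue_measure R]_(u in D) G u + r * \int[@lebesgue_measure R]_(u in D) H u.
Proof.
move=> mD iF iG iH FE.
have iZ : (@lebesgue_measure R).-integrable D (fun u => (r * H u)%:E).
  under [X in _.-integrable _ X]eq_fun do rewrite EFinM.
  by apply: integrableZl.
have -> : r * \int[@lebesgue_measure R]_(u in D) H u =
    \int[@lebesgue_measure R]_(u in D) (r * H u) by apply/esym; apply: RintegralZl.
have -> : \int[@lebesgue_measure R]_(u in D) G u +
    \int[@lebesgue_measure R]_(u in D) (r * H u) =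
    \int[@lebesgue_measure R]_(u in D) (G u + r * H u) by apply/esym; apply: RintegralD.
congr fine; apply: ae_integral_eq => //; first by case/integrableP: iF.
- under [X in measurable_fun _ X]eq_fun do rewrite EFinD.
  by apply: emeasurable_funD; [case/integrableP: iG|case/integrableP: iZ].
- by apply: ae_imp FE => u uE Du; rewrite uE.
Qed.

(** Convolve K1 * f' + f(0) K1, which is almost everywhere the derivative of
    K1 * f, with K2 and apply the semigroup law. *)
Lemma convolution_derive1_convolution (R : realType) (k alpha m1 m2 omega c1 c2 b t : R) (f : R -> R) :
  0 < k -> 0 < alpha -> 0 < m1 -> 0 < m2 -> 0 < b -> abs_continuous 0 b f ->
  0 < t < b ->
  let K1 := kPrabhakar_kernel k alpha m1 omega c1 in
  let K2 := kPrabhakar_kernel k alpha m2 omega c2 in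
  (@lebesgue_measure R).-integrable `]0, t[
    (EFin \o (fun u => K2 (t - u) * derive1 (convolution K1 f) u)) ->
  (@lebesgue_measure R).-integrable `]0, t[
    (EFin \o (fun u => K2 (t - u) * convolution K1 (derive1 f) u)) ->
  convolution K2 (derive1 (convolution K1 f)) t =
  convolution K2 (convolution K1 (derive1 f)) t +
  f 0 * kPrabhakar_kernel k alpha (m2 + m1) omega (c2 + c1) t.
Proof.
move=> k0 a0 m10 m20 b0 acf /andP[t0 tb] K1 K2 ig ih.
have mt : measurable (`]0, t[%classic : set R) by exact: measurable_itv.
have [_ dg] := convolution_abs_continuous omega c1 k0 a0 m10 b0 acf.
have [iKK KKE] := @kPrabhakar_kernel_conv R k alpha omega m2 c2 m1 c1 t k0 a0 m20 m10 t0.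
have iKKt : (@lebesgue_measure R).-integrable `]0, t[ (fun u => (K2 (t - u) * K1 u)%:E).
  exact: integrableS iKK.
have <- : \int[@lebesgue_measure R]_(u in `]0%R, t[) (K2 (t - u) * K1 u) =
    kPrabhakar_kernel k alpha (m2 + m1) omega (c2 + c1) t.
  apply: EFin_inj; rewrite (EFin_Rintegral mt iKKt).
  rewrite -KKE integral_mkcond; apply: eq_integral => u _; rewrite patchE.
  case: ifPn => //; rewrite notin_setE/= in_itv/= => /negP.
  rewrite negb_and -!leNgt => /orP[u0|tu].
    by rewrite [X in _ * X]kPrabhakar_kernel_le0// mulr0.
  by rewrite [X in X * _]kPrabhakar_kernel_le0 ?subr_le0// mul0r.
apply: (Rintegral_ae_linear mt ig ih iKKt).
apply: ae_imp dg => u du; rewrite /= in_itv/= => /andP[u0 ut].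
  have u0b : 0 < u < b by rewrite u0 (lt_trans ut).
  rewrite (du u0b).2 /convolution_density -convolution_derive1E//.
  rewrite /trunc_kernel; case/andP: u0b => _ ->.
  by rewrite mulrDr (mulrCA (f 0)).
Qed.

Lemma kPrabhakar_id (R : realType) (k alpha m omega c : R) :
  m = 0 -> c = 0 -> kPrabhakar k alpha m omega c = id.
Proof.
move=> -> ->; apply/funext => f; apply/funext => x.
by rewrite /kPrabhakar !eqxx.
Qed.

Lemma kPrabhakar_convolution (R : realType) (k alpha m omega c : R) : 0 < m ->
  kPrabhakar k alpha m omega c = convolution (kPrabhakar_kernel k alpha m omega c).
Proof.
move=> m0; apply/funext => f; apply/funext => x.
by rewrite /kPrabhakar (gt_eqF m0).
Qed.

Lemma kPrabhakar_defined_id (R : realType) (k alpha m omega c : R) (A : set R)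
    (f : R -> R) (x : R) :
  m = 0 -> c = 0 -> kPrabhakar_defined k alpha m omega c A f x = A x.
Proof. by move=> -> ->; rewrite /kPrabhakar_defined !eqxx. Qed.

Lemma kPrabhakar_defined_convolution (R : realType) (k alpha m omega c : R)
    (A : set R) (f : R -> R) (x : R) : 0 < m ->
  kPrabhakar_defined k alpha m omega c A f x =
  ({ae @lebesgue_measure R, forall u, 0 < u < x -> A u} /\
  (@lebesgue_measure R).-integrable `]0, x[
    (EFin \o (fun u => kPrabhakar_kernel k alpha m omega c (x - u) * f u))).
Proof. by move=> m0; rewrite /kPrabhakar_defined (gt_eqF m0). Qed.

Lemma kPrabhakar_kernelE (R : realType) (k alpha mu omega c t : R) :
  0 < k -> 0 < t ->
  k * kPrabhakar_kernel k alpha (k - mu) omega c t =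
  t `^ (- (mu / k)) * kMittagLeffler k alpha (k - mu) c (omega * t `^ (alpha / k)).
Proof.
move=> k0 t0; rewrite /kPrabhakar_kernel t0.
rewrite mulrBl divff ?gt_eqF// addrAC subrr add0r.
by rewrite mulrA mulrCA divff ?gt_eqF// mulr1.
Qed.

Unset Implicit Arguments.
Set Strict Implicit.
Set Printing Implicit Defensive.

Theorem mainTheorem6 (R : realType) (k alpha gamma omega mu nu b : R)
    (f : R -> R)
    (hk : 0 < k) (halpha : 0 < alpha) (hmu : 0 < mu < 1) (hnu : 0 <= nu <= 1)
    (hb : 0 < b)
    (hf : abs_continuous 0 b f)
    (hmuk : mu < k)
    (hnu1 : nu = 1 -> f 0 = 0) :
  [/\ kHilferPrabhakar_class k alpha omega gamma mu nu b f,
      {ae @lebesgue_measure R, forall t, 0 < t < b ->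
        kHilferPrabhakar_defined k alpha omega gamma mu nu f t /\
        kHilferPrabhakarReg_defined k alpha omega gamma mu nu f t} &
      forall t : R, 0 < t < b ->
        kHilferPrabhakar_defined k alpha omega gamma mu nu f t ->
        kHilferPrabhakarReg_defined k alpha omega gamma mu nu f t ->
        kHilferPrabhakarReg k alpha omega gamma mu nu f t =
        kHilferPrabhakar k alpha omega gamma mu nu f t
        - t `^ (- (mu / k))
          * kMittagLeffler k alpha (k - mu) (- gamma)
              (omega * t `^ (alpha / k))
          * lim (f x @[x --> 0^'+])].
Proof.
have -> : lim (f x @[x --> 0^'+]) = f 0.
  by apply: cvg_lim => //; exact: abs_continuous_cvg_right hf.
have imf := abs_continuous_integrable (ltW hb) hf.
have km0 : 0 < k - mu by rewrite subr_gt0.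
have mE : nu * (k - mu) + (1 - nu) * (k - mu) = k - mu by ring.
have cE : - (gamma * nu) + - (gamma * (1 - nu)) = - gamma by ring.
have aux (C r K E : R) : k * K = E -> k * C = k * (C + r * K) - E * r.
  by move=> <-; ring.
rewrite /kHilferPrabhakar_class /kHilferPrabhakar_defined
  /kHilferPrabhakarReg_defined /kHilferPrabhakar /kHilferPrabhakarReg.
have [nu1|nu_neq1] := eqVneq nu 1.
  have m1E : (1 - nu) * (k - mu) = 0 by rewrite nu1 subrr mul0r.
  have c1E : - (gamma * (1 - nu)) = 0 by rewrite nu1 subrr mulr0 oppr0.
  have m2 : 0 < nu * (k - mu) by rewrite nu1 mul1r.
  rewrite (kPrabhakar_id _ _ _ m1E c1E) /=.
  split => //; last by move=> t _ _ _; rewrite hnu1// mulr0 subr0.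
  have A := convolution_derive1_defined omega (- (gamma * nu)) hk halpha m2 hb hf.
  apply: ae_imp A => t At t0b; have [dA iA] := At t0b.
  rewrite !kPrabhakar_defined_convolution//; split; split => //.
  by apply: ae_imp dA => u du u0t; rewrite (kPrabhakar_defined_id _ _ _ _ _ _ m1E c1E); exact: du.
have m1 : 0 < (1 - nu) * (k - mu).
  by rewrite mulr_gt0// subr_gt0 lt_neqAle nu_neq1; case/andP: hnu.
rewrite (kPrabhakar_convolution _ _ _ _ m1).
set c1 := - (gamma * (1 - nu)); set K1 := kPrabhakar_kernel _ _ _ _ c1.
set g := convolution K1 f.
have [acg dg] := convolution_abs_continuous omega c1 hk halpha m1 hb hf.
have A := convolution_derive1_defined omega c1 hk halpha m1 hb hf.
have [nu0|nu_neq0] := eqVneq nu 0.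
  have m2E : nu * (k - mu) = 0 by rewrite nu0 mul0r.
  have c2E : - (gamma * nu) = 0 by rewrite nu0 mulr0 oppr0.
  rewrite (kPrabhakar_id _ _ _ m2E c2E) /=; split => //.
    apply: ae_imp (ae_and dg A) => t [{}dg {}A] t0b.
    rewrite !(kPrabhakar_defined_id _ _ _ _ _ _ m2E c2E) kPrabhakar_defined_convolution//.
    by split; [exact: (dg t0b).1|exact: A t0b].
  move=> t t0b; rewrite !(kPrabhakar_defined_id _ _ _ _ _ _ m2E c2E) kPrabhakar_defined_convolution//.
  move=> /= dgt [_ iK]; have t0 : 0 < t by case/andP: t0b.
  have m1k : 0 < (1 - nu) * (k - mu) <= k.
    rewrite m1 nu0 subr0 mul1r gerBl; case/andP: hmu => mu0 _; exact: ltW.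
  rewrite /g (convolution_derivative hk halpha m1k hb hf t0b dgt iK).
  rewrite /K1 /c1 nu0 subr0 mul1r mulr1.
  exact: aux (kPrabhakar_kernelE alpha mu omega (- gamma) hk t0).
have m2 : 0 < nu * (k - mu).
  by rewrite mulr_gt0// lt_neqAle eq_sym nu_neq0; case/andP: hnu.
rewrite (kPrabhakar_convolution _ _ _ _ m2).
set c2 := - (gamma * nu).
split => //.
  have B := convolution_derive1_defined omega c2 hk halpha m2 hb acg.
  have C := convolution2_defined omega c1 c2 hk halpha m1 m2 hb hf.
  apply: ae_imp (ae_and B C) => t [{}B {}C] t0b.
  rewrite !kPrabhakar_defined_convolution//; split; first exact: B t0b.
  split; last exact: C t0b.
  apply: ae_imp A => u {}A /andP[u0 ut]; rewrite kPrabhakar_defined_convolution//.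
  by apply: A; rewrite u0 (lt_trans ut)//; case/andP: t0b.
move=> t t0b; have t0 : 0 < t by case/andP: t0b.
rewrite !kPrabhakar_defined_convolution// => -[_ iH] [_ iR].
rewrite (convolution_derive1_convolution hk halpha m1 m2 hb hf t0b iH iR) mE cE.
exact: aux (kPrabhakar_kernelE alpha mu omega (- gamma) hk t0).
Qed.
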